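(* Let $a\in L^1_{\mathrm{loc}}(\mathbb{R}_+;L^\infty(\mathbb{R}))$ generate a unique Filippov flow $X=X_t(x,s)$, and assume that $a(\cdot,t)$ has one-sided limits (at every point of $\mathbb{R}$) for a.e. $t>0$. If $v\in L^\infty(\mathbb{R}\times\mathbb{R}_+)$ is a weak solution of the continuity equation $\partial_t v+\partial_x(av)=0$ with initial data $v_0\in L^\infty(\mathbb{R})$, then $$v(\cdot,t)=(X_t)_\# v_0,\qquad\text{where } X_t(x)=X_t(x,0).$$ More generally, $v(\cdot,t)=X_t(\cdot,s)_\#\, v(\cdot,s)$ for any $t\geq s\geq 0$.
   Context: $\mathbb{R}_+=[0,\infty)$. Weak solution of the continuity equation: $v\in L^\infty(\mathbb{R}\times\mathbb{R}_+)$ with $\int_{\mathbb{R}_+}\int_{\mathbb{R}}(\partial_t\varphi+a\,\partial_x\varphi)v\,dx\,dt+\int_{\mathbb{R}}\varphi(x,0)v_0(x)\,dx=0$ for all $\varphi\in C_c^\infty(\mathbb{R}\times\mathbb{R}_+)$. Such a $v$ has a representative for which $t\mapsto v(\cdot,t)$ is weak-$*$ continuous into $L^\infty(\mathbb{R})$ on $[0,\infty)$ with $v(\cdot,0)=v_0$; pointwise-in-time statements refer to this representative. Pushforward: for measurable $Y:\mathbb{R}\to\mathbb{R}$, $w=Y_\# w_0$ means $\int_{\mathbb{R}} w(x)\psi(x)\,dx=\int_{\mathbb{R}} w_0(x)\psi(Y(x))\,dx$ for all $\psi\in C_c(\mathbb{R})$. Filippov flow: put $\underline a(x,t)=\lim_{\delta\downarrow0}\operatorname{ess\,inf}_{y\in(x-\delta,x+\delta)}a(y,t)$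 and $\overline a(x,t)=\lim_{\delta\downarrow0}\operatorname{ess\,sup}_{y\in(x-\delta,x+\delta)}a(y,t)$. A Filippov flow generated by $a$ is a measurable function $X=X_t(x,s)$, defined for $x\in\mathbb{R}$ and $0\leq s\leq t$, such that (i) $X_s(x,s)=x$; (ii) for all $x\in\mathbb{R}$, $s\ge0$, the map $t\mapsto X_t(x,s)$ is absolutely continuous and $\underline a(X_t(x,s),t)\leq\frac{d}{dt}X_t(x,s)\leq\overline a(X_t(x,s),t)$ for a.e. $t>s$; (iii) $X_t(X_\tau(x,s),\tau)=X_t(x,s)$ for all $x\in\mathbb{R}$, $0\leq s\leq\tau\leq t$. Uniqueness of the Filippov flow is equivalent to the existence of exactly one absolutely continuous solution of the differential inclusion $\underline a(x_t,t)\leq\dot x_t\leq\overline a(x_t,t)$ (a.e. $t>s$) from every initial point $(x,s)\in\mathbb{R}\times\mathbb{R}_+$. *)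

(* Defs.v *)
From HB Require Import structures.
From mathcomp Require Import all_boot all_order all_algebra.
From mathcomp Require Import all_classical all_reals all_analysis.
From mathcomp Require Import ess_sup_inf.

Set Implicit Arguments.
Unset Strict Implicit.
Unset Printing Implicit Defensive.

Import Order.TTheory GRing.Theory Num.Theory.
Import numFieldNormedType.Exports.

Local Open Scope classical_set_scope.
Local Open Scope ring_scope.

(* Points of the half-plane are pairs (x, t): space first, time second.
   Fields and densities are functions on all of R * R, but only their values
   on [halfplane R] are ever used.  Elements of L^infty-type spaces are given
   by Borel measurable representatives. *)

Definition halfplane (R : realType) : set (R * R) := [set z | 0 <= z.2].

Definition L1loc_Linfty (R : realType) (a : R * R -> R) : Prop :=
  measurable_fun (@halfplane R) a /\
  forall T : R, 0 < T ->
    (@lebesgue_measure R).-integrable `[0, T]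
      (fun t => Lnorm (@lebesgue_measure R) +oo%E (fun x => (a (x, t))%:E)).

Definition Linfty (R : realType) (f : R -> R) : Prop :=
  f \in Lfun (@lebesgue_measure R) +oo%E.

Definition Linfty_halfplane (R : realType) (v : R * R -> R) : Prop :=
  v \_ (@halfplane R) \in
    Lfun ((@lebesgue_measure R) \x (@lebesgue_measure R))%E +oo%E.

(* The property is one of the class of f in L^infty(R): some representative
   has a left and a right limit at every point. *)
Definition has_one_sided_limits (R : realType) (f : R -> R) : Prop :=
  exists b : R -> R,
    {ae @lebesgue_measure R, forall x, b x = f x} /\
    forall x : R, cvg (b y @[y --> x^'-]) /\ cvg (b y @[y --> x^'+]).

Definition ess_inf_ball (R : realType) (f : R -> R) (x d : R) : \bar R :=
  ess_inf (mrestr (@lebesgue_measure R) (measurable_itv `]x - d, x + d[))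
    (EFin \o f).

Definition ess_sup_ball (R : realType) (f : R -> R) (x d : R) : \bar R :=
  ess_sup (mrestr (@lebesgue_measure R) (measurable_itv `]x - d, x + d[))
    (EFin \o f).

Definition lower_env (R : realType) (a : R * R -> R) (x t : R) : \bar R :=
  lim (ess_inf_ball (fun y => a (y, t)) x d @[d --> 0^'+]).

Definition upper_env (R : realType) (a : R * R -> R) (x t : R) : \bar R :=
  lim (ess_sup_ball (fun y => a (y, t)) x d @[d --> 0^'+]).

Definition absolutely_continuous_on (R : realType) (f : R -> R) (a b : R) :
    Prop :=
  forall e : R, 0 < e -> exists2 d : R, 0 < d &
    forall (n : nat) (l r : 'I_n -> R),
      (forall i, [/\ a <= l i, l i <= r i & r i <= b]) ->
      trivIset setT (fun i => `]l i, r i[%classic) ->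
      \sum_(i < n) (r i - l i) < d ->
      \sum_(i < n) `|f (r i) - f (l i)| < e.

(* [X t x s] is X_t(x,s); only its values for 0 <= s <= t matter. *)
Definition filippov_flow (R : realType) (a : R * R -> R) (X : R -> R -> R -> R)
    : Prop :=
  [/\ measurable_fun [set z : R * R * R | 0 <= z.1.2 <= z.2]
        (fun z : R * R * R => X z.2 z.1.1 z.1.2),
      forall x s : R, 0 <= s -> X s x s = x,
      forall x s : R, 0 <= s ->
        (forall T : R, s <= T ->
           absolutely_continuous_on (fun t => X t x s) s T) /\
        {ae @lebesgue_measure R, forall t : R, s < t ->
           derivable (fun r => X r x s) t 1 /\
           (lower_env a (X t x s) t <= (derive1 (fun r => X r x s) t)%:E
              <= upper_env a (X t x s) t)%E} &
      forall x s tau t : R, 0 <= s -> s <= tau -> tau <= t ->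
        X t (X tau x s) tau = X t x s].

Definition unique_filippov_flow (R : realType) (a : R * R -> R)
    (X : R -> R -> R -> R) : Prop :=
  filippov_flow a X /\
  forall Y : R -> R -> R -> R, filippov_flow a Y ->
    forall x s t : R, 0 <= s -> s <= t -> Y t x s = X t x s.

Definition compactly_supported (R : realType) (T : topologicalType)
    (f : T -> R) : Prop :=
  compact (closure [set z | f z != 0]).

Definition dx (R : realType) (f : R * R -> R) (z : R * R) : R :=
  'D_((1, 0) : R * R) f z.

Definition dt (R : realType) (f : R * R -> R) (z : R * R) : R :=
  'D_((0, 1) : R * R) f z.

(* The boolean word w encodes an iterated partial derivative, [true] standing
   for the time derivative. *)
Definition smooth2 (R : realType) (f : R * R -> R) : Prop :=
  forall w : seq bool,
    let g := foldr (fun (b : bool) h => if b then dt h else dx h) f w in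
    continuous g /\
    forall z : R * R,
      derivable g z ((1, 0) : R * R) /\ derivable g z ((0, 1) : R * R).

(* C_c^infty(R x [0, +oo[) consists of the restrictions to the closed
   half-plane of the smooth compactly supported functions on the plane, so no
   vanishing at t = 0 is imposed. *)
Definition test_function (R : realType) (phi : R * R -> R) : Prop :=
  smooth2 phi /\ compactly_supported phi.

Definition weak_solution (R : realType) (a v : R * R -> R) (v0 : R -> R) :
    Prop :=
  forall phi : R * R -> R, test_function phi ->
    ((\int[@lebesgue_measure R]_(t in `[0%R, +oo[)
        (\int[@lebesgue_measure R]_x
           ((dt phi (x, t) + a (x, t) * dx phi (x, t)) * v (x, t))%:E))
     + (\int[@lebesgue_measure R]_x (phi (x, 0) * v0 x)%:E) = 0)%E.

(* [w t] is v(.,t) for the representative of v that is weak-* continuous in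
   time, with values in L^infty(R) = L^1(R)^*. *)
Definition weak_star_representative (R : realType) (v : R * R -> R)
    (v0 : R -> R) (w : R -> R -> R) : Prop :=
  [/\ forall t : R, 0 <= t -> Linfty (w t),
      {ae @lebesgue_measure R, forall t : R, 0 <= t ->
         {ae @lebesgue_measure R, forall x : R, w t x = v (x, t)}},
      {ae @lebesgue_measure R, forall x : R, w 0 x = v0 x} &
      forall g : R -> R,
        (@lebesgue_measure R).-integrable setT (EFin \o g) ->
        {within `[0, +oo[, continuous
           (fun t : R => \int[@lebesgue_measure R]_x (w t x * g x))}].

Definition is_pushforward (R : realType) (Y w0 w : R -> R) : Prop :=
  measurable_fun setT Y /\
  forall psi : R -> R, continuous psi -> compactly_supported psi ->
    (\int[@lebesgue_measure R]_x (w x * psi x)%:E =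
     \int[@lebesgue_measure R]_x (w0 x * psi (Y x))%:E)%E.

(* Main.v *)
Require Import Defs.
From HB Require Import structures.
From mathcomp Require Import all_boot all_order all_algebra.
From mathcomp Require Import all_classical all_reals all_analysis.
From mathcomp Require Import lra ring.
From mathcomp Require Import ess_sup_inf measurable_realfun.

Set Implicit Arguments.
Unset Strict Implicit.
Unset Printing Implicit Defensive.

Import Order.TTheory GRing.Theory Num.Theory.
Import numFieldNormedType.Exports.

Local Open Scope classical_set_scope.
Local Open Scope ring_scope.

(* Let g_y be the Filippov curve started at time s with g_y(t) = y; it exists
   because X_t(., s) is monotone and onto. When the equation is tested with a
   mollified indicator, of width d, of the moving interval between g_y1 and
   g_y2, the transport terms at the two ends cancel up to the essential
   oscillation of a(., r) on the balls of radius 2d about g_y1(r) and g_y2(r).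
   A function with one-sided limits has only countably many points at which
   its oscillation does not vanish, and y |-> g_y(r) is injective; by Fubini,
   for a.e. y the oscillation along g_y tends to 0 with d for a.e. r. So, for
   almost all y1 < y2, v has the same mass in [y1, y2[ at time t as in
   [g_y1(s), g_y2(s)[ at time s, and step functions with such nodes
   approximate every continuous test function.

   Uniqueness of the flow yields uniqueness of curves: the flow may be
   redirected along any given curve from the first time it meets it, and the
   result is again a Filippov flow. *)

(** Curves are labelled by their end point at time t, not by their starting point. Trajectories may
    merge, so a set of positive measure of starting points could be carried along a single line of
    discontinuity of a; trajectories with distinct end points, however, have not met before t. That
    the flow map is onto rests on the closure of Filippov curves under pointwise limits. A limit
    curve inherits only the bound of its increments by the integral of the norm of a, so its
    derivative is obtained through Radon-Nikodym. The cancellation at the moving ends is exact only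
    infinitesimally. Over a time step the centre of the mollified step is frozen, which leaves an
    error quadratic in the integral of the norm of a. The width d is kept fixed while the time steps
    are refined, and only then tends to 0; the constants may therefore blow up with d. Joint
    measurability being part of the definition of a flow, redirection also requires that the set of
    (x, s, t) for which a meeting has occurred be measurable. *)

(** Compactness of [s, t] in additive form, for intervals tagged by a point they contain: the
    supremum of the points reachable from s is itself reachable, and would be passed if it were less
    than t. It replaces the extraction of finite subcovers throughout. *)
Lemma cousin (R : realType) (D : R -> R -> Prop) (s t : R) : s <= t ->
  (forall x, s <= x <= t -> exists2 e, 0 < e & forall u v,
     s <= u -> u <= x -> x <= v -> v <= t -> v - u < e -> D u v) ->
  (forall x y z, s <= x -> x <= y -> y <= z -> z <= t ->
     D x y -> D y z -> D x z) ->
  D s t.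
Proof.
move=> st loc tr.
pose S := [set x | s <= x <= t /\ D s x].
have Ss : S s.
  split; first by rewrite lexx.
  have [|e e0 h] := loc s; first by rewrite lexx.
  by apply: h => //; rewrite subrr.
have Sub : ubound S t by move=> x [/andP[]].
have hS : has_sup S by split; [exists s|exists t].
have sxt : s <= sup S <= t.
  by apply/andP; split; [apply: ub_le_sup => //; exists t|apply: ge_sup => //; exists s].
have [e e0 h] := loc _ sxt.
(* x lies within e/2 below the supremum and v at most e/3 above it, so [x, v] has length less than e
   and is tagged by the supremum. *)
have [x Sx xlt] := sup_adherent (divr_gt0 e0 (ltr0Sn _ 1)) hS.
have xs : x <= sup S by apply: ub_le_sup => //; exists t.
pose v := Num.min (sup S + e / 3) t.
move: (sxt) => /andP[ss st'].
have sv : sup S <= v by rewrite /v le_min st' andbT; lra.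
have vt : v <= t by rewrite /v ge_min lexx orbT.
case: Sx => /andP[sx xt] Dx.
have Dv : D s v.
  apply: (tr s x v) => //; first by rewrite (le_trans xs).
  apply: h => //; have : v <= sup S + e / 3 by rewrite /v ge_min lexx.
  by move: xlt; lra.
have Sv : S v by split=> //; rewrite vt andbT (le_trans ss).
have vs : v <= sup S by apply: ub_le_sup => //; exists t.
suff -> : t = v by [].
have : v = sup S by apply/eqP; rewrite eq_le vs sv.
rewrite /v; case: (leP (sup S + e / 3) t) => //; lra.
Qed.

(* Concatenable form of a finite family of nonoverlapping intervals: endpoints
   are listed in increasing order. *)
Fixpoint chain (R : realType) (u v : R) (p : seq (R * R)) : Prop :=
  if p is q :: p' then [/\ u <= q.1, q.1 <= q.2 & chain q.2 v p'] else u <= v.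

Lemma chain_le (R : realType) (u v : R) p : chain u v p -> u <= v.
Proof.
elim: p u => [//|q p ih] u /= [uq qq /ih]; exact/le_trans/(le_trans uq).
Qed.

Lemma chain_cat (R : realType) (u v w : R) p q :
  chain u v p -> chain v w q -> chain u w (p ++ q).
Proof.
elim: p u => [|x p ih] u /=.
  case: q => [|y q] /=; first exact: le_trans.
  by move=> uv [vy yy c]; split=> //; exact: le_trans vy.
by move=> [ux xx c] cq; split=> //; exact: ih.
Qed.

Lemma chain_nth (R : realType) (u v : R) p i : chain u v p -> (i < size p)%N ->
  let q := nth (u, u) p i in [/\ u <= q.1, q.1 <= q.2 & q.2 <= v].
Proof.
elim: p u i => [//|x p ih] u [|i] /= [ux xx c] ip.
  by split => //; exact: chain_le c.
have [] := ih x.2 i c ip.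
rewrite (set_nth_default (u, u))// => h1 h2 h3; split => //.
by apply: le_trans h1; exact: le_trans xx.
Qed.

Lemma chain_lt (R : realType) (u v : R) p i j : chain u v p ->
  (i < j)%N -> (j < size p)%N ->
  (nth (u, u) p i).2 <= (nth (u, u) p j).1.
Proof.
elim: p u i j => [//|x p ih] u [|i] [|j]//= [ux xx c] ij jp.
  have [] := chain_nth c jp.
  by rewrite (set_nth_default (u, u)).
have := ih x.2 i j c ij jp.
by rewrite !(set_nth_default (u, u) (x.2, x.2))//; exact: (@ltn_trans j).
Qed.

Lemma absolutely_continuous_chain (R : realType) (f : R -> R) (s t e : R) :
  absolutely_continuous_on f s t -> 0 < e -> exists2 d : R, 0 < d &
  forall p, chain s t p -> \sum_(q <- p) (q.2 - q.1) < d ->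
    \sum_(q <- p) `|f q.2 - f q.1| < e.
Proof.
move=> acf e0; have [d d0 h] := acf _ e0; exists d => // p cp.
rewrite !(big_nth (s, s)) !big_mkord => pd.
apply: (h (size p) (fun i => (nth (s, s) p i).1) (fun i => (nth (s, s) p i).2)).
- by move=> i; exact: (chain_nth cp).
- move=> i j _ _ [x [/= ]]; rewrite !in_itv/= => /andP[ix xi] /andP[jx xj].
  apply/val_inj/eqP; case: (ltngtP i j) => //= ij.
    have := chain_lt cp ij (ltn_ord j); lra.
  have := chain_lt cp ij (ltn_ord i); lra.
- exact: pd.
Qed.

(** * Absolutely continuous functions and their derivatives *)

Section ac.
Variable R : realType.
Notation mu := (@lebesgue_measure R).
Implicit Types f g h : R -> R.

(** The increment is split at x and each half is estimated by the difference quotient at x, which is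
    why u and v must lie on either side of x. Intervals of this kind are the ones handled by
    [cousin]. *)
Lemma derivable_le0_local h (x e : R) : 0 < e -> derivable h x 1 -> derive1 h x <= 0 ->
  exists2 d, 0 < d & forall u v, u <= x -> x <= v -> v - u < d ->
    h v - h u <= e * (v - u).
Proof.
move=> e0 dh dle.
have : (fun r => r^-1 *: (h (r + x) - h x)) @ 0^' --> derive1 h x.
  rewrite derive1E; have := dh => /cvg_ex[l hl].
  have -> : 'D_1 h x = l by apply/cvg_lim => //; exact: hl.
  apply: cvg_trans hl; apply: near_eq_cvg; near=> r.
  by rewrite /= [_%:A]mulr1.
move=> /cvgrPdist_lt/(_ _ e0)[d /= d0 hd].
exists d => // u v ux xv uvd.
have key r : `|r| < d -> r != 0 -> r^-1 * (h (r + x) - h x) < e.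
  move=> rd r0; have := hd r; rewrite /ball_/= sub0r normrN.
  by move=> /(_ rd r0); rewrite ltr_norml => /andP[+ _]; rewrite /GRing.scale/=; lra.
have hv : h v - h x <= e * (v - x).
  have [->|vx] := eqVneq v x; first by rewrite !subrr mulr0.
  have vx0 : 0 < v - x by rewrite subr_gt0 lt_neqAle eq_sym vx.
  have := key (v - x); rewrite subrK gtr0_norm// => /(_ _ _)/ltW.
  by rewrite ler_pdivrMl// mulrC; apply; lra.
have hu : h x - h u <= e * (x - u).
  have [->|vx] := eqVneq u x; first by rewrite !subrr mulr0.
  have vx0 : 0 < x - u by rewrite subr_gt0 lt_neqAle vx.
  have ux1 : `|u - x| < d by rewrite ltr0_norm; lra.
  have ux2 : u - x != 0 by rewrite subr_eq0.
  have := key _ ux1 ux2; rewrite subrK.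
  have -> : (u - x)^-1 * (h u - h x) = (x - u)^-1 * (h x - h u).
    by field; rewrite ux2 gt_eqF.
  by move=> /ltW; rewrite ler_pdivrMl// mulrC.
by have := lerD hv hu; rewrite -mulrDr; lra.
Unshelve. all: by end_near. Qed.

Lemma itv_measure_lty (u v : R) : (mu `[u, v]%classic < +oo)%E.
Proof. by rewrite lebesgue_measure_itv; case: ifP => _; rewrite ltry. Qed.

Lemma integrable_bounded_itv f (u v M : R) : measurable_fun `[u, v] f ->
  (forall x, u <= x <= v -> `|f x| <= M) ->
  mu.-integrable `[u, v] (EFin \o f).
Proof.
move=> mf fM; apply: measurable_bounded_integrable => //.
  exact: itv_measure_lty.
exists M; split => //= y My x; rewrite /= in_itv/= => xuv.
by rewrite (le_trans (fM _ xuv))// ltW.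
Qed.

Lemma Rint_cst (u v c : R) : u <= v -> \int[mu]_(x in `[u, v]) c = c * (v - u).
Proof.
move=> uv; rewrite Rintegral_cst// [X in fine X]lebesgue_measure_itv/= lte_fin.
by move: uv; rewrite le_eqVlt => /predU1P[->|->]; rewrite ?ltxx ?subrr.
Qed.

Lemma integrable_itvS g (s t u v : R) : s <= u -> v <= t ->
  mu.-integrable `[s, t] (EFin \o g) -> mu.-integrable `[u, v] (EFin \o g).
Proof.
move=> su vt; apply: integrableS => //.
by apply: subset_itv; rewrite bnd_simp.
Qed.

Lemma Rint_split g (u v w : R) : u <= v -> v <= w ->
  mu.-integrable `[u, w] (EFin \o g) ->
  \int[mu]_(x in `[u, w]) g x =
  \int[mu]_(x in `[u, v]) g x + \int[mu]_(x in `[v, w]) g x.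
Proof.
move=> uv vw ig.
have := @Rintegral_itvB _ g (BLeft u) (BRight w) v ig; rewrite !bnd_simp => /(_ uv vw).
rewrite Rintegral_itv_obnd_cbnd; first by lra.
by apply: integrableS ig => //; apply: subset_itv; rewrite bnd_simp.
Qed.

(** Absolute continuity of the integral of g, applied to the union of the intervals, whose measure
    is the sum of their lengths. *)
Lemma dominated_ac f g (s t : R) : (forall x, 0 <= g x) ->
  mu.-integrable `[s, t] (EFin \o g) ->
  (forall u v, s <= u -> u <= v -> v <= t ->
     `|f v - f u| <= \int[mu]_(x in `[u, v]) g x) ->
  absolutely_continuous_on f s t.
Proof.
move=> g0 ig fg e e0.
have ig' : mu.-integrable setT (EFin \o (g \_ `[s, t])).
  by rewrite -restrict_EFin; apply/integrable_restrict => //; rewrite setTI.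
have [d [d0 hd]] := integral_normr_continuous ig' e0.
exists d => // n l r lr tI sd.
set A := \big[setU/set0]_(i < n) `]l i, r i[%classic.
have mA : measurable A by apply: bigsetU_measurable.
have muA : mu A = (\sum_(i < n) (r i - l i))%:E.
  rewrite /A measure_bigsetU_ord// -sumEFin; apply: eq_bigr => i _.
  rewrite [LHS]lebesgue_measure_itv/= lte_fin; have [_ lri _] := lr i.
  case: ltP => [_|rl]; first by rewrite -EFinB.
  suff -> : r i = l i by rewrite subrr.
  by apply/eqP; rewrite eq_le rl lri.
have muAd : (mu A < d%:E)%E by rewrite muA lte_fin.
have := hd A mA muAd.
apply: le_lt_trans.
apply: (@le_trans _ _ (\sum_(i < n) \int[mu]_(x in `[l i, r i]) g x)).
  by apply: ler_sum => i _; have [? ? ?] := lr i; apply: fg.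
rewrite -lee_fin.
have igi i : mu.-integrable `[l i, r i] (EFin \o g).
  by have [? ? ?] := lr i; exact: integrable_itvS ig.
have iA : mu.-integrable A (EFin \o (fun x => `|(g \_ `[s, t]) x|)).
  by apply: (@integrable_norm _ _ _ mu); apply: integrableS ig'.
rewrite /Rintegral fineK; last exact: integrable_fin_num.
rewrite -sumEFin integral_bigsetU_EFin//; last 3 first.
- exact: index_enum_uniq.
- exact: sub_trivIset tI.
- by have /integrableP[] := iA.
apply: lee_sum => i _; rewrite fineK; last exact: integrable_fin_num.
rewrite -[leRHS](@integral_itv_bndoo _ _ _ _ true false); last first.
  have /integrableP[+ _] := iA; apply: measurable_funS => //.
  by rewrite /A (bigD1 i)//=; apply: subsetUl.
apply: ge0_le_integral => //.
- by move=> x _; rewrite lee_fin.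
- by have /integrableP[] := igi i.
- have /integrableP[/measurable_EFinP mg _] := ig'.
  by apply/measurable_EFinP; apply: measurableT_comp => //; exact: measurable_funTS.
- move=> x; rewrite /= in_itv/= => /andP[lx xr]; rewrite lee_fin patchE ifT ?ger0_norm//.
  have [sl _ rt] := lr i.
  by rewrite inE/= in_itv/= (le_trans sl)//= (le_trans xr).
Qed.

Lemma primitive_diff g (s t u v : R) : mu.-integrable `[s, t] (EFin \o g) ->
  s <= u -> u <= v -> v <= t ->
  \int[mu]_(x in `[s, v]) g x - \int[mu]_(x in `[s, u]) g x =
  \int[mu]_(x in `[u, v]) g x.
Proof.
move=> ig su uv vt; rewrite (Rint_split su uv); first by lra.
exact: integrable_itvS ig.
Qed.

Lemma primitive_ac g (s t : R) : mu.-integrable `[s, t] (EFin \o g) ->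
  absolutely_continuous_on (fun x => \int[mu]_(y in `[s, x]) g y) s t.
Proof.
move=> ig; apply: (@dominated_ac _ (fun x => `|g x|)) => //.
  exact: (@integrable_norm _ _ _ mu).
move=> u v su uv vt; rewrite (@primitive_diff _ _ t)//.
by apply: le_normr_Rintegral => //; exact: integrable_itvS ig.
Qed.

Lemma acD f g (s t : R) : absolutely_continuous_on f s t ->
  absolutely_continuous_on g s t ->
  absolutely_continuous_on (fun x => f x + g x) s t.
Proof.
move=> acf acg e e0.
have e2 : 0 < e / 2 by lra.
have [d d0 hd] := acf _ e2; have [d' d0' hd'] := acg _ e2.
exists (Num.min d d') => [|n l r lr tI]; first by rewrite lt_min d0.
rewrite lt_min => /andP[sd sd'].
have := ltrD (hd _ _ _ lr tI sd) (hd' _ _ _ lr tI sd').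
rewrite -splitr; apply: le_lt_trans; rewrite -big_split/=.
apply: ler_sum => i _; rewrite opprD addrACA; exact: ler_normD.
Qed.

Lemma acN f (s t : R) : absolutely_continuous_on f s t ->
  absolutely_continuous_on (fun x => - f x) s t.
Proof.
move=> acf e e0; have [d d0 hd] := acf _ e0; exists d => // n l r lr tI sd.
apply: le_lt_trans (hd _ _ _ lr tI sd).
by apply: ler_sum => i _; rewrite -opprD normrN.
Qed.

Lemma ac_continuity f (s t : R) : absolutely_continuous_on f s t ->
  forall e, 0 < e -> exists2 d, 0 < d & forall u v, s <= u -> u <= v -> v <= t ->
    v - u < d -> `|f v - f u| < e.
Proof.
move=> acf e e0; have [d d0 hd] := acf _ e0; exists d => // u v su uv vt uvd.
have := hd 1%N (fun=> u) (fun=> v); rewrite !big_ord1; apply => //.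
by move=> i j _ _ _; rewrite !ord1.
Qed.

(** The exceptional null set lies in an open U of measure less than d. Intervals tagged in U are
    collected in a chain whose total length is controlled by the measure of U, so absolute
    continuity makes their increments small; at any other tag [derivable_le0_local] applies. *)
Lemma ac_le0 h (s t : R) : s <= t -> absolutely_continuous_on h s t ->
  {ae mu, forall x, s < x < t -> derivable h x 1 /\ derive1 h x <= 0} ->
  h t <= h s.
Proof.
move=> st ach aeh; rewrite -subr_le0; apply/ler_addgt0Pr => e0 e00; rewrite add0r.
(* The chain will contribute e and the remaining intervals e (t - s); together they make e0. *)
pose e := e0 / (1 + (t - s)).
have ts1 : 0 < 1 + (t - s) by lra.
have e_gt0 : 0 < e by rewrite divr_gt0.
have [d d_gt0 hd] := absolutely_continuous_chain ach e_gt0.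
(* Nothing is assumed at the two end points, so they join the exceptional set. *)
pose B := [set x | ~ (s < x < t -> derivable h x 1 /\ derive1 h x <= 0)] `|` [set s; t].
have [N [mN N0 BN]] : mu.-negligible B.
  apply: negligibleU => //; apply/negligibleP; first by apply: measurableU.
  by apply: (@countable_lebesgue_measure0 R); apply: finite_set_countable.
have Nlt : (mu N < +oo)%E by rewrite N0.
have [U [oU NU Ud]] := lebesgue_regularity_outer mN Nlt d_gt0.
have mU : measurable U by exact: open_measurable.
have muU : (mu U < d%:E)%E.
  have E : (mu U = mu (U `\` N) + mu (U `&` N))%E by exact: (measureDI mu).
  have Z : mu (U `&` N) = 0%E.
    apply: (@subset_measure0 _ _ _ mu (U `&` N) N) => //; exact: measurableI.
  by rewrite E Z adde0.
have iU u v : mu.-integrable `[u, v] (EFin \o \1_U).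
  apply: (@integrable_bounded_itv _ _ _ 1) => //.
  by move=> x _; rewrite indicE; case: (_ \in _); rewrite ?normr1 ?normr0.
pose m u v := \int[mu]_(x in `[u, v]) (\1_U x : R).
(* Each clause is additive under concatenation of intervals, as [cousin] demands. *)
pose D u v := exists p, [/\ chain u v p, \sum_(q <- p) (q.2 - q.1) <= m u v &
  h v - h u <= e * (v - u) + \sum_(q <- p) `|h q.2 - h q.1|].
have : D s t.
  apply: cousin => //; last first.
    move=> x y z sx xy yz zt [p [cp pm ph]] [q [cq qm qh]].
    exists (p ++ q); split; first exact: chain_cat cp cq.
      by rewrite big_cat/= /m (Rint_split xy yz) ?lerD.
    by rewrite big_cat/=; have := lerD ph qh; lra.
  move=> x /andP[sx xt]; have [Ux|nUx] := pselect (U x).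
    have /nbhs_ballP[r /= r0 rU] : nbhs x U by exact: open_nbhs_nbhs.
    exists r => // u v su ux xv vt uv.
    exists [:: (u, v)]; split => /=.
    - by split=> //; exact: (le_trans ux).
    - rewrite big_seq1 /m (@eq_Rintegral _ _ _ _ _ (cst 1)).
        by rewrite Rint_cst ?mul1r// (le_trans ux).
      move=> z; rewrite inE/= in_itv/= => /andP[uz zv].
      rewrite indicE mem_set//; apply: rU; rewrite /ball/=.
      by rewrite ltr_distlC; apply/andP; split; lra.
    - rewrite big_seq1/=; apply: (@le_trans _ _ `|h v - h u|); first exact: ler_norm.
      by rewrite lerDr mulr_ge0 ?(ltW e_gt0)//; have := le_trans ux xv; lra.
  have nB : ~ B x by move=> /BN/NU.
  have sxt : s < x < t.
    rewrite !lt_neqAle sx xt !andbT; apply/andP; split; apply/eqP => xE; apply: nB.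
      by right; left.
    by right; right.
  have [dx dx0] : derivable h x 1 /\ derive1 h x <= 0.
    by apply: contrapT => nh; apply: nB; left => /= /(_ sxt).
  have [r r0 hr] := derivable_le0_local e_gt0 dx dx0.
  exists r => // u v su ux xv vt uv; exists [::]; split => /=.
  - exact: (le_trans ux).
  - by rewrite big_nil Rintegral_ge0// => z _; rewrite indicE.
  - by rewrite big_nil addr0; exact: hr.
move=> [p [cp pm ph]].
have md : m s t < d.
  rewrite -lte_fin; apply: le_lt_trans muU.
  rewrite /m /Rintegral fineK; last exact: integrable_fin_num.
  by rewrite integral_indic// le_measure// ?inE//; first [exact: measurableI|exact: subIsetl].
have := hd p cp (le_lt_trans pm md) => pe.
have -> : e0 = e + e * (t - s) by rewrite /e; field; rewrite gt_eqF.
lra.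
Qed.

End ac.

Section ac_monotonicity.
Variable R : realType.
Notation mu := (@lebesgue_measure R).
Implicit Types f g h : R -> R.

Lemma ae_imp (P Q : R -> Prop) : (forall x, P x -> Q x) ->
  {ae mu, forall x, P x} -> {ae mu, forall x, Q x}.
Proof. by move=> PQ; apply: (@filterS _ _ (ae_filter_ringOfSetsType mu)). Qed.

Lemma ae_imp2 (P Q S : R -> Prop) : (forall x, P x -> Q x -> S x) ->
  {ae mu, forall x, P x} -> {ae mu, forall x, Q x} -> {ae mu, forall x, S x}.
Proof. by move=> PQ; apply: (@filterS2 _ _ (ae_filter_ringOfSetsType mu)). Qed.

Lemma is_derive1P f (x d : R) :
  derivable f x 1 /\ derive1 f x = d <-> is_derive x 1 f d.
Proof.
rewrite derive1E; split=> [[fx <-]|[fx <-]]//; exact: DeriveDef.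
Qed.

Lemma primitive_is_derive g (s t : R) : mu.-integrable `[s, t] (EFin \o g) ->
  {ae mu, forall x, s < x < t ->
     is_derive x 1 (fun y => \int[mu]_(z in `[s, y]) g z) (g x)}.
Proof.
move=> ig; pose g' := g \_ `[s, t].
have locg : locally_integrable setT g' by exact: integrable_locally.
have := lebesgue_differentiation locg; apply: ae_imp => x gx /andP[sx xt].
have g'E z : s <= z <= t -> g' z = g z.
  by move=> szt; rewrite /g' patchE ifT// inE/= in_itv.
rewrite -g'E ?(ltW sx) ?(ltW xt)//.
have ig' : mu.-integrable `[s, t] (EFin \o g').
  apply: eq_integrable ig => // z; rewrite inE/= in_itv/= => szt.
  by rewrite /= g'E.
have [] := @FTC1_lebesgue_pt _ g' (BLeft s) x t xt ig' sx gx.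
move=> dF F1; have /is_derive1P := conj dF F1.
apply: near_eq_is_derive; near=> y.
apply: eq_Rintegral => z; rewrite inE/= in_itv/= => /andP[sz zy].
rewrite g'E// sz/= (le_trans zy)//.
by near: y; exact: lt_le_nbhsl.
Unshelve. all: by end_near. Qed.

(** The difference of f and the primitive of g falls under [ac_le0]. *)
Lemma ac_le_integral f g (s t : R) : s <= t -> absolutely_continuous_on f s t ->
  mu.-integrable `[s, t] (EFin \o g) ->
  {ae mu, forall x, s < x < t -> derivable f x 1 /\ derive1 f x <= g x} ->
  f t - f s <= \int[mu]_(x in `[s, t]) g x.
Proof.
move=> st acf ig aef.
have := ac_le0 st (acD acf (acN (primitive_ac ig))).
rewrite set_itv1 Rintegral_set1 subr0 lerBlDr addrC -lerBlDr; apply.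
have := primitive_is_derive ig; move: aef; apply: ae_imp2 => x hf hg sxt.
have [df fg] := hf sxt; have dg := hg sxt.
have fD : is_derive x 1 f (derive1 f x) by apply/is_derive1P.
have /is_derive1P[dd ->] := is_deriveD fD (is_deriveN dg).
by rewrite subr_le0.
Qed.

Lemma ac_ge_integral f g (s t : R) : s <= t -> absolutely_continuous_on f s t ->
  mu.-integrable `[s, t] (EFin \o g) ->
  {ae mu, forall x, s < x < t -> derivable f x 1 /\ g x <= derive1 f x} ->
  \int[mu]_(x in `[s, t]) g x <= f t - f s.
Proof.
move=> st acf ig aef.
have := @ac_le_integral (fun x => - f x) (fun x => - g x) s t st (acN acf).
have -> : \int[mu]_(x in `[s, t]) - g x = - \int[mu]_(x in `[s, t]) g x.
  have := @RintegralZl _ _ _ mu _ g (-1) (measurable_itv `[s, t]) ig.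
  by rewrite mulN1r => <-; apply: eq_Rintegral => x _; rewrite mulN1r.
rewrite -opprD lerN2; apply; first by exact: integrableN ig.
move: aef; apply: ae_imp => x hf sxt; have [df gf] := hf sxt.
have fD : is_derive x 1 f (derive1 f x) by apply/is_derive1P.
have /is_derive1P[dd ->] := is_deriveN fD; split => //.
by rewrite lerN2.
Qed.

End ac_monotonicity.

Section integrable_real.
Context d (T : measurableType d) (R : realType) (mu : {measure set T -> \bar R}).
Variables (D : set T).
Hypothesis mD : measurable D.
Implicit Types f g : T -> R.

Lemma integrableRZ k f : mu.-integrable D (EFin \o f) ->
  mu.-integrable D (EFin \o (fun x => k * f x)).
Proof. by move=> /(integrableZl mD k). Qed.

Lemma integrableRD f g : mu.-integrable D (EFin \o f) ->
  mu.-integrable D (EFin \o g) -> mu.-integrable D (EFin \o (fun x => f x + g x)).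
Proof. exact: integrableD. Qed.

Lemma integrableRB f g : mu.-integrable D (EFin \o f) ->
  mu.-integrable D (EFin \o g) -> mu.-integrable D (EFin \o (fun x => f x - g x)).
Proof. exact: integrableB. Qed.

Lemma integrableR_le f g : measurable_fun D f ->
  (forall x, D x -> `|f x| <= g x) -> mu.-integrable D (EFin \o g) ->
  mu.-integrable D (EFin \o f).
Proof.
move=> mf fg; apply: le_integrable => //; first exact/measurable_EFinP.
by move=> x Dx /=; rewrite lee_fin (le_trans (fg _ Dx))// ler_norm.
Qed.

End integrable_real.

(** * Densities of functions with dominated increments *)

Section density_measure.
Variables (R : realType) (g : R -> R).
Notation mu := (@lebesgue_measure R).
Hypotheses (g0 : forall x, 0 <= g x) (mg : measurable_fun setT g).

(** The two properties of g are arguments so that the measure structure can be attached to the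
    resulting term. *)
Definition density_measure of (forall x, 0 <= g x) & measurable_fun setT g :=
  fun A : set (measurableTypeR R) => (\int[mu]_(x in A) (g x)%:E)%E.

Local Notation dm := (density_measure g0 mg).

Let dm0 : dm set0 = 0%E. Proof. exact: integral_set0. Qed.

Let dm_ge0 A : (0 <= dm A)%E.
Proof. by apply: integral_ge0 => x _; rewrite lee_fin. Qed.

Let dm_sigma_additive : semi_sigma_additive dm.
Proof.
move=> F mF tF mUF; rewrite /density_measure ge0_integral_bigcup//=.
- apply: is_cvg_ereal_nneg_natsum => n _.
  by apply: integral_ge0 => x _; rewrite lee_fin.
- by apply/measurable_EFinP; exact: measurable_funTS.
- by move=> x _; rewrite lee_fin.
Qed.

HB.instance Definition _ := isMeasure.Build _ _ _ dm dm0 dm_ge0 dm_sigma_additive.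

End density_measure.

Lemma min_lip (R : realType) (u v c : R) : u <= v -> Num.min v c - Num.min u c <= v - u.
Proof. by move=> uv; case: (leP u c) => ?; case: (leP v c) => ?; lra. Qed.

Lemma max_lip (R : realType) (u v c : R) : u <= v -> Num.max v c - Num.max u c <= v - u.
Proof. by move=> uv; case: (leP u c) => ?; case: (leP v c) => ?; lra. Qed.

Lemma clamp_lip (R : realType) (s t u v : R) : u <= v ->
  let c x := Num.max s (Num.min x t) in c u <= c v /\ c v - c u <= v - u.
Proof.
move=> uv; have muv : Num.min u t <= Num.min v t by rewrite le_min2.
split; first by rewrite le_max2.
rewrite ![Num.max s _]maxC; apply: (le_trans (max_lip _ muv)); exact: min_lip.
Qed.

Section dominated.
Variable R : realType.
Notation mu := (@lebesgue_measure R).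

Lemma lebesgue_stieltjes_itv (h : cumulative R R) (u v : R) : u <= v ->
  lebesgue_stieltjes_measure h `]u, v]%classic = (h v - h u)%:E.
Proof.
move=> uv; rewrite /lebesgue_stieltjes_measure/= /measure_extension measurable_mu_extE/=; last exact: is_ocitv.
by rewrite wlength_itv_bnd.
Qed.

(** By uniqueness of Stieltjes measures, those of h and h' add up to the measure of density g, and
    each summand is at most the sum. *)
Lemma stieltjes_dominated (h h' : cumulative R R) (g : R -> R)
    (g0 : forall x, 0 <= g x) (mg : measurable_fun setT g) :
  (forall u v : R, u <= v -> ((h v - h u)%:E + (h' v - h' u)%:E =
     \int[mu]_(x in `]u, v]) (g x)%:E)%E) ->
  lebesgue_stieltjes_measure h `<< mu.
Proof.
move=> hh'.
apply/null_content_dominatesP => A mA A0.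
pose ls := lebesgue_stieltjes_measure h.
pose ls' := lebesgue_stieltjes_measure h'.
have nd : nondecreasing (h \+ h').
  by move=> u v uv; apply: lerD; exact: cumulative_is_nondecreasing.
have rc : right_continuous (h \+ h').
  by move=> x; apply: cvgD; exact: cumulative_is_right_continuous.
pose H : cumulative R R := HB.pack (h \+ h') (isCumulative.Build R _ R (h \+ h') nd rc).
have E1 : lebesgue_stieltjes_measure H A = (ls A + ls' A)%E.
  rewrite (@lebesgue_stieltjes_measure_unique _ H (measure_add ls ls'))//.
    by rewrite [LHS]measure_addE.
  move=> _ [[u v] _ <-]/=.
  rewrite [RHS]measure_addE; have [uv|vu] := leP u v.
    rewrite [LHS]lebesgue_stieltjes_itv// [X in _ = (X + _)%E]lebesgue_stieltjes_itv//.
    by rewrite [X in _ = (_ + X)%E]lebesgue_stieltjes_itv// -EFinD/= opprD addrACA.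
  by rewrite set_itv_ge ?bnd_simp -?leNgt ?(ltW vu)// !measure0 adde0.
have E2 : lebesgue_stieltjes_measure H A = density_measure g0 mg A.
  rewrite (@lebesgue_stieltjes_measure_unique _ H (density_measure g0 mg))//.
  move=> _ [[u v] _ <-]/=; have [uv|vu] := leP u v.
    by rewrite [LHS]lebesgue_stieltjes_itv// [RHS]/density_measure -hh'// -EFinD/= opprD addrACA.
  by rewrite set_itv_ge ?bnd_simp -?leNgt ?(ltW vu)// !measure0.
have : (ls A <= 0)%E.
  apply: (@le_trans _ _ (ls A + ls' A)%E); first by rewrite leeDl.
  rewrite -E1 E2 /density_measure null_set_integral//.
  by apply/measurable_EFinP; exact: measurable_funTS.
by move=> ls0; apply/eqP; rewrite eq_le ls0/=.
Qed.

(** f need not be monotone, but with G a primitive of g both G + f and G - f are nondecreasing, and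
    their sum 2 G has density 2 g. So the Stieltjes measure of G + f is absolutely continuous;
    subtracting g from its Radon-Nikodym density leaves a density of f. *)
Lemma dominated_density (f g : R -> R) (s t : R) : s <= t -> (forall x, 0 <= g x) ->
  mu.-integrable `[s, t] (EFin \o g) ->
  (forall u v, s <= u -> u <= v -> v <= t ->
     `|f v - f u| <= \int[mu]_(x in `[u, v]) g x) ->
  exists2 r, mu.-integrable `[s, t] (EFin \o r) &
   forall u v, s <= u -> u <= v -> v <= t -> f v - f u = \int[mu]_(x in `[u, v]) r x.
Proof.
move=> st g0 ig fg.
(* Cumulative functions live on the whole line: clamping the argument extends G and f by constants
   outside [s, t]. *)
pose c x := Num.max s (Num.min x t).
have cP x : s <= c x <= t.
  by rewrite /c le_max lexx/= ge_max st/= ge_min lexx orbT.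
have cE x : s <= x <= t -> c x = x.
  move=> /andP[sx xt]; rewrite /c min_l// max_r//.
have clip u v : u <= v -> c u <= c v /\ c v - c u <= v - u.
  exact: clamp_lip.
pose G x := \int[mu]_(y in `[s, x]) g y.
have Gd u v : s <= u -> u <= v -> v <= t -> G v - G u = \int[mu]_(x in `[u, v]) g x.
  by move=> su uv vt; rewrite /G (primitive_diff ig).
(* [h false] is G + f and [h true] is G - f, both with clamped argument. *)
pose h (b : bool) x := G (c x) + (-1) ^+ b * f (c x).
have hd b u v : u <= v -> `|h b v - h b u| <= 2 * (G (c v) - G (c u)) /\ h b u <= h b v.
  move=> uv; have [cuv _] := clip _ _ uv.
  have /andP[scu _] := cP u; have /andP[_ cvt] := cP v.
  have := fg _ _ scu cuv cvt; rewrite -Gd// ler_norml => /andP[h1 h2].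
  by rewrite /h ler_norml; case: b; rewrite ?expr1 ?expr0; split; lra.
have nd b : nondecreasing (h b) by move=> u v uv; have [] := hd b _ _ uv.
have rc b : right_continuous (h b).
  move=> x; apply/cvgrPdist_lt => e e0.
  have e2 : 0 < e / 2 by lra.
  have [d d0 Hd] := ac_continuity (primitive_ac ig) e2.
  near=> y; have xy : x <= y by near: y; exact: nbhs_right_ge.
  have yd : y - x < d by rewrite ltrBlDl; near: y; apply: nbhs_right_lt; rewrite ltrDl.
  have [cxy cd] := clip _ _ xy; have /andP[sc _] := cP x; have /andP[_ ct] := cP y.
  rewrite distrC; apply: (le_lt_trans (hd b _ _ xy).1).
  have := Hd _ _ sc cxy ct (le_lt_trans cd yd).
  by rewrite -/(G _) -/(G _) ltr_norml => /andP[_]; lra.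
pose H b : cumulative R R := HB.pack (h b) (isCumulative.Build R _ R (h b) (nd b) (rc b)).
(* The clamped functions are constant off [s, t], so the density of their sum has to vanish
   there. *)
pose g2 := (fun x => 2 * g x) \_ `]s, t].
have ig2 : mu.-integrable `[s, t] (EFin \o (fun x => 2 * g x)).
  exact: integrableRZ ig.
have g20 x : 0 <= g2 x by rewrite /g2 patchE; case: ifP => // _; rewrite mulr_ge0.
have mg2 : measurable_fun setT g2.
  apply/(measurable_restrictT _ _).1 => //.
  have /integrableP[/measurable_EFinP m2 _] := ig2.
  by apply: measurable_funS m2 => //; apply: subset_itvr; rewrite bnd_simp.
have dom : lebesgue_stieltjes_measure (H false) `<< mu.
  apply: (@stieltjes_dominated _ (H true) g2 g20 mg2) => u v uv.
  have [cuv _] := clip _ _ uv.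
  have /andP[scu _] := cP u; have /andP[_ cvt] := cP v.
  have ic : mu.-integrable `[c u, c v] (EFin \o g) by exact: integrable_itvS ig.
  transitivity ((2 * \int[mu]_(x in `[c u, c v]) g x)%:E).
    by rewrite -EFinD -Gd//= /h expr0 expr1; congr (_%:E); lra.
  rewrite -RintegralZl// -Rintegral_itv_obnd_cbnd; last first.
    by apply: (@integrableS _ _ _ mu `[s, t]) => //; apply: subset_itv; rewrite bnd_simp.
  rewrite /Rintegral fineK; last first.
    apply: integrable_fin_num => //.
    by apply: (@integrableS _ _ _ mu `[s, t]) => //; apply: subset_itv; rewrite bnd_simp.
  rewrite integral_mkcond [RHS]integral_mkcond; apply: eq_integral => x _.
  rewrite /g2 !patchE; case: ifPn => [|].
    rewrite inE/= in_itv/= /c => /andP[ux xv].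
    have sx : s < x by apply: le_lt_trans ux; rewrite le_max lexx.
    have ux' : u < x.
      apply: contraTT ux; rewrite -!leNgt => xu; rewrite le_max; apply/orP; right.
      rewrite le_min xu/=; apply: (le_trans xv); rewrite ge_max st/=.
      by rewrite ge_min lexx orbT.
    move: xv; rewrite le_max leNgt sx/= le_min => /andP[xv xt].
    by rewrite ifT ?inE/= ?in_itv/= ?ux'// ifT// inE/= in_itv/= sx.
  rewrite notin_setE/= in_itv/= => /negP nx.
  case: ifPn => //; rewrite inE/= in_itv/= => /andP[ux xv].
  case: ifPn => //; rewrite inE/= in_itv/= => /andP[sx xt].
  case/negP: nx; rewrite /c gt_max sx/= gt_min ux/=.
  by rewrite le_max le_min xv xt orbT.
have mst : measurable (`]s, t]%classic : set (measurableTypeR R)) by exact: measurable_itv.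
have Hst : (lebesgue_stieltjes_measure (H false) `]s, t] < +oo)%E.
  by rewrite lebesgue_stieltjes_itv// ltry.
have dom' : mfrestr mst Hst `<< mu.
  apply/null_content_dominatesP => A mA A0; rewrite /mfrestr /mrestr.
  apply/eqP; rewrite eq_le measure_ge0 andbT.
  have /null_content_dominatesP/(_ A mA A0) <- := dom.
  by apply: le_measure; rewrite ?inE//; exact: measurableI.
have [r [r0 rfin ir rE]] := radon_nikodym_sigma_finite dom'.
have irr : mu.-integrable setT (EFin \o (fine \o r)).
  by apply: eq_integrable ir => // x _; rewrite /= fineK.
have irst : mu.-integrable `[s, t] (EFin \o (fine \o r)).
  exact: integrableS irr.
exists (fun x => fine (r x) - g x).
  exact: integrableRB irst ig.
move=> u v su uv vt.
have iruv := integrable_itvS su vt irst.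
rewrite RintegralB//; last exact: integrable_itvS ig.
rewrite -Gd// -[X in _ = X - _]Rintegral_itv_obnd_cbnd; last first.
  by apply: integrableS iruv => //; apply: subset_itvr; rewrite bnd_simp.
have muv : measurable (`]u, v]%classic : set (measurableTypeR R)) by exact: measurable_itv.
have -> : \int[mu]_(x in `]u, v]) fine (r x) = h false v - h false u.
  rewrite /Rintegral (eq_integral r); last by move=> x _; rewrite fineK.
  rewrite -rE//; transitivity (fine (lebesgue_stieltjes_measure (H false) (`]u, v] `&` `]s, t]))) => //.
  rewrite setIidl; last by apply: subset_itv; rewrite bnd_simp.
  by rewrite lebesgue_stieltjes_itv.
by rewrite /h expr0 !cE ?su ?(le_trans uv)// ?(le_trans su)//; lra.
Unshelve. all: by end_near. Qed.

End dominated.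

Section derivative.
Variable R : realType.
Notation mu := (@lebesgue_measure R).
Implicit Types f g h : R -> R.

(** Information on the right of x is enough because the derivative is known to exist. If d were
    negative, f minus its linear part would have derivative 0 at x, and f would decrease to the
    right of x at rate at least -d/2. *)
Lemma is_derive_ge0 f (x d : R) : is_derive x 1 f d ->
  (exists2 e, 0 < e & forall y, x <= y -> y - x < e -> f x <= f y) -> 0 <= d.
Proof.
move=> fd [e e0 fe]; rewrite leNgt; apply/negP => d0.
have hd : is_derive x 1 (fun y => f y - d * y) (d - d * 1).
  exact: is_deriveB.
have /is_derive1P[hx hx'] := hd.
have e2 : 0 < - d / 2 by lra.
have := derivable_le0_local e2 hx; rewrite hx' mulr1 subrr lexx => /(_ isT)[r r0 hr].
pose y := x + Num.min e r / 2.
have m0 : 0 < Num.min e r by rewrite lt_min e0.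
have me : Num.min e r <= e by rewrite ge_min lexx.
have mr : Num.min e r <= r by rewrite ge_min lexx orbT.
have h1 : f x <= f y by apply: fe; rewrite /y; lra.
have h2 : (f y - d * y) - (f x - d * x) <= - d / 2 * (y - x).
  by apply: hr; rewrite /y; lra.
have yx : 0 < y - x by rewrite /y; lra.
have := mulr_gt0 e2 yx; nra.
Qed.

Lemma density_is_derive f r (s t : R) : mu.-integrable `[s, t] (EFin \o r) ->
  (forall u v, s <= u -> u <= v -> v <= t -> f v - f u = \int[mu]_(x in `[u, v]) r x) ->
  {ae mu, forall x, s < x < t -> is_derive x 1 f (r x)}.
Proof.
move=> ir fr; have := primitive_is_derive ir; apply: ae_imp => x hx /andP[sx xt].
have H : is_derive x 1 (fun y => \int[mu]_(z in `[s, y]) r z) (r x) by apply: hx; rewrite sx.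
have := is_deriveD (is_derive_cst (f s) x 1) H; rewrite add0r.
apply: near_eq_is_derive; near=> y; have E : f y - f s = \int[mu]_(z in `[s, y]) r z.
  apply: fr => //; near: y; [exact: lt_le_nbhsr|exact: lt_le_nbhsl].
by rewrite -[LHS]/(f s + \int[mu]_(z in `[s, y]) r z) -E addrC subrK.
Unshelve. all: by end_near. Qed.

End derivative.

(** * Essential bounds on balls *)

Section ess_ball.
Variable R : realType.
Notation mu := (@lebesgue_measure R).
Implicit Types f g : R -> R.

Lemma ess_sup_ball_leP f (z d : R) y : reflect
  {ae mu, forall x, z - d < x < z + d -> ((f x)%:E <= y)%E}
  (ess_sup_ball f z d <= y)%E.
Proof.
apply: (iffP ess_supP) => -[N [mN N0 sN]].
- exists (N `&` `]z - d, z + d[); split.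
  + by apply: measurableI.
  + exact: N0.
  + move=> x /=; rewrite not_implyE => -[xz nf]; split; last by rewrite /= in_itv.
    exact: sN.
- exists (N `|` ~` `]z - d, z + d[); split.
  + by apply: measurableU => //; exact: measurableC.
  + suff : mu ((N `|` ~` `]z - d, z + d[) `&` `]z - d, z + d[) = 0%E by [].
    rewrite setIUl setICl setU0.
    by apply: (@subset_measure0 _ _ _ mu _ N) => //; exact: measurableI.
  + move=> x /= nf; have [xz|xz] := pselect (x \in `]z - d, z + d[); [left|by right].
    by apply: sN => /=; rewrite not_implyE; split=> //; rewrite in_itv in xz.
Qed.

Lemma ess_inf_ball_geP f (z d : R) y : reflect
  {ae mu, forall x, z - d < x < z + d -> (y <= (f x)%:E)%E}
  (y <= ess_inf_ball f z d)%E.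
Proof.
have -> : ess_inf_ball f z d = (- ess_sup_ball (fun x => (- f x)%R) z d)%E.
  by rewrite /ess_inf_ball ess_infEN.
rewrite leeNr; apply: (iffP (ess_sup_ball_leP _ _ _ _)); apply: ae_imp => x h /h.
  by rewrite EFinN leeN2.
by rewrite EFinN leeN2.
Qed.

End ess_ball.

Section ess_ball_measurable.
Variable R : realType.
Notation mu := (@lebesgue_measure R).
Implicit Types f g : R -> R.

(** Superlevel sets of the essential supremum become conditions on the measure of a section; joint
    measurability in centre and time then follows from that of section measures. *)
Lemma ess_sup_ball_gtP f (z d : R) c : measurable_fun setT f ->
  (c < ess_sup_ball f z d)%E =
  (0 < mu [set x : R | (z - d < x < z + d)%R /\ (c < (f x)%:E)%E])%E.
Proof.
move=> mf; set A := [set x | _].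
have mA : measurable A.
  have -> : A = `]z - d, z + d[ `&` (EFin \o f) @^-1` `]c, +oo[.
    by apply/seteqP; split => x /=; rewrite !in_itv/= andbT.
  apply: measurableI => //; rewrite -[X in measurable X]setTI.
  have /measurable_EFinP := mf; apply => //; exact: emeasurable_itv.
apply/idP/idP.
  rewrite ltNge => /ess_sup_ball_leP h; rewrite lt0e measure_ge0 andbT.
  apply/eqP => A0; apply: h; exists A; split => //.
  by move=> x /=; rewrite not_implyE => -[xz /negP]; rewrite -ltNge => cf; split.
move=> A0; rewrite ltNge; apply/negP => /ess_sup_ball_leP h.
move: A0; suff -> : mu A = 0%E by rewrite ltxx.
apply/negligibleP => //; move: h; apply: negligibleS => x [xz cf] /= /(_ xz).
by rewrite leNgt cf.
Qed.

Lemma measurable_ess_sup_ball (b : R * R -> R) (d : R) : measurable_fun setT b ->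
  measurable_fun setT
    (fun p : R * R => ess_sup_ball (fun y => b (y, p.2)) p.1 d).
Proof.
move=> mb.
apply: (measurability _ (ErealGenOInfty.measurableE R)) => _ [_ [c ->] <-].
rewrite setTI.
pose E := [set q : (R * R) * R | q.1.1 - d < q.2 < q.1.1 + d /\ c < b (q.2, q.1.2)].
have mE : measurable E.
  have m1 : measurable_fun setT (fun q : (R * R) * R => q.1.1).
    by apply: measurableT_comp.
  have m2 : measurable_fun setT (fun q : (R * R) * R => b (q.2, q.1.2)).
    apply: measurableT_comp => //; apply: measurable_fun_pair => //.
    exact: measurableT_comp.
  have -> : E = [set q | 0 < (q.2 - (q.1.1 - d))] `&` [set q | 0 < (q.1.1 + d) - q.2]
     `&` [set q | 0 < b (q.2, q.1.2) - c].
    apply/seteqP; split => q /=.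
      by move=> [/andP[h1 h2] h3]; do !split; lra.
    by move=> [[h1 h2] h3]; split; [apply/andP; split; lra|lra].
  have mpos (h : (R * R) * R -> R) : measurable_fun setT h -> measurable [set q | 0 < h q].
    move=> mh; have -> : [set q | 0 < h q] = setT `&` h @^-1` `]0, +oo[.
      by rewrite setTI; apply/seteqP; split => q /=; rewrite in_itv/= andbT.
    by apply: mh.
  apply: measurableI; first apply: measurableI; apply: mpos.
  - by apply: measurable_funB => //; apply: measurable_funB.
  - by apply: measurable_funB => //; apply: measurable_funD.
  - by apply: measurable_funB.
have := measurable_fun_xsection mu mE.
move=> /(_ measurableT `]0%E, +oo[%classic (emeasurable_itv _)); rewrite setTI.
congr (measurable _); apply/seteqP; split => p /=; rewrite !in_itv/= !andbT;
  (rewrite ess_sup_ball_gtP; last by apply: measurableT_comp);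
  suff -> : xsection E p = [set x | p.1 - d < x < p.1 + d /\ (c%:E < (b (x, p.2))%:E)%E] by [].
all: by apply/seteqP; split => x; rewrite /xsection/= inE/= lte_fin.
Qed.

Lemma measurable_ess_inf_ball (b : R * R -> R) (d : R) : measurable_fun setT b ->
  measurable_fun setT
    (fun p : R * R => ess_inf_ball (fun y => b (y, p.2)) p.1 d).
Proof.
move=> mb; have mNb : measurable_fun setT (fun p => - b p) by exact: measurableT_comp.
rewrite (_ : (fun p : R * R => _) = (fun p => - ess_sup_ball (fun y => (- b (y, p.2))%R) p.1 d)%E).
  by apply: measurableT_comp => //; exact: (measurable_ess_sup_ball _ mNb).
by apply/funext => p; rewrite /ess_inf_ball ess_infEN.
Qed.

End ess_ball_measurable.

(** * The essential oscillation of the field *)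

Section envelopes.
Variable R : realType.
Notation mu := (@lebesgue_measure R).
Variable a : R * R -> R.

Lemma lebesgue_setT_gt0 : (0 < mu [set: R])%E.
Proof. rewrite -set_itvNyy [X in (_ < X)%E]lebesgue_measure_itv/= addye// lt0y. Qed.

Definition ext_field : R * R -> R := a \_ (@halfplane R).

(** [fine] turns an infinite norm into 0, so this is a bound for the field only at the times singled
    out by [good_time]. *)
Definition speed (t : R) : R :=
  if 0 <= t then fine (Lnorm mu +oo%E (fun x => (a (x, t))%:E)) else 0.

Definition esup (d : R) (z t : R) : R :=
  fine (ess_sup_ball (fun y => ext_field (y, t)) z d).

Definition einf (d : R) (z t : R) : R :=
  fine (ess_inf_ball (fun y => ext_field (y, t)) z d).

Definition good_time (t : R) :=
  0 <= t /\ {ae mu, forall x, `|a (x, t)| <= speed t}.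

Lemma ext_fieldE x t : 0 <= t -> ext_field (x, t) = a (x, t).
Proof. by move=> t0; rewrite /ext_field patchE ifT// inE. Qed.

Lemma measurable_halfplane : measurable (@halfplane R).
Proof.
have -> : @halfplane R = setT `&` snd @^-1` `[0, +oo[.
  by rewrite setTI; apply/seteqP; split => q /=; rewrite in_itv/= andbT.
by apply: measurable_snd.
Qed.

Lemma measurable_ext_field : measurable_fun (@halfplane R) a -> measurable_fun setT ext_field.
Proof.
move=> ma; rewrite /ext_field; apply/(measurable_restrictT _ _).1 => //.
exact: measurable_halfplane.
Qed.

Lemma measurable_esup d : measurable_fun (@halfplane R) a ->
  measurable_fun setT (fun p : R * R => esup d p.1 p.2).
Proof.
move=> ma; have := measurable_ess_sup_ball d (measurable_ext_field ma).
by move=> h; exact: (measurableT_comp (fine_measurable measurableT) h).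
Qed.

Lemma measurable_einf d : measurable_fun (@halfplane R) a ->
  measurable_fun setT (fun p : R * R => einf d p.1 p.2).
Proof.
move=> ma; have := measurable_ess_inf_ball d (measurable_ext_field ma).
by move=> h; exact: (measurableT_comp (fine_measurable measurableT) h).
Qed.

Lemma speed_ge0 t : 0 <= speed t.
Proof. by rewrite /speed; case: ifP => // _; rewrite fine_ge0// Lnorm_ge0. Qed.

Lemma integrable_speed : L1loc_Linfty a -> forall s t, 0 <= s ->
  mu.-integrable `[s, t] (EFin \o speed).
Proof.
move=> [_ ia] s t s0.
have T0 : 0 < Num.max t 1 by rewrite lt_max ltr01 orbT.
apply: (@integrableS _ _ _ mu `[0, Num.max t 1]) => //.
  by apply: subset_itv; rewrite bnd_simp// le_max lexx.
have iT := ia _ T0.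
apply: le_integrable iT => //.
  have /integrableP[m _] := ia _ T0.
  apply: (eq_measurable_fun (EFin \o fine \o (fun t => Lnorm mu +oo%E (fun x => (a (x, t))%:E)))).
    by move=> x; rewrite inE/= in_itv/= => /andP[x0 _]; rewrite /speed x0.
  by apply/measurable_EFinP; exact: (measurableT_comp (fine_measurable measurableT) m).
move=> x; rewrite /= in_itv/= => /andP[x0 _]; rewrite /speed x0.
by case: Lnorm => //= ; rewrite ?normr0 ?lee_fin// leey.
Qed.

Lemma good_time_ae : L1loc_Linfty a -> {ae mu, forall t, 0 <= t -> good_time t}.
Proof.
move=> [ma ia].
have h n : {ae mu, forall t, `[0, n.+1%:R]%classic t -> Lnorm mu +oo%E (fun x => (a (x, t))%:E) \is a fin_num}.
  by apply: integrable_ae; [exact: measurable_itv|exact: ia].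
have := ae_foralln h; apply: ae_imp => t ht t0; split => //.
have tn : `[0, (Num.truncn t).+1%:R]%classic t.
  rewrite /= in_itv/= t0/= ltW//; exact: truncnS_gt.
have fN := ht _ tn.
rewrite /speed t0.
have : {ae mu, forall x, (`|(a (x, t))%:E| <= Lnorm mu +oo%E (fun x => (a (x, t))%:E))%E}.
  rewrite unlock /= ifT; first exact: ess_sup_ge.
  exact: lebesgue_setT_gt0.
by apply: ae_imp => x; rewrite -[X in (_ <= X)%E](fineK fN) lee_fin.
Qed.

End envelopes.

Section ess_ball_theory.
Variable R : realType.
Notation mu := (@lebesgue_measure R).
Implicit Types f g : R -> R.

Lemma ae_itv_ex (P : R -> Prop) (u v : R) : u < v -> {ae mu, forall x, P x} ->
  exists2 x, u < x < v & P x.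
Proof.
move=> uv [N [mN N0 sN]]; apply: contrapT => nP.
have : mu `]u, v[%classic = 0%E.
  apply: (@subset_measure0 _ _ _ mu _ N) => // x; rewrite /= in_itv/= => xuv.
  by apply: sN => /= Px; apply: nP; exists x.
rewrite lebesgue_measure_itv/= lte_fin uv -EFinB => /eqP; rewrite eqe subr_eq0.
by rewrite gt_eqF.
Qed.

Lemma ess_sup_ball_mono f (z z' d d' : R) : z - d <= z' - d' -> z' + d' <= z + d ->
  (ess_sup_ball f z' d' <= ess_sup_ball f z d)%E.
Proof.
move=> h1 h2; apply/ess_sup_ball_leP.
have /ess_sup_ball_leP := lexx (ess_sup_ball f z d).
apply: ae_imp => x H /andP[x1 x2]; apply: H; apply/andP; split; lra.
Qed.

Lemma ess_inf_ball_mono f (z z' d d' : R) : z - d <= z' - d' -> z' + d' <= z + d ->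
  (ess_inf_ball f z d <= ess_inf_ball f z' d')%E.
Proof.
move=> h1 h2; apply/ess_inf_ball_geP.
have /ess_inf_ball_geP := lexx (ess_inf_ball f z d).
apply: ae_imp => x H /andP[x1 x2]; apply: H; apply/andP; split; lra.
Qed.

(** The essential supremum is monotone in the radius, so its limit at 0 is an infimum over all
    radii. *)
Lemma upper_env_geP (a : R * R -> R) (z t : R) y :
  (y <= upper_env a z t)%E <->
  forall d, 0 < d -> (y <= ess_sup_ball (fun x => a (x, t)) z d)%E.
Proof.
set f := fun x => a (x, t).
have nd : {in Interval (BRight (0 : R)) +oo%O &, nondecreasing_fun (ess_sup_ball f z)}.
  by move=> d d' _ _ dd'; apply: ess_sup_ball_mono; lra.
have := @nondecreasing_at_right_cvge _ (ess_sup_ball f z) 0 +oo%O isT nd.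
move=> /cvg_lim E.
rewrite /upper_env E//; split.
  move=> h d d0; apply: (le_trans h); apply: ereal_inf_lbound.
  by exists d => //=; rewrite in_itv/= d0.
move=> h; apply: le_ereal_inf_tmp => _ [d /= + <-]; rewrite in_itv/= andbT; exact: h.
Qed.

Lemma lower_env_leP (a : R * R -> R) (z t : R) y :
  (lower_env a z t <= y)%E <->
  forall d, 0 < d -> (ess_inf_ball (fun x => a (x, t)) z d <= y)%E.
Proof.
set f := fun x => a (x, t).
have nd : {in Interval (BRight (0 : R)) +oo%O &, nonincreasing_fun (ess_inf_ball f z)}.
  by move=> d d' _ _ dd'; apply: ess_inf_ball_mono; lra.
have := @nonincreasing_at_right_cvge _ (ess_inf_ball f z) 0 +oo%O isT nd.
move=> /cvg_lim E.
rewrite /lower_env E//; split.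
  move=> h d d0; apply: le_trans h; apply: ereal_sup_ubound.
  by exists d => //=; rewrite in_itv/= d0.
move=> h; apply: ge_ereal_sup => _ [d /= + <-]; rewrite in_itv/= andbT; exact: h.
Qed.

Variable a : R * R -> R.
Notation esup := (esup a).
Notation einf := (einf a).

Lemma good_ball_bounds t z d : good_time a t -> 0 < d ->
  [/\ ess_sup_ball (fun y => ext_field a (y, t)) z d = (esup d z t)%:E,
      ess_inf_ball (fun y => ext_field a (y, t)) z d = (einf d z t)%:E,
      - speed a t <= einf d z t, einf d z t <= esup d z t &
      esup d z t <= speed a t].
Proof.
move=> [t0 at0] d0.
set f := fun y => ext_field a (y, t).
have fE : {ae mu, forall x, `|f x| <= speed a t}.
  by move: at0; apply: ae_imp => x; rewrite /f ext_fieldE.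
have sup_le : (ess_sup_ball f z d <= (speed a t)%:E)%E.
  apply/ess_sup_ball_leP; move: fE; apply: ae_imp => x + _.
  by rewrite lee_fin ler_norml => /andP[].
have inf_ge : ((- speed a t)%:E <= ess_inf_ball f z d)%E.
  apply/ess_inf_ball_geP; move: fE; apply: ae_imp => x + _.
  by rewrite lee_fin ler_norml => /andP[].
have inf_sup : (ess_inf_ball f z d <= ess_sup_ball f z d)%E.
  have /ess_sup_ball_leP h1 := lexx (ess_sup_ball f z d).
  have /ess_inf_ball_geP h2 := lexx (ess_inf_ball f z d).
  have zd : z - d < z + d by lra.
  have [x xz [/(_ xz) k1 /(_ xz) k2]] := ae_itv_ex zd (ae_imp2 (fun x => @conj _ _) h1 h2).
  exact: le_trans k2 k1.
have sfin : ess_sup_ball f z d \is a fin_num.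
  rewrite fin_numElt; apply/andP; split.
    by apply: lt_le_trans (le_trans inf_ge inf_sup); rewrite ltNyr.
  by apply: le_lt_trans sup_le _; rewrite ltry.
have ifin : ess_inf_ball f z d \is a fin_num.
  rewrite fin_numElt; apply/andP; split.
    by apply: lt_le_trans inf_ge; rewrite ltNyr.
  by apply: le_lt_trans (le_trans inf_sup sup_le) _; rewrite ltry.
rewrite /esup /einf !fineK//; split => //.
- by rewrite -lee_fin fineK.
- by rewrite fine_le.
- by rewrite -lee_fin fineK.
Qed.

Lemma good_ae_between t z d : good_time a t -> 0 < d ->
  {ae mu, forall x, z - d < x < z + d -> einf d z t <= a (x, t) <= esup d z t}.
Proof.
move=> gt d0; have [sE iE _ _ _] := good_ball_bounds z gt d0.
have /ess_sup_ball_leP := lexx (ess_sup_ball (fun y => ext_field a (y, t)) z d).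
have /ess_inf_ball_geP := lexx (ess_inf_ball (fun y => ext_field a (y, t)) z d).
rewrite sE iE; apply: ae_imp2 => x h1 h2 xz.
have [t0 _] := gt; move: (h1 xz) (h2 xz); rewrite !lee_fin ext_fieldE// => -> ->.
by [].
Qed.

Lemma good_mono t (z z' d d' : R) : good_time a t -> 0 < d' ->
  z - d <= z' - d' -> z' + d' <= z + d ->
  esup d' z' t <= esup d z t /\ einf d z t <= einf d' z' t.
Proof.
move=> gt d0 h1 h2; have d'0 : 0 < d by lra.
have [sE iE _ _ _] := good_ball_bounds z gt d'0.
have [sE' iE' _ _ _] := good_ball_bounds z' gt d0.
by rewrite -!lee_fin -sE -iE -sE' -iE'; split; [apply: ess_sup_ball_mono|apply: ess_inf_ball_mono].
Qed.

(** The inclusion becomes a family of real inequalities, one for each radius; in this form it can be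
    integrated along a curve and passed to limits. *)
Lemma good_env t (z y : R) : good_time a t ->
  (lower_env a z t <= y%:E <= upper_env a z t)%E <->
  forall d, 0 < d -> einf d z t <= y <= esup d z t.
Proof.
move=> gt; have t0 := gt.1.
have E : (fun x => a (x, t)) = (fun x => ext_field a (x, t)).
  by apply/funext => x; rewrite ext_fieldE.
split=> [/andP[/lower_env_leP h1 /upper_env_geP h2] d d0|h].
  have [sE iE _ _ _] := good_ball_bounds z gt d0.
  by rewrite -!lee_fin -sE -iE -E h1// h2.
apply/andP; split.
  apply/lower_env_leP => d d0; have [sE iE _ _ _] := good_ball_bounds z gt d0.
  by rewrite E iE lee_fin; have /andP[] := h d d0.
apply/upper_env_geP => d d0; have [sE iE _ _ _] := good_ball_bounds z gt d0.
by rewrite E sE lee_fin; have /andP[] := h d d0.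
Qed.

End ess_ball_theory.

Section local_bounds.
Variable R : realType.
Notation mu := (@lebesgue_measure R).
Implicit Types f g h : R -> R.

Lemma integrableR_ae_le d (T : measurableType d) (m : {measure set T -> \bar R})
    (D : set T) (f g : T -> R) : measurable D -> measurable_fun D f ->
  {ae m, forall x, D x -> `|f x| <= g x} -> m.-integrable D (EFin \o g) ->
  m.-integrable D (EFin \o f).
Proof.
move=> mD mf fg /integrableP[/measurable_EFinP mg ig].
apply/integrableP; split; first exact/measurable_EFinP.
apply: le_lt_trans ig; apply: ae_ge0_le_integral => //.
- by apply/measurable_EFinP; exact: measurableT_comp.
- by apply/measurable_EFinP; exact: measurableT_comp.
- move: fg; apply: (@filterS _ _ (ae_filter_ringOfSetsType m)) => x h Dx.
  by rewrite /= lee_fin (le_trans (h Dx))// ler_norm.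
Qed.

Lemma acS f (s t s' t' : R) : s <= s' -> t' <= t ->
  absolutely_continuous_on f s t -> absolutely_continuous_on f s' t'.
Proof.
move=> ss tt acf e e0; have [d d0 h] := acf e e0; exists d => // n l r lr.
apply: h => i; have [h1 h2 h3] := lr i; split=> //.
  exact: le_trans h1.
exact: le_trans tt.
Qed.

Lemma ac_continuous f (s t : R) : s <= t -> absolutely_continuous_on f s t ->
  continuous (fun x => f (Num.max s (Num.min x t))).
Proof.
move=> st acf x; apply/cvgrPdist_lt => e e0.
have [d d0 hd] := ac_continuity acf e0.
pose c x := Num.max s (Num.min x t).
have cP y : s <= c y <= t.
  by rewrite /c le_max lexx/= ge_max st/= ge_min lexx orbT.
have clip u v : u <= v -> c u <= c v /\ c v - c u <= v - u.
  exact: clamp_lip.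
exists d => // y /=; rewrite -/(c x) -/(c y) => xy.
have /andP[? ?] := cP x; have /andP[? ?] := cP y.
have [xley|/ltW ylex] := leP x y.
  have [? ?] := clip _ _ xley.
  by rewrite distrC; apply: hd => //; move: xy; rewrite distrC ger0_norm ?subr_ge0//; lra.
have [? ?] := clip _ _ ylex.
by apply: hd => //; move: xy; rewrite ger0_norm ?subr_ge0//; lra.
Qed.

(* Short-interval integral bounds suffice, the derivative being local. *)
Lemma derive_le_local f r g (s t : R) :
  mu.-integrable `[s, t] (EFin \o r) ->
  mu.-integrable `[s, t] (EFin \o g) ->
  {ae mu, forall x, s < x < t -> exists2 d, 0 < d & forall y, x <= y -> y <= t ->
     y - x < d -> f y - f x <= \int[mu]_(z in `[x, y]) g z} ->
  (forall u v, s <= u -> u <= v -> v <= t -> f v - f u = \int[mu]_(x in `[u, v]) r x) ->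
  {ae mu, forall x, s < x < t -> is_derive x 1 f (r x) /\ r x <= g x}.
Proof.
move=> ir ig loc fr.
have := ae_imp2 (fun x => @conj _ _) (density_is_derive ir fr) (primitive_is_derive ig).
move: loc; apply: ae_imp2 => x loc [hf hg] sxt; split; first exact: hf.
have [d d0 hd] := loc sxt; have /andP[sx xt] := sxt.
rewrite -subr_ge0; apply: (is_derive_ge0 (is_deriveB (hg sxt) (hf sxt))).
exists (Num.min d (t - x)); first by rewrite lt_min d0 subr_gt0.
move=> y xy; rewrite lt_min => /andP[yd yt].
have yt' : y <= t by lra.
have h1 := hd _ xy yt' yd; have h2 := primitive_diff ig (ltW sx) xy yt'.
change (\int[mu]_(z in `[s, x]) g z - f x <= \int[mu]_(z in `[s, y]) g z - f y).
lra.
Qed.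

End local_bounds.

(** * Filippov curves and the flow *)

Section curves.
Variable R : realType.
Notation mu := (@lebesgue_measure R).
Variable a : R * R -> R.
Hypothesis ha : L1loc_Linfty a.
Notation speed := (speed a).
Notation esup := (esup a).
Notation einf := (einf a).
Implicit Types (f g : R -> R) (s t u v : R).

Definition filippov_curve s g :=
  (forall T, s <= T -> absolutely_continuous_on g s T) /\
  {ae mu, forall t, s < t -> derivable g t 1 /\
     (lower_env a (g t) t <= (derive1 g t)%:E <= upper_env a (g t) t)%E}.

Let is_s s t : 0 <= s -> mu.-integrable `[s, t] (EFin \o speed) := @integrable_speed _ _ ha s t.

Lemma curve_derive s g : 0 <= s -> filippov_curve s g ->
  {ae mu, forall t, s < t -> [/\ derivable g t 1, good_time a t &
    forall d, 0 < d -> einf d (g t) t <= derive1 g t <= esup d (g t) t]}.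
Proof.
move=> s0 [_ gd]; have := good_time_ae ha; move: gd; apply: ae_imp2 => t h1 h2 st.
have [dg ge] := h1 st; have gt := h2 (le_trans s0 (ltW st)).
by split => //; apply/(good_env _ _ gt).
Qed.

Lemma curve_speed s g : 0 <= s -> filippov_curve s g ->
  {ae mu, forall t, s < t -> derivable g t 1 /\ `|derive1 g t| <= speed t}.
Proof.
move=> s0 gc; move: (curve_derive s0 gc); apply: ae_imp => t h st.
have [dg gt ge] := h st; split => //.
have [_ _ h1 h2 h3] := good_ball_bounds (g t) gt ltr01.
by have /andP[h4 h5] := ge _ ltr01; rewrite ler_norml; lra.
Qed.

Lemma curve_dist s g u v : 0 <= s -> filippov_curve s g ->
  s <= u -> u <= v -> `|g v - g u| <= \int[mu]_(x in `[u, v]) speed x.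
Proof.
move=> s0 gc su uv.
have acg : absolutely_continuous_on g u v.
  by apply: acS (gc.1 v _) => //; exact: le_trans uv.
have isuv := is_s v (le_trans s0 su).
have key f : absolutely_continuous_on f u v ->
  {ae mu, forall t, s < t -> derivable f t 1 /\ `|derive1 f t| <= speed t} ->
  f v - f u <= \int[mu]_(x in `[u, v]) speed x.
  move=> acf h; apply: ac_le_integral => //; move: h; apply: ae_imp => t h /andP[ut _].
  have [df le] := h (le_lt_trans su ut); split => //.
  by apply: le_trans le; exact: ler_norm.
rewrite ler_norml; apply/andP; split; last exact: key acg (curve_speed s0 gc).
rewrite lerNl opprB -[X in X - _]opprK addrC.
apply: (key (fun x => - g x)); first exact: acN.
move: (curve_speed s0 gc); apply: ae_imp => t h st; have [dg le] := h st.
have /is_derive1P[d1 ->] := is_deriveN (iffLR (is_derive1P _ _ _) (conj dg erefl)).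
by rewrite normrN.
Qed.

Lemma measurable_along (F : R -> R -> R) g s t :
  measurable_fun setT (fun p : R * R => F p.1 p.2) ->
  absolutely_continuous_on g s t ->
  measurable_fun `[s, t] (fun x => F (g x) x).
Proof.
move=> mF acg.
have [st|ts] := leP s t; last first.
  by rewrite set_itv_ge ?bnd_simp -?ltNge//; exact: measurable_fun_set0.
pose c (x : R) := Num.max s (Num.min x t).
have mc : measurable_fun setT (fun x => g (c x)).
  by apply: continuous_measurable_fun; exact: ac_continuous.
have mp : measurable_fun setT (fun x : R => (g (c x), x)) by exact: measurable_fun_pair.
apply: (@eq_measurable_fun _ _ _ _ _ (fun x : R => F (g (c x)) x)).
  by move=> x; rewrite inE/= in_itv/= => /andP[sx xt]; rewrite /c min_l// max_r.
by apply: measurable_funTS; exact: (measurableT_comp mF mp).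
Qed.

Lemma integrable_esup d g s t : 0 < d -> 0 <= s -> absolutely_continuous_on g s t ->
  mu.-integrable `[s, t] (EFin \o (fun x => esup d (g x) x)).
Proof.
move=> d0 s0 acg; apply: (@integrableR_ae_le _ _ _ mu _ _ speed) => //.
- by apply: (measurable_along (F := esup d)) acg; apply: measurable_esup; exact: ha.1.
- have := good_time_ae ha; apply: ae_imp => x h; rewrite /= in_itv/= => /andP[sx _].
  have [_ _ h1 h2 h3] := good_ball_bounds (g x) (h (le_trans s0 sx)) d0.
  by rewrite ler_norml; lra.
- exact: is_s.
Qed.

Lemma integrable_einf d g s t : 0 < d -> 0 <= s -> absolutely_continuous_on g s t ->
  mu.-integrable `[s, t] (EFin \o (fun x => einf d (g x) x)).
Proof.
move=> d0 s0 acg; apply: (@integrableR_ae_le _ _ _ mu _ _ speed) => //.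
- by apply: (measurable_along (F := einf d)) acg; apply: measurable_einf; exact: ha.1.
- have := good_time_ae ha; apply: ae_imp => x h; rewrite /= in_itv/= => /andP[sx _].
  have [_ _ h1 h2 h3] := good_ball_bounds (g x) (h (le_trans s0 sx)) d0.
  by rewrite ler_norml; lra.
- exact: is_s.
Qed.

(** * Pointwise limits of Filippov curves *)

Section closure.
Variables (s : R) (gn : nat -> R -> R) (g : R -> R).
Hypotheses (s0 : 0 <= s) (gnc : forall n, filippov_curve s (gn n)).
Hypothesis gng : forall t, s <= t -> gn n t @[n --> \oo] --> g t.

Lemma limit_dist u v : s <= u -> u <= v ->
  `|g v - g u| <= \int[mu]_(x in `[u, v]) speed x.
Proof.
move=> su uv.
have : `|gn n v - gn n u| @[n --> \oo] --> `|g v - g u|.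
  by apply: cvg_norm; apply: cvgB; apply: gng => //; exact: le_trans uv.
move=> /cvgr_to_le; apply; apply: nearW => n; exact: curve_dist (gnc n) su uv.
Qed.

Lemma limit_ac T : absolutely_continuous_on g s T.
Proof.
apply: (@dominated_ac _ _ speed) => //; first exact: speed_ge0.
  exact: is_s.
by move=> u v su uv _; exact: limit_dist.
Qed.

(** Closeness at the single time u propagates to [u, v] because neither curve moves by d/4 there.
    Three distances of d/4 and a radius of d/4 put the ball of radius d/4 about [gn n x] inside the
    ball of radius d about [g x]. *)
Lemma limit_close d u v : s <= u -> u <= v -> 0 < d ->
  \int[mu]_(x in `[u, v]) speed x < d / 4 ->
  \forall n \near \oo, forall x, u <= x -> x <= v ->
    g x - d <= gn n x - d / 4 /\ gn n x + d / 4 <= g x + d.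
Proof.
move=> su uv d0 sm; have d4 : 0 < d / 4 by lra.
have /cvgrPdist_lt/(_ _ d4) := gng su.
apply: filterS => n hn x ux xv.
have isv := is_s v (le_trans s0 su).
have sx : \int[mu]_(x in `[u, x]) speed x < d / 4.
  apply: le_lt_trans sm; rewrite (Rint_split ux xv) ?lerDl// Rintegral_ge0//.
  by move=> y _; exact: speed_ge0.
have h1 := le_lt_trans (limit_dist su ux) sx.
have h2 := le_lt_trans (curve_dist s0 (gnc n) su ux) sx.
move: hn h1 h2; rewrite !ltr_norml => /andP[? ?] /andP[? ?] /andP[? ?].
by split; lra.
Qed.

Lemma limit_le_esup d u v : s <= u -> u <= v -> 0 < d ->
  \int[mu]_(x in `[u, v]) speed x < d / 4 ->
  g v - g u <= \int[mu]_(x in `[u, v]) esup d (g x) x.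
Proof.
move=> su uv d0 sm; have d4 : 0 < d / 4 by lra.
have : gn n v - gn n u @[n --> \oo] --> g v - g u.
  by apply: cvgB; apply: gng => //; exact: le_trans uv.
move=> /cvgr_to_le; apply.
have := limit_close su uv d0 sm; apply: filterS => n hn.
apply: ac_le_integral => //.
- by apply: acS ((gnc n).1 v _) => //; exact: le_trans uv.
- apply: integrable_esup => //; first exact: le_trans su.
  by apply: acS (limit_ac v).
- move: (curve_derive s0 (gnc n)); apply: ae_imp => x h /andP[ux xv].
  have [dg gt ge] := h (le_lt_trans su ux); split => //.
  have [h1 h2] := hn x (ltW ux) (ltW xv).
  have /andP[_ h3] := ge _ d4; apply: (le_trans h3).
  by have [] := good_mono gt d4 h1 h2.
Qed.

Lemma limit_ge_einf d u v : s <= u -> u <= v -> 0 < d ->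
  \int[mu]_(x in `[u, v]) speed x < d / 4 ->
  \int[mu]_(x in `[u, v]) einf d (g x) x <= g v - g u.
Proof.
move=> su uv d0 sm; have d4 : 0 < d / 4 by lra.
have : gn n v - gn n u @[n --> \oo] --> g v - g u.
  by apply: cvgB; apply: gng => //; exact: le_trans uv.
move=> /cvgr_to_ge; apply.
have := limit_close su uv d0 sm; apply: filterS => n hn.
apply: ac_ge_integral => //.
- by apply: acS ((gnc n).1 v _) => //; exact: le_trans uv.
- apply: integrable_einf => //; first exact: le_trans su.
  by apply: acS (limit_ac v).
- move: (curve_derive s0 (gnc n)); apply: ae_imp => x h /andP[ux xv].
  have [dg gt ge] := h (le_lt_trans su ux); split => //.
  have [h1 h2] := hn x (ltW ux) (ltW xv).
  have /andP[h3 _] := ge _ d4; apply: le_trans h3.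
  by have [] := good_mono gt d4 h1 h2.
Qed.

(** The increments of g are dominated by the integral of [speed], so g has a density, which is its
    derivative almost everywhere. On short intervals the increments of the approximants are bounded
    by integrals of [einf] and [esup] along g itself, and these bounds no longer depend on n;
    differentiating the limit inequalities gives the inclusion for each radius. *)
Lemma limit_curve : filippov_curve s g.
Proof.
split=> [T _|]; first exact: limit_ac.
have small d T : 0 < d -> exists2 e, 0 < e & forall x y, s <= x -> x <= y -> y <= T ->
    y - x < e -> \int[mu]_(z in `[x, y]) speed z < d.
  move=> d0; have [e e0 he] := ac_continuity (primitive_ac (is_s T s0)) d0.
  exists e => // x y sx xy yT yx; have := he _ _ sx xy yT yx.
  rewrite (primitive_diff (is_s T s0))//; apply: le_lt_trans; exact: ler_norm.
(* Bounded horizons and radii 1/(k+1) keep the families countable, so that the exceptional sets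
   still form a null set. *)
have main n : {ae mu, forall t, s < t < s + n%:R -> derivable g t 1 /\
    forall k, einf k.+1%:R^-1 (g t) t <= derive1 g t <= esup k.+1%:R^-1 (g t) t}.
  have sT : s <= s + n%:R by rewrite lerDl.
  have [r ir rE] : exists2 r, mu.-integrable `[s, s + n%:R] (EFin \o r) &
      forall u v, s <= u -> u <= v -> v <= s + n%:R -> g v - g u = \int[mu]_(x in `[u, v]) r x.
    apply: (dominated_density sT (@speed_ge0 _ a)); first exact: is_s.
    by move=> u v su uv _; exact: limit_dist.
  have upper k : {ae mu, forall t, s < t < s + n%:R -> is_derive t 1 g (r t) /\
      r t <= esup k.+1%:R^-1 (g t) t}.
    have k0 : 0 < k.+1%:R^-1 :> R by rewrite invr_gt0.
    have k4 : 0 < k.+1%:R^-1 / 4 :> R by rewrite divr_gt0.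
    apply: derive_le_local ir _ _ rE.
      by apply: integrable_esup => //; exact: limit_ac.
    apply: aeW => x /andP[sx xT]; have [e e0 he] := small _ (s + n%:R) k4.
    exists e => // y xy yT yx; apply: limit_le_esup => //; first exact: ltW.
    by apply: he => //; exact: ltW.
  have lower k : {ae mu, forall t, s < t < s + n%:R -> is_derive t 1 (fun x => - g x) (- r t) /\
      - r t <= - einf k.+1%:R^-1 (g t) t}.
    have k0 : 0 < k.+1%:R^-1 :> R by rewrite invr_gt0.
    have k4 : 0 < k.+1%:R^-1 / 4 :> R by rewrite divr_gt0.
    have ie : mu.-integrable `[s, s + n%:R] (EFin \o (fun x => einf k.+1%:R^-1 (g x) x)).
      by apply: integrable_einf => //; exact: limit_ac.
    have RN u v h : mu.-integrable `[u, v] (EFin \o h) ->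
       \int[mu]_(x in `[u, v]) - h x = - \int[mu]_(x in `[u, v]) h x.
      move=> ih; rewrite -mulN1r -RintegralZl//.
      by apply: eq_Rintegral => x _; rewrite mulN1r.
    apply: derive_le_local.
    - exact: (integrableN ir).
    - exact: (integrableN ie).
    - apply: aeW => x /andP[sx xT]; have [e e0 he] := small _ (s + n%:R) k4.
      exists e => // y xy yT yx; rewrite RN; last exact: integrable_itvS (ltW sx) yT ie.
      rewrite -opprD lerN2; apply: limit_ge_einf => //; first exact: ltW.
      by apply: he => //; exact: ltW.
    - move=> u v su uv vT; rewrite RN; last exact: integrable_itvS su vT ir.
      by rewrite -rE// opprB opprK addrC.
  move: (ae_foralln upper) (ae_foralln lower); apply: ae_imp2 => t h1 h2 st.
  have [/is_derive1P[dg gE] _] := h1 0%N st; split => // k.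
  have [_ h3] := h1 k st; have [_ h4] := h2 k st.
  by rewrite gE -lerN2 h4 h3.
move: (ae_foralln main) (good_time_ae ha); apply: ae_imp2 => t h gt st.
have gt' := gt (le_trans s0 (ltW st)).
have [n tn] : exists n : nat, t < s + n%:R.
  exists (Num.truncn (t - s)).+1; rewrite -ltrBlDl.
  exact: truncnS_gt.
have stn : s < t < s + n%:R by rewrite st.
have [dg ge] := h n stn; split => //; apply/(good_env _ _ gt') => d d0.
have [k kd] : exists k : nat, k.+1%:R^-1 < d.
  exists (Num.truncn d^-1); rewrite invf_plt ?posrE//; exact: truncnS_gt.
have k0 : 0 < k.+1%:R^-1 :> R by rewrite invr_gt0.
have [h1 h2] : esup k.+1%:R^-1 (g t) t <= esup d (g t) t /\
    einf d (g t) t <= einf k.+1%:R^-1 (g t) t by apply: good_mono; rewrite ?lerD2l ?lerN2 ?(ltW kd).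
have /andP[h3 h4] := ge k.
by apply/andP; split; [exact: le_trans h3|exact: le_trans h1].
Qed.

End closure.
End curves.

(** * Concatenation of curves *)

Section concatenation.
Variable R : realType.
Notation mu := (@lebesgue_measure R).
Variable a : R * R -> R.
Implicit Types (f g : R -> R) (s t u v : R).

Lemma curve_near f g t : f t = g t -> (\forall y \near t, f y = g y) ->
  derivable f t 1 /\ (lower_env a (f t) t <= (derive1 f t)%:E <= upper_env a (f t) t)%E ->
  derivable g t 1 /\ (lower_env a (g t) t <= (derive1 g t)%:E <= upper_env a (g t) t)%E.
Proof.
move=> fg nfg [df ef].
have /is_derive1P[dg gE] : is_derive t 1 g (derive1 f t).
  by apply: near_eq_is_derive (iffLR (is_derive1P _ _ _) (conj df erefl)).
by rewrite gE -fg.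
Qed.

Lemma curve_ext s f g : (forall t, s <= t -> f t = g t) ->
  filippov_curve a s f -> filippov_curve a s g.
Proof.
move=> fg [acf df]; split=> [T sT e e0|].
  have [d d0 h] := acf T sT e e0; exists d => // n l r lr tI sd.
  have := h n l r lr tI sd; congr (_ < _); apply: eq_bigr => i _.
  have [h1 h2 h3] := lr i; rewrite !fg//; exact: le_trans h2.
move: df; apply: ae_imp => t h st; apply: (curve_near _ _ (h st)); first by apply: fg; exact: ltW.
by near=> y; apply: fg; near: y; exact: lt_le_nbhsr.
Unshelve. all: by end_near. Qed.

(** The second hypothesis places every nondegenerate image interval inside the original one, so
    disjoint intervals keep disjoint images. *)
Lemma ac_clamp f (s t : R) (c : R -> R) :
  (forall u v, s <= u -> u <= v -> v <= t -> [/\ s <= c u, c u <= c v, c v <= t & c v - c u <= v - u]) ->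
  (forall u v, s <= u -> u <= v -> v <= t -> c u < c v -> u <= c u /\ c v <= v) ->
  absolutely_continuous_on f s t ->
  absolutely_continuous_on (fun x => f (c x)) s t.
Proof.
move=> cc cin acf e e0; have [d d0 h] := acf e e0; exists d => // n l r lr tI sd.
apply: (h n (fun i => c (l i)) (fun i => c (r i))).
- by move=> i; have [h1 h2 h3] := lr i; have [] := cc _ _ h1 h2 h3.
- move=> i j _ _ [x [/=]]; rewrite !in_itv/= => /andP[ix xi] /andP[jx xj].
  apply: tI => //; exists x.
  have [h1 h2 h3] := lr i; have [k1 k2 k3] := lr j.
  have [] := cin _ _ h1 h2 h3 (lt_trans ix xi).
  have [] := cin _ _ k1 k2 k3 (lt_trans jx xj).
  by rewrite /= !in_itv/=; split; apply/andP; split; lra.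
- apply: le_lt_trans sd; apply: ler_sum => i _.
  by have [h1 h2 h3] := lr i; have [] := cc _ _ h1 h2 h3.
Qed.

Lemma curve_concat s s0 f g tau : s <= tau -> s0 <= tau -> f tau = g tau ->
  filippov_curve a s f -> filippov_curve a s0 g ->
  filippov_curve a s (fun t => if t < tau then f t else g t).
Proof.
move=> stau s0tau fg [acf df] [acg dg]; split=> [T sT|].
  (* Removes the case distinction: the concatenation is a sum of functions with clamped time, each
     absolutely continuous. *)
  have E t : (if t < tau then f t else g t) =
     (f (Num.min t tau) + g (Num.max t tau)) - g tau.
    by rewrite /Order.min /Order.max; case: ltP => _; rewrite ?addrK// fg [_ + g t]addrC addrK.
  have ac1 : absolutely_continuous_on (fun x => f (Num.min x tau)) s T.
    apply: ac_clamp (acf T sT) => u v su uv vT.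
      split; [by rewrite le_min su|by rewrite le_min !ge_min uv lexx orbT| |exact: min_lip].
      by rewrite ge_min vT.
    rewrite ge_min lexx; case: (leP u tau) => ut; first by rewrite lexx.
    by rewrite min_r ?ltxx// ltW// (lt_le_trans ut).
  have ac2 : absolutely_continuous_on (fun x => g (Num.max x tau)) s T.
    have [tT|Tt] := leP tau T; last first.
      move=> e e0; exists 1 => // n l r lr tI _.
      rewrite big1 => // i _; have [h1 h2 h3] := lr i.
      have rt := le_trans h3 (ltW Tt).
      by rewrite !max_r ?subrr ?normr0// (le_trans h2).
    have acg' : absolutely_continuous_on g tau T by apply: acS (acg T _) => //; lra.
    move=> e e0; have [d d0 h] := acg' e e0; exists d => // n l r lr tI sd.
    apply: (h n (fun i => Num.max (l i) tau) (fun i => Num.max (r i) tau)).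
    - move=> i; have [h1 h2 h3] := lr i; split; first by rewrite le_max lexx orbT.
        by rewrite ge_max !le_max h2 lexx !orbT.
      by rewrite ge_max h3.
    - move=> i j _ _ [x [/=]]; rewrite !in_itv/= => /andP[ix xi] /andP[jx xj].
      apply: tI => //; exists x; rewrite /= !in_itv/=; move: ix xi jx xj.
      rewrite !gt_max !lt_max => /andP[-> tx] + /andP[-> _] +.
      by rewrite !(ltNge x tau) (ltW tx)/= !orbF => -> ->.
    - apply: le_lt_trans sd; apply: ler_sum => i _; have [h1 h2 h3] := lr i.
      exact: max_lip.
  have -> : (fun t => if t < tau then f t else g t) =
     (fun t => (f (Num.min t tau) + g (Num.max t tau)) + (- g tau)).
    exact/funext.
  apply: acD; first exact: acD.
  move=> e e0; exists 1 => // n l r _ _ _.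
  by rewrite big1 // => i _; rewrite subrr normr0.
have ne : {ae mu, forall t : R, t != tau}.
  exists [set tau]; split; [exact: measurable_set1|exact: lebesgue_measure_set1|].
  by move=> t /= /negP; rewrite negbK => /eqP.
move: df (ae_imp2 (fun x => @conj _ _) dg ne); apply: ae_imp2 => t h1 [h2 nt] st.
move: nt; rewrite neq_lt => /orP[tt|tt].
  apply: (curve_near _ _ (h1 st)); first by rewrite tt.
  by near=> y; rewrite ifT//; near: y; exact: lt_nbhsl.
apply: (curve_near _ _ (h2 (le_lt_trans s0tau tt))); first by rewrite ltNge ltW.
by near=> y; rewrite ltNge ifN// negbK; near: y; exact: lt_le_nbhsr.
Unshelve. all: by end_near. Qed.

End concatenation.

(** * Redirection of a flow along a curve *)

Section redirection.
Variable R : realType.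
Notation mu := (@lebesgue_measure R).
Variables (a : R * R -> R) (X : R -> R -> R -> R).
Implicit Types (f g : R -> R) (s t u v x : R).

Definition flow_domain : set (R * R * R) := [set z | 0 <= z.1.2 <= z.2].

Lemma measurable_pos d (T : measurableType d) (h : T -> R) :
  measurable_fun setT h -> measurable [set z | 0 <= h z].
Proof.
move=> mh; have -> : [set q | 0 <= h q] = setT `&` h @^-1` `[0, +oo[.
  by rewrite setTI; apply/seteqP; split => q /=; rewrite in_itv/= andbT.
by apply: mh.
Qed.

Lemma measurable_flow_domain : measurable flow_domain.
Proof.
have -> : flow_domain = [set z | 0 <= z.1.2] `&` [set z | 0 <= z.2 - z.1.2].
  by apply/seteqP; split => z /=; rewrite /flow_domain/= subr_ge0; [move=> /andP[]|move=> [-> ->]].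
have m1 : measurable_fun setT (fun z : R * R * R => z.1.2) by exact: measurableT_comp.
by apply: measurableI; apply: measurable_pos => //; exact: measurable_funB.
Qed.

Hypothesis hX : filippov_flow a X.

Lemma flow_curve x s : 0 <= s -> filippov_curve a s (fun t => X t x s).
Proof. by move=> s0; case: hX => _ _ h _; exact: h. Qed.

Lemma flow_id x s : 0 <= s -> X s x s = x.
Proof. by case: hX => _ h _ _; exact: h. Qed.

Lemma flow_comp x s tau t : 0 <= s -> s <= tau -> tau <= t ->
  X t (X tau x s) tau = X t x s.
Proof. by case: hX => _ _ _ h; exact: h. Qed.

Definition touches s0 g t x s :=
  exists r, [/\ Num.max s s0 <= r, r <= t & X r x s = g r].

(** The test concerns all times up to t: once g has been met the trajectory stays on g, even where X
    would leave it. *)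
Definition redirect s0 g t x s := if `[< touches s0 g t x s >] then g t else X t x s.

(** If g was met before tau, the trajectory restarts at tau from a point of g, so it meets g at once
    and stays on it. Otherwise it has followed X until tau, and meetings after tau are the same for
    both starting points. *)
Lemma redirect_comp s0 g x s tau t : 0 <= s -> s <= tau -> tau <= t ->
  redirect s0 g t (redirect s0 g tau x s) tau = redirect s0 g t x s.
Proof.
move=> s_ge0 st tt; have tau0 : 0 <= tau by exact: le_trans st.
rewrite /redirect; case: (asboolP (touches s0 g tau x s)) => [[r [h1 h2 h3]]|nm].
  have ms : s0 <= r by move: h1; rewrite ge_max => /andP[].
  rewrite !asboolT//.
    by exists r; split=> //; exact: le_trans tt.
  exists tau; split=> //; last exact: flow_id.
  by rewrite ge_max lexx (le_trans ms).
have E : touches s0 g t (X tau x s) tau <-> touches s0 g t x s.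
  split=> -[r [h1 h2 h3]].
    move: h1; rewrite ge_max => /andP[h0 h1].
    exists r; split=> //; first by rewrite ge_max h1 (le_trans st).
    by rewrite -h3 flow_comp.
  have tr : tau <= r.
    rewrite leNgt; apply/negP => rt; apply: nm; exists r; split=> //; exact: ltW.
  move: h1; rewrite ge_max => /andP[h0 h1].
  exists r; split=> //; first by rewrite ge_max h1 tr.
  by rewrite flow_comp.
by rewrite (asbool_equiv_eq E) flow_comp.
Qed.

(** Both curves are continuous, so the set of meeting times is closed and contains its infimum. *)
Lemma first_meeting s0 g t x s : 0 <= s -> filippov_curve a s0 g ->
  touches s0 g t x s -> exists tau, [/\ Num.max s s0 <= tau, X tau x s = g tau &
    forall r, Num.max s s0 <= r -> X r x s = g r -> tau <= r].
Proof.
move=> s_ge0 gc [r0 [h1 h2 h3]]; set m := Num.max s s0 in h1 *.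
pose S := [set r | m <= r /\ X r x s = g r].
have S0 : S !=set0 by exists r0.
have lS : lbound S m by move=> r [].
have hS : has_inf S by split => //; exists m.
have mi : m <= inf S by exact: lb_le_inf.
exists (inf S); split => //; last by move=> r mr e; apply: ge_inf; [exists m|].
apply/eqP; rewrite -subr_eq0 -normr_eq0 eq_le normr_ge0 andbT.
apply/ler_addgt0Pr => e e0; rewrite add0r.
have e2 : 0 < e / 2 by lra.
have sm : s <= m by rewrite /m le_max lexx.
have s0m : s0 <= m by rewrite /m le_max lexx orbT.
have T1 : s <= inf S + 1 by lra.
have T2 : s0 <= inf S + 1 by lra.
have [d1 d10 H1] := ac_continuity ((flow_curve x s_ge0).1 _ T1) e2.
have [d2 d20 H2] := ac_continuity (gc.1 _ T2) e2.
pose d := Num.min 1 (Num.min d1 d2).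
have d0 : 0 < d by rewrite /d !lt_min ltr01 d10.
have [r [mr er] rlt] := inf_adherent d0 hS.
have ir : inf S <= r by apply: ge_inf; [exists m|split].
have [rd rd1 rd2] : [/\ r - inf S < 1, r - inf S < d1 & r - inf S < d2].
  have : r - inf S < d by lra.
  by rewrite /d !lt_min => /and3P[].
have h4 : s <= inf S by lra.
have h5 : s0 <= inf S by lra.
have h6 : r <= inf S + 1 by lra.
have := H1 _ _ h4 ir h6 rd1; have := H2 _ _ h5 ir h6 rd2.
rewrite er => k1 k2.
have -> : X (inf S) x s - g (inf S) = (g r - g (inf S)) - (g r - X (inf S) x s) by ring.
by apply: (le_trans (ler_normB _ _)); lra.
Qed.

Lemma redirect_curve s0 g x s : 0 <= s -> filippov_curve a s0 g ->
  filippov_curve a s (fun t => redirect s0 g t x s).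
Proof.
move=> s_ge0 gc.
have [[t mt]|nm] := pselect (exists t, touches s0 g t x s); last first.
  apply: (curve_ext _ (flow_curve x s_ge0)) => t st.
  by rewrite /redirect asboolF// => mt; apply: nm; exists t.
have [tau [h1 h2 h3]] := first_meeting s_ge0 gc mt.
move: (h1); rewrite ge_max => /andP[k1 k2].
apply: (curve_ext _ (curve_concat k1 k2 h2 (flow_curve x s_ge0) gc)) => r sr.
rewrite /redirect; case: ltP => rt.
  rewrite asboolF// => -[q [m1 m2 m3]].
  by have := h3 _ m1 m3; lra.
by rewrite asboolT//; exists tau; split.
Qed.

(** Rational subdivision points of the interval between [Num.max s s0] and t, as measurable
    functions of (x, s, t). They replace the uncountable range of meeting times in [touches]. *)
Definition mid (s0 : R) (i N : nat) (z : R * R * R) : R :=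
  Num.max z.1.2 s0 + i%:R / N.+1%:R * (z.2 - Num.max z.1.2 s0).

Lemma mid_bounds s0 i N (z : R * R * R) : (i <= N.+1)%N -> flow_domain z -> s0 <= z.2 ->
  Num.max z.1.2 s0 <= mid s0 i N z <= z.2.
Proof.
move: z => [[x s] t] iN /= /andP[s_ge0 st] s0t; rewrite /mid/=.
have mt : Num.max s s0 <= t by rewrite ge_max st s0t.
move: mt; set m := Num.max s s0 => mt.
have q0 : 0 <= i%:R / N.+1%:R :> R by rewrite divr_ge0.
have q1 : i%:R / N.+1%:R <= 1 :> R by rewrite ler_pdivrMr// mul1r ler_nat.
have tm : 0 <= t - m by lra.
have := mulr_ge0 q0 tm; have := ler_wpM2r tm q1.
by set p := _ * _; rewrite mul1r => *; apply/andP; split; lra.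
Qed.

(** The distance between the two trajectories is continuous on a compact interval: it has a zero
    exactly when it takes arbitrarily small values on a dense set of times. *)
Lemma touches_rational s0 g (z : R * R * R) : 0 <= s0 -> filippov_curve a s0 g ->
  flow_domain z -> s0 <= z.2 ->
  touches s0 g z.2 z.1.1 z.1.2 <->
  forall n : nat, exists N i : nat, (i <= N.+1)%N /\
    `|X (mid s0 i N z) z.1.1 z.1.2 - g (mid s0 i N z)| < n.+1%:R^-1.
Proof.
move: z => [[x s] t] s00 gc /= /andP[s_ge0 st] s0t; rewrite /mid/=.
set m := Num.max s s0.
have mt : m <= t by rewrite /m ge_max st s0t.
have sm : s <= m by rewrite /m le_max lexx.
have s0m : s0 <= m by rewrite /m le_max lexx orbT.
pose h r := `|X r x s - g r|.
have hc : forall e, 0 < e -> exists2 d, 0 < d & forall u v, m <= u -> m <= v -> u <= t -> v <= t ->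
    `|u - v| < d -> `|h u - h v| < e.
  move=> e e0; have e2 : 0 < e / 2 by lra.
  have [d1 d10 H1] := ac_continuity ((flow_curve x s_ge0).1 _ st) e2.
  have [d2 d20 H2] := ac_continuity (gc.1 _ s0t) e2.
  exists (Num.min d1 d2); first by rewrite lt_min d10.
  have key u v : m <= u -> u <= v -> v <= t -> v - u < Num.min d1 d2 -> `|h v - h u| < e.
    move=> mu uv vt; rewrite lt_min => /andP[uvd uvd'].
    have := H1 _ _ (le_trans sm mu) uv vt uvd; have := H2 _ _ (le_trans s0m mu) uv vt uvd'.
    move=> k1 k2; apply: (le_lt_trans (ler_dist_dist _ _)).
    have -> : X v x s - g v - (X u x s - g u) = (X v x s - X u x s) - (g v - g u) by ring.
    by apply: (le_lt_trans (ler_normB _ _)); lra.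
  move=> u v mu mv ut vt; have [uv|/ltW vu] := leP u v.
    by rewrite distrC ger0_norm ?subr_ge0// distrC; exact: key.
  by rewrite ger0_norm ?subr_ge0//; exact: key.
have mid_in (i N : nat) : (i <= N.+1)%N -> m <= m + i%:R / N.+1%:R * (t - m) <= t.
  by move=> iN; apply: (@mid_bounds s0 i N (x, s, t)); rewrite // /flow_domain/= s_ge0.
split=> [[r [mr rt e]] n|H].
  have n0 : 0 < n.+1%:R^-1 :> R by rewrite invr_gt0.
  have [d d0 hd] := hc _ n0.
  (* A degenerate interval is treated apart, as the position of r will be divided by t - m. *)
  have [mt'|tm] := ltP m t; last first.
    have -> : m = t by apply/eqP; rewrite eq_le mt tm.
    exists 0%N, 0%N; split=> //; rewrite subrr mulr0 addr0.
    have -> : t = r by move: mr; rewrite -/m => mr; apply/eqP; rewrite eq_le rt (le_trans tm).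
    by rewrite e subrr normr0.
  have tm : 0 < t - m by lra.
  (* This N makes the mesh finer than d; y is the position of r in units of the mesh, and its
     integer part gives a node within d of r. *)
  pose N := Num.truncn ((t - m) / d).
  pose y := (r - m) / (t - m) * N.+1%:R.
  have y0 : 0 <= y by rewrite /y mulr_ge0// divr_ge0 ?subr_ge0// ltW.
  exists N, (Num.truncn y).
  have := truncn_itv y0 => /andP[y1 y2].
  have iN : (Num.truncn y <= N.+1)%N.
    rewrite -(ler_nat R) (le_trans y1)// /y ler_piMl// ler_pdivrMr// mul1r; lra.
  split=> //; have /andP[in1 in2] := mid_in _ _ iN.
  set p := m + _ in in1 in2 *.
  have pr : `|p - r| < d.
    have rE : r = m + y / N.+1%:R * (t - m).
      by rewrite /y mulfK// divfK ?gt_eqF//; lra.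
    have E : p - r = ((Num.truncn y)%:R - y) * ((t - m) / N.+1%:R).
      rewrite rE /p; ring.
    have tN : (t - m) / N.+1%:R < d.
      by rewrite ltr_pdivrMr// mulrC -ltr_pdivrMr//; exact: truncnS_gt.
    have tN0 : 0 < (t - m) / N.+1%:R by rewrite divr_gt0.
    rewrite E normrM (gtr0_norm tN0); apply: le_lt_trans tN.
    rewrite ler_piMl ?(ltW tN0)//.
    rewrite -natr1 in y2.
    by rewrite ler_norml; apply/andP; split; lra.
  have := hd _ _ in1 mr in2 rt pr.
  by rewrite /h e subrr normr0 subr0 normr_id.
pose c y := Num.max m (Num.min y t).
have cE y : m <= y <= t -> c y = y by move=> /andP[my yt]; rewrite /c min_l// max_r.
have hcont : continuous (h \o c).
  have acX : absolutely_continuous_on (fun r => X r x s) m t.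
    by apply: acS ((flow_curve x s_ge0).1 _ st).
  have acg : absolutely_continuous_on g m t by apply: acS (gc.1 _ s0t).
  move=> y; apply: cvg_norm; apply: cvgB.
    exact: (ac_continuous mt acX).
  exact: (ac_continuous mt acg).
(* The minimum is attained, and it lies below every 1/(n+1), hence is 0. *)
have [r rmt rmin] : exists2 r, r \in `[m, t] & forall q, q \in `[m, t] -> h r <= h q.
  have [r rmt rmin] := EVT_min mt (continuous_subspaceT hcont).
  exists r => // q qmt; have := rmin _ qmt.
  by move: rmt qmt; rewrite !in_itv/= => rmt qmt; rewrite !cE.
exists r; move: (rmt); rewrite in_itv/= => /andP[mr rt]; split => //.
apply/eqP; rewrite -subr_eq0 -normr_eq0 eq_le normr_ge0 andbT -/(h r).
apply/ler_addgt0Pr => e e0; rewrite add0r.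
have [N [i [iN hN]]] := H (Num.truncn e^-1).
have /rmin hr : m + i%:R / N.+1%:R * (t - m) \in `[m, t] by rewrite in_itv/=; exact: mid_in.
apply: (le_trans hr); apply/ltW; apply: (lt_trans hN).
by rewrite invf_plt ?posrE//; exact: truncnS_gt.
Unshelve. all: by end_near. Qed.

End redirection.

Section curve_uniqueness.
Variable R : realType.
Notation mu := (@lebesgue_measure R).
Variables (a : R * R -> R) (X : R -> R -> R -> R).
Implicit Types (f g : R -> R) (s t u v x : R).

Lemma measurable_curve s0 g : filippov_curve a s0 g ->
  measurable_fun setT (fun y => g (Num.max s0 y)).
Proof.
move=> gc; apply: continuous_measurable_fun => y.
have sT : s0 <= Num.max s0 y + 1 by rewrite (@le_trans _ _ (Num.max s0 y)) ?le_max ?lexx// lerDl.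
have := @ac_continuous _ _ _ _ sT (gc.1 _ sT) y.
have yT : y < Num.max s0 y + 1.
  by rewrite (@le_lt_trans _ _ (Num.max s0 y)) ?le_max ?lexx ?orbT// ltrDl.
rewrite [X in _ --> g (Num.max s0 X) -> _]min_l ?ltW// => gy.
rewrite /continuous_at; apply: cvg_trans gy; apply: near_eq_cvg; near=> z.
by rewrite min_l//; near: z; exact: lt_le_nbhsl.
Unshelve. all: by end_near. Qed.

Hypothesis hX : filippov_flow a X.

Let X' := (fun z : R * R * R => X z.2 z.1.1 z.1.2) \_ (@flow_domain R).

Let mX' : measurable_fun setT X'.
Proof.
rewrite /X'; apply/(measurable_restrictT _ _).1; first exact: measurable_flow_domain.
by case: hX.
Qed.

(** On this set the redirected flow takes its values from g and elsewhere from X, so its joint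
    measurability comes down to that of the set. *)
Lemma measurable_touches s0 g : 0 <= s0 -> filippov_curve a s0 g ->
  measurable (@flow_domain R `&` [set z | touches X s0 g z.2 z.1.1 z.1.2]).
Proof.
move=> s00 gc.
have mmax : measurable_fun setT (fun z : R * R * R => Num.max z.1.2 s0).
  by apply: measurable_maxr => //; exact: measurableT_comp.
have mmid i N : measurable_fun setT (mid s0 i N).
  apply: measurable_funD => //; apply: measurable_funM => //.
  exact: measurable_funB.
pose S (n N i : nat) := [set z : R * R * R | (i <= N.+1)%N /\
   `|X' (z.1, mid s0 i N z) - g (Num.max s0 (mid s0 i N z))| < n.+1%:R^-1].
have mS n N i : measurable (S n N i).
  have [iN|iN] := boolP (i <= N.+1)%N; last first.
    have -> : S n N i = set0 by apply/seteqP; split => z //= -[iN2]; rewrite iN2 in iN.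
    exact: measurable0.
  have mF : measurable_fun setT (fun z : R * R * R =>
     n.+1%:R^-1 - `|X' (z.1, mid s0 i N z) - g (Num.max s0 (mid s0 i N z))|).
    apply: measurable_funB => //; apply: measurableT_comp => //.
    apply: measurable_funB.
      apply: (measurableT_comp mX').
      by apply: measurable_fun_pair.
    exact: (measurableT_comp (measurable_curve gc)).
  have -> : S n N i = setT `&` (fun z : R * R * R =>
     n.+1%:R^-1 - `|X' (z.1, mid s0 i N z) - g (Num.max s0 (mid s0 i N z))|) @^-1` `]0, +oo[.
    rewrite setTI; apply/seteqP; split => z /=; rewrite in_itv/= andbT subr_gt0.
      by case.
    by move=> ?; split.
  exact: mF.
have -> : @flow_domain R `&` [set z | touches X s0 g z.2 z.1.1 z.1.2] =
   @flow_domain R `&` [set z | 0 <= z.2 - s0] `&` \bigcap_n \bigcup_N \bigcup_i S n N i.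
  apply/seteqP; split => z /=.
    move=> [Dz mz]; have s0z : s0 <= z.2.
      by case: mz => r [+ rz _]; rewrite ge_max => /andP[_ sr]; exact: le_trans rz.
    split; first by split=> //; rewrite subr_ge0.
    move=> n _; have [N [i [iN h]]] := (touches_rational hX s00 gc Dz s0z).1 mz n.
    exists N => //; exists i => //; split => //.
    have /andP[m1 m2] := mid_bounds iN Dz s0z.
    have : Num.max s0 (mid s0 i N z) = mid s0 i N z.
      by rewrite max_r//; apply: le_trans m1; rewrite le_max lexx orbT.
    move=> ->; rewrite /X' patchE mem_set//=.
    move: Dz => /andP[z0 _]; rewrite /flow_domain/= z0/=; apply: le_trans m1.
    by rewrite le_max lexx.
  move=> [[Dz]]; rewrite subr_ge0 => s0z H; split => //.
  apply/(touches_rational hX s00 gc Dz s0z) => n.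
  have [N _ [i _ [iN h]]] := H n I; exists N, i; split=> //.
  have /andP[m1 m2] := mid_bounds iN Dz s0z.
  have E : Num.max s0 (mid s0 i N z) = mid s0 i N z.
    by rewrite max_r//; apply: le_trans m1; rewrite le_max lexx orbT.
  move: h; rewrite E /X' patchE mem_set//=.
  move: Dz => /andP[z0 _]; rewrite /flow_domain/= z0/=; apply: le_trans m1.
  by rewrite le_max lexx.
apply: measurableI.
  apply: measurableI; first exact: measurable_flow_domain.
  by apply: measurable_pos; exact: measurable_funB.
apply: bigcapT_measurable => n; apply: bigcupT_measurable => N.
exact: bigcupT_measurable.
Qed.

Lemma redirect_flow s0 g : 0 <= s0 -> filippov_curve a s0 g ->
  filippov_flow a (redirect X s0 g).
Proof.
move=> s00 gc; split.
- set M := @flow_domain R `&` [set z | touches X s0 g z.2 z.1.1 z.1.2].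
  have mM : measurable M by exact: measurable_touches.
  apply: (@eq_measurable_fun _ _ _ _ _ (fun z : R * R * R =>
    \1_M z * g (Num.max s0 z.2) + (1 - \1_M z) * X' z)).
    move=> z; rewrite inE => Dz; rewrite /redirect indicE.
    have [mz|nz] := asboolP (touches X s0 g z.2 z.1.1 z.1.2).
      rewrite mem_set// subrr mul0r addr0 mul1r max_r//.
      by case: mz => r [+ rz _]; rewrite ge_max => /andP[_ sr]; exact: le_trans rz.
    by rewrite memNset ?mul0r ?add0r ?subr0 ?mul1r ?/X' ?patchE ?mem_set//; case.
  apply: measurable_funTS; apply: measurable_funD; apply: measurable_funM => //.
  + exact: (measurableT_comp (measurable_curve gc)).
  + exact: measurable_funB.
- move=> x s s_ge0; rewrite /redirect; case: asboolP => [[r [+ rs e]]|_]; last exact: flow_id hX _ _ s_ge0.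
  rewrite ge_max => /andP[sr _].
  have E : r = s by apply/eqP; rewrite eq_le sr rs.
  by move: e; rewrite E => <-; exact: flow_id hX _ _ s_ge0.
- by move=> x s s_ge0; exact: (redirect_curve hX x s_ge0 gc).
- by move=> x s tau t s_ge0 st tt; exact: (redirect_comp hX).
Qed.

Hypothesis uX : unique_filippov_flow a X.

(** Started on g at time s0, the redirected flow meets g immediately and follows it; uniqueness of
    the flow identifies it with X. *)
Lemma curve_unique s0 g t : 0 <= s0 -> filippov_curve a s0 g -> s0 <= t ->
  g t = X t (g s0) s0.
Proof.
move=> s00 gc s0t; rewrite -(uX.2 _ (redirect_flow s00 gc) (g s0) s0 t s00 s0t).
rewrite /redirect asboolT//; exists s0; split => //.
  by rewrite ge_max lexx.
exact: (flow_id hX).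
Qed.

End curve_uniqueness.

(** * Monotonicity and surjectivity of the flow map *)

Section flow_theory.
Variable R : realType.
Notation mu := (@lebesgue_measure R).
Variables (a : R * R -> R) (X : R -> R -> R -> R).
Hypothesis ha : L1loc_Linfty a.
Hypothesis uX : unique_filippov_flow a X.
Implicit Types (f g : R -> R) (s t u v x y : R).

Let hX : filippov_flow a X := uX.1.

Lemma flow_dist x s t : 0 <= s -> s <= t ->
  `|X t x s - x| <= \int[mu]_(r in `[s, t]) speed a r.
Proof.
move=> s0 st; have := curve_dist ha s0 (flow_curve hX x s0) (lexx s) st.
by rewrite (flow_id hX).
Qed.

Lemma flow_meet x y s r t : 0 <= s -> s <= r -> r <= t ->
  X r x s = X r y s -> X t x s = X t y s.
Proof.
by move=> s0 sr rt e; rewrite -(flow_comp hX x s0 sr rt) e (flow_comp hX).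
Qed.

(** To exchange their order two trajectories would have to meet, by the intermediate value theorem;
    after a meeting they coincide. *)
Lemma flow_mono s t : 0 <= s -> s <= t -> {homo (fun x => X t x s) : x y / x <= y}.
Proof.
move=> s0 st x y; rewrite le_eqVlt => /predU1P[->//|xy].
rewrite leNgt; apply/negP => yx.
pose c r := Num.max s (Num.min r t).
pose h r := X (c r) x s - X (c r) y s.
have hcont : continuous h.
  by move=> r; apply: cvgB; [exact: (ac_continuous st ((flow_curve hX x s0).1 _ st))|
    exact: (ac_continuous st ((flow_curve hX y s0).1 _ st))].
have cE r : s <= r <= t -> c r = r by move=> /andP[my yt]; rewrite /c min_l// max_r.
have hs : h s = x - y by rewrite /h cE ?lexx// !(flow_id hX).
have ht : h t = X t x s - X t y s by rewrite /h cE ?st ?lexx.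
have [|r rst hr0] := @IVT _ h s t 0 st (continuous_subspaceT hcont).
  rewrite hs ht ge_min le_max subr_le0 (ltW xy)/=.
  by apply/orP; right; rewrite subr_ge0 ltW.
move: rst; rewrite in_itv/= => /andP[sr rt].
move: hr0; rewrite /h cE ?sr// => /eqP; rewrite subr_eq0 => /eqP e.
by move: yx; rewrite (flow_meet s0 sr rt e) ltxx.
Qed.

Lemma flow_lt_inv x y s t : 0 <= s -> s <= t -> X t x s < X t y s -> x < y.
Proof.
move=> s0 st h; rewrite ltNge; apply/negP => yx.
by have := flow_mono s0 st yx; rewrite leNgt h.
Qed.

Lemma flow_lt x y s r t : 0 <= s -> s <= r -> r <= t ->
  X t x s < X t y s -> X r x s < X r y s.
Proof.
move=> s0 sr rt h; have xy := flow_lt_inv s0 (le_trans sr rt) h.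
rewrite lt_neqAle (flow_mono s0 sr (ltW xy)) andbT; apply/eqP => e.
by move: h; rewrite (flow_meet s0 sr rt e) ltxx.
Qed.

(** The pointwise limit of the trajectories is a Filippov curve starting from x, hence the
    trajectory of x. Monotone sequences of starting points supply the convergence at all times that
    is assumed here. *)
Lemma flow_cvg (x_ : nat -> R) x s t : 0 <= s -> s <= t ->
  x_ n @[n --> \oo] --> x -> (forall r, s <= r -> cvgn (fun n => X r (x_ n) s)) ->
  X t (x_ n) s @[n --> \oo] --> X t x s.
Proof.
move=> s0 st xx hc.
pose g r := lim (X r (x_ n) s @[n --> \oo]).
have gc : filippov_curve a s g.
  apply: (limit_curve ha s0 (gn := fun n r => X r (x_ n) s)).
    by move=> n; exact: flow_curve.
  by move=> r sr; exact: hc.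
have gs : g s = x.
  apply/cvg_lim => //; apply: cvg_trans xx; apply: near_eq_cvg.
  by near=> n; rewrite (flow_id hX).
by have := curve_unique uX.1 uX s0 gc st; rewrite gs => <-; exact: hc.
Unshelve. all: by end_near. Qed.

(** At the supremum of the points carried to at most y, approach from the left gives one inequality
    and approach from the right the other. The displacement is at most c, which makes that set
    nonempty and bounded above. *)
Lemma flow_surj y s t : 0 <= s -> s <= t -> exists x, X t x s = y.
Proof.
move=> s0 st; set c := \int[mu]_(r in `[s, t]) speed a r.
have hd x := flow_dist x s0 st.
pose E := [set x | X t x s <= y].
have E0 : E (y - c).
  by have := hd (y - c); rewrite -/c ler_norml => /andP[_]; rewrite /E/=; lra.
have Eub : ubound E (y + c).
  by move=> x; rewrite /E/=; have := hd x; rewrite -/c ler_norml => /andP[+ _]; lra.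
have hE : has_sup E by split; [exists (y - c)|exists (y + c)].
set x0 := sup E.
have xub x : E x -> x <= x0 by move=> Ex; apply: ub_le_sup => //; exists (y + c).
have inv0 : n.+1%:R^-1 @[n --> \oo] --> (0 : R) by exact: cvg_harmonic.
exists x0; apply/eqP; rewrite eq_le; apply/andP; split.
  have cv : X t (x0 - n.+1%:R^-1) s @[n --> \oo] --> X t x0 s.
    apply: flow_cvg => //.
      by rewrite -[X in _ --> X]subr0; apply: cvgB => //; exact: cvg_cst.
    move=> r sr; apply: nondecreasing_is_cvgn.
      apply/nondecreasing_seqP => n; apply: flow_mono => //.
      by rewrite lerB// lef_pV2 ?posrE// ler_nat.
    exists (X r x0 s) => _ [n _ <-]; apply: flow_mono => //.
    by rewrite gerBl.
  apply: (cvgr_to_le cv); apply: nearW => n.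
  have n0 : 0 < n.+1%:R^-1 :> R by rewrite invr_gt0.
  have [e Ee xe] := sup_adherent n0 hE.
  by apply: le_trans Ee; apply: flow_mono => //; exact: ltW.
have cv : X t (x0 + n.+1%:R^-1) s @[n --> \oo] --> X t x0 s.
  apply: flow_cvg => //.
    by rewrite -[X in _ --> X]addr0; apply: cvgD => //; exact: cvg_cst.
  move=> r sr; apply: nonincreasing_is_cvgn.
    apply/nonincreasing_seqP => n; apply: flow_mono => //.
    by rewrite lerD2l lef_pV2 ?posrE// ler_nat.
  exists (X r x0 s) => _ [n _ <-]; apply: flow_mono => //.
  by rewrite lerDl.
apply: (cvgr_to_ge cv); apply: nearW => n.
rewrite leNgt; apply/negP => h.
have : x0 + n.+1%:R^-1 <= x0 by apply: xub; exact: ltW.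
by rewrite gerDl leNgt invr_gt0 ltr0Sn.
Qed.

End flow_theory.

(** * Smooth test functions *)

Section smooth.
Variable R : realType.
Notation mu := (@lebesgue_measure R).
Implicit Types (f g : R -> R) (x c : R).

Fixpoint iter_derivable n f : Prop :=
  if n is m.+1 then (forall x, derivable f x 1) /\ iter_derivable m (derive1 f)
  else True.

Definition smooth f := forall n, iter_derivable n f.

Lemma iter_derivableW n f : iter_derivable n.+1 f -> iter_derivable n f.
Proof. by elim: n f => [//|n ih] f [df h]; split=> //; exact: ih. Qed.

Lemma is_derive_fun f (f' : R -> R) : (forall x, is_derive x 1 f (f' x)) ->
  (forall x, derivable f x 1) /\ derive1 f = f'.
Proof.
move=> h; split=> [x|]; first by have /is_derive1P[] := h x.
by apply/funext => x; have /is_derive1P[] := h x.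
Qed.

Lemma is_derive_cvg f x (l : R) : (fun h => h^-1 * (f (h + x) - f x)) @ 0^' --> l ->
  is_derive x 1 f l.
Proof.
have -> : (fun h : R => h^-1 * (f (h + x) - f x)) =
  (fun h : R => h^-1 *: ((f \o shift x) (h *: 1) - f x)).
  by apply/funext => h; rewrite /= [h *: 1]mulr1.
by move=> h; apply: DeriveDef; [apply/cvg_ex; exists l|apply/cvg_lim].
Qed.

Lemma derivable_is f x : derivable f x 1 -> is_derive x 1 f (derive1 f x).
Proof. by move=> h; apply/is_derive1P. Qed.

Lemma iter_derivable_cst n c : iter_derivable n (cst c).
Proof.
elim: n c => [//|n ih] c.
have [h1 h2] := is_derive_fun (fun x => is_derive_cst c x 1).
by split => //; rewrite h2; exact: ih.
Qed.

Lemma iter_derivableD n f g : iter_derivable n f -> iter_derivable n g ->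
  iter_derivable n (fun x => f x + g x).
Proof.
elim: n f g => [//|n ih] f g [df hf] [dg hg].
have [h1 h2] := is_derive_fun (fun x => is_deriveD (derivable_is (df x)) (derivable_is (dg x))).
by split => //; rewrite h2; exact: ih.
Qed.

Lemma iter_derivableM n f g : iter_derivable n f -> iter_derivable n g ->
  iter_derivable n (fun x => f x * g x).
Proof.
elim: n f g => [//|n ih] f g hf hg; move: (hf) (hg) => [df hf'] [dg hg'].
have [h1 h2] := is_derive_fun (fun x => is_deriveM (derivable_is (df x)) (derivable_is (dg x))).
split => //; rewrite h2; apply: iter_derivableD; apply: ih => //.
  exact: iter_derivableW.
exact: iter_derivableW.
Qed.

Lemma iter_derivable_affine n f b c : iter_derivable n f ->
  iter_derivable n (fun x => f (b * x + c)).
Proof.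
elim: n f => [//|n ih] f [df hf].
have haff x : is_derive x 1 (fun x => b * x + c) b.
  have := is_deriveD (is_deriveZ b (is_derive_id x 1)) (is_derive_cst c x 1).
  by rewrite addr0 [b *: 1]mulr1.
have [h1 h2] := is_derive_fun (fun x => @is_derive1_comp _ f (fun x => b * x + c) x _ _ (derivable_is (df (b * x + c))) (haff x)).
split => //; rewrite h2; apply: iter_derivableM; last exact: iter_derivable_cst.
exact: ih.
Qed.

Lemma smooth_cst c : smooth (cst c). Proof. move=> n; exact: iter_derivable_cst. Qed.

Lemma smoothD f g : smooth f -> smooth g -> smooth (fun x => f x + g x).
Proof. by move=> hf hg n; exact: iter_derivableD. Qed.

Lemma smoothM f g : smooth f -> smooth g -> smooth (fun x => f x * g x).
Proof. by move=> hf hg n; exact: iter_derivableM. Qed.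

Lemma smooth_affine f b c : smooth f -> smooth (fun x => f (b * x + c)).
Proof. by move=> hf n; exact: iter_derivable_affine. Qed.

Lemma smooth_derive1 f : smooth f -> smooth (derive1 f).
Proof. by move=> hf n; have [] := hf n.+1. Qed.

Lemma smooth_is_derive f x : smooth f -> is_derive x 1 f (derive1 f x).
Proof. by move=> hf; apply: derivable_is; have [] := hf 1%N. Qed.

Lemma smooth_continuous f : smooth f -> continuous f.
Proof.
move=> hf x; apply: differentiable_continuous; apply/derivable1_diffP.
by have [] := hf 1%N.
Qed.

Lemma smooth_primitive f g : smooth f -> (forall x, is_derive x 1 g (f x)) -> smooth g.
Proof.
move=> hf hg [//|n]; have [h1 h2] := is_derive_fun hg.
by split => //; rewrite h2.
Qed.

Section flat.

(** The powers of 1/x make the family closed under differentiation up to linear combinations, so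
    smoothness is proved by one induction for all k at once. *)
Definition flat (k : nat) x := if 0 < x then (x^-1) ^+ k * expR (- x^-1) else 0.

Lemma flat_ge0 k x : 0 <= flat k x.
Proof.
by rewrite /flat; case: ifP => // x0; rewrite mulr_ge0 ?expR_ge0// exprn_ge0// invr_ge0 ltW.
Qed.

(** Serves the differentiability at 0, where the difference quotient of [flat k] is [flat k.+1]. It
    comes from the Taylor term of order k + 1 of the exponential at 1/x. *)
Lemma flat_le k x : 0 < x -> flat k x <= (k.+1)`!%:R * x.
Proof.
move=> x0; rewrite /flat x0 expRN ler_pdivrMr ?expR_gt0//.
have xi : 0 <= x^-1 by rewrite invr_ge0 ltW.
have := expR_ge1Dxn k xi.
have f0 : 0 < (k.+1)`!%:R :> R by rewrite ltr0n fact_gt0.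
set F := (k.+1)`!%:R in f0 *; set e := expR _ => h.
have : x^-1 ^+ k.+1 <= F * e.
  rewrite mulrC -ler_pdivrMr//; lra.
rewrite exprS => h2; have := ler_wpM2l (ltW x0) h2.
by rewrite mulrA divff ?gt_eqF// mul1r; lra.
Qed.

Lemma flat_derive k x : is_derive x 1 (flat k) (- k%:R * flat k.+1 x + flat k.+2 x).
Proof.
have [x0|x0|x0] := ltgtP x 0.
- rewrite /flat !ltNge (ltW x0)/= mulr0 addr0.
  have := is_derive_cst (0 : R) x 1; apply: near_eq_is_derive; near=> y.
  by rewrite ltNge ifN// negbK; near: y; exact: lt_le_nbhsl.
- have xn : x != 0 by rewrite gt_eqF.
  have dV : is_derive x 1 (fun y : R => y^-1) (- x ^- 2).
    apply: DeriveDef; first by apply: derivableV => //; exact: derivable_id.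
    by rewrite deriveV ?derive_id// [_ *: 1]mulr1.
  have dE : is_derive x 1 (fun y : R => expR (- y^-1)) (expR (- x^-1) * (x ^- 2)).
    by have := @is_derive1_comp _ expR (fun y : R => - y^-1) x _ _ (is_derive_expR (- x^-1)) (is_deriveN dV); rewrite opprK.
  have dX : is_derive x 1 (fun y : R => y^-1 ^+ k) ((k%:R * x^-1 ^+ k.-1) * (- x ^- 2)).
    have := is_deriveX k dV; congr (is_derive _ _ _ _).
    by apply/funext => y; rewrite exprfctE.
  have := is_deriveM dX dE.
  have -> : (x^-1 ^+ k) *: (expR (- x^-1) * x ^- 2) +
    expR (- x^-1) *: ((k%:R * x^-1 ^+ k.-1) * - x ^- 2) = - k%:R * flat k.+1 x + flat k.+2 x.
    rewrite /flat x0 /GRing.scale/= -exprVn; set u := x^-1; set e := expR _.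
    by case: (k) => [|n]; rewrite ?exprS ?expr0 /=; ring.
  apply: near_eq_is_derive; near=> y.
  have y0 : 0 < y by near: y; exact: lt_nbhsr.
  by rewrite /flat y0.
- rewrite x0 /flat ltxx mulr0 addr0; apply: is_derive_cvg.
  apply/cvgrPdist_lt => e e0.
  have F0 : 0 < (k.+2)`!%:R :> R by rewrite ltr0n fact_gt0.
  exists (e / (k.+2)`!%:R); first by rewrite /= divr_gt0.
  move=> h /=; rewrite sub0r normrN => he h0.
  rewrite addr0 ltxx subr0 sub0r normrN.
  have [hp|hn] := ltP 0 h; last by rewrite mulr0 normr0.
  have -> : h^-1 * (h^-1 ^+ k * expR (- h^-1)) = flat k.+1 h by rewrite /flat hp exprS mulrA.
  rewrite ger0_norm ?flat_ge0//; apply: (le_lt_trans (flat_le _ hp)).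
  by rewrite mulrC -ltr_pdivlMr//; rewrite gtr0_norm in he.
Unshelve. all: by end_near. Qed.

Lemma smooth_flat k : smooth (flat k).
Proof.
move=> n; elim: n k => [//|n ih] k.
have [h1 h2] := is_derive_fun (flat_derive k).
split => //; rewrite h2; apply: iter_derivableD; last exact: ih.
by apply: iter_derivableM; [exact: iter_derivable_cst|exact: ih].
Qed.

End flat.
End smooth.

Section bump.
Variable R : realType.
Notation mu := (@lebesgue_measure R).
Implicit Types (f g : R -> R) (x y z c : R).

Definition bump x : R := flat 0 (1 * x + 1) * flat 0 (-1 * x + 1).

Lemma smooth_bump : smooth bump.
Proof. by apply: smoothM; apply: (smooth_affine (f := flat 0)); exact: smooth_flat. Qed.

Lemma bump_ge0 x : 0 <= bump x.
Proof. by rewrite /bump mulr_ge0// flat_ge0. Qed.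

Lemma bump_out x : 1 <= `|x| -> bump x = 0.
Proof.
rewrite ler_normr /bump /flat => /orP[x1|x1].
  by rewrite [X in _ * X]ifF ?mulr0//; apply/negbTE; rewrite -leNgt; lra.
by rewrite [X in X * _]ifF ?mul0r//; apply/negbTE; rewrite -leNgt; lra.
Qed.

Lemma bump0_gt0 : 0 < bump 0.
Proof. by rewrite /bump !mulr0 add0r /flat ltr01 expr0 mul1r mulr_gt0// expR_gt0. Qed.

Lemma integrable_bump : mu.-integrable setT (EFin \o bump).
Proof.
have mb : measurable_fun setT bump.
  by apply: continuous_measurable_fun; apply: smooth_continuous; exact: smooth_bump.
have ib : mu.-integrable `[-1, 1] (EFin \o bump).
  have bc : {within `[(-1 : R), 1], continuous bump}.
    by apply: continuous_subspaceT; apply: smooth_continuous; exact: smooth_bump.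
  exact: continuous_compact_integrable (@segment_compact R (-1) 1) bc.
have : mu.-integrable setT (EFin \o (bump \_ `[-1, 1])).
  by rewrite -restrict_EFin; apply/integrable_restrict => //; rewrite setTI.
apply: eq_integrable => // x _ /=; rewrite patchE; case: ifPn => //.
rewrite notin_setE/= in_itv/= => /negP xn; rewrite bump_out// leNgt.
apply: contra xn; rewrite ltr_norml => /andP[? ?]; apply/andP; split; lra.
Qed.

Let F x := \int[mu]_(y in `]-oo, x]) bump y.

Let Fd x : is_derive x 1 F (bump x).
Proof.
apply/is_derive1P; apply: (@continuous_FTC1 _ bump -oo%O x (x + 1)).
- by rewrite ltrDl.
- by apply: (@integrableS _ _ _ mu setT) => //; exact: integrable_bump.
- by rewrite ltNyr.
- by apply: smooth_continuous; exact: smooth_bump.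
Qed.

Let F_ge0 x : 0 <= F x.
Proof. by apply: Rintegral_ge0 => y _; exact: bump_ge0. Qed.

Let F_left x : x <= -1 -> F x = 0.
Proof.
move=> x1; rewrite /F (@eq_Rintegral _ _ _ _ _ (cst 0)); first by rewrite Rintegral_cst// mul0r.
move=> y; rewrite inE/= in_itv/= => yx; rewrite bump_out// ler_normr; apply/orP; right; lra.
Qed.

Let F_diff x y : x <= y -> F y = F x + \int[mu]_(z in `]x, y]) bump z.
Proof.
move=> xy; have := @Rintegral_itvB _ bump -oo%O (BRight y) x.
move=> /(_ _ isT); rewrite bnd_simp => /(_ _ xy) <-; first by rewrite /F addrC subrK.
by apply: (@integrableS _ _ _ mu setT) => //; exact: integrable_bump.
Qed.

Let F_nd x y : x <= y -> F x <= F y.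
Proof.
by move=> xy; rewrite (F_diff xy) lerDl; apply: Rintegral_ge0 => z _; exact: bump_ge0.
Qed.

Let F_right x : 1 <= x -> F x = F 1.
Proof.
move=> x1; rewrite (F_diff x1) (@eq_Rintegral _ _ _ _ _ (cst 0)).
  by rewrite Rintegral_cst// mul0r addr0.
move=> y; rewrite inE/= in_itv/= => /andP[y1 _]; rewrite bump_out// ler_normr; apply/orP; left; lra.
Qed.

Let F1_gt0 : 0 < F 1.
Proof.
rewrite lt_neqAle F_ge0 andbT; apply/eqP => F10.
(* If F vanished at 1 it would vanish, being monotone, around 0, against the positive derivative
   [bump 0]. *)
have : is_derive (0 : R) 1 F 0.
  have := is_derive_cst (0 : R) (0 : R) 1; apply: near_eq_is_derive; near=> y.
  apply/eqP; rewrite /cst eq_le F_ge0/= F10; apply: F_nd; near: y; exact: lt_le_nbhsl.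
move=> /is_derive1P[_]; have /is_derive1P[_ ->] := Fd 0.
by apply/eqP; rewrite gt_eqF// bump0_gt0.
Unshelve. all: by end_near. Qed.

(** The normalised primitive of [bump]: it rises from 0 to 1 on [-1, 1], and its derivative is a
    mollifier of mass one. *)
Definition smooth_step x : R := (\int[mu]_(y in `]-oo, x]) bump y) / (\int[mu]_(y in `]-oo, 1]) bump y).

Lemma smooth_smooth_step : smooth smooth_step.
Proof.
apply: (@smooth_primitive _ (fun x => bump x * (F 1)^-1)).
  by apply: smoothM; [exact: smooth_bump|exact: smooth_cst].
move=> x; have := is_deriveM (Fd x) (is_derive_cst (F 1)^-1 x 1).
by rewrite scaler0 add0r [_ *: bump x]mulrC.
Qed.

Lemma smooth_step_derive_ge0 x : 0 <= derive1 smooth_step x.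
Proof.
have : is_derive x 1 smooth_step (bump x * (F 1)^-1).
  have := is_deriveM (Fd x) (is_derive_cst (F 1)^-1 x 1).
  by rewrite scaler0 add0r [_ *: bump x]mulrC.
by move=> /is_derive1P[_ ->]; rewrite divr_ge0 ?bump_ge0.
Qed.

Lemma smooth_step_derive_out x : 1 <= `|x| -> derive1 smooth_step x = 0.
Proof.
have : is_derive x 1 smooth_step (bump x * (F 1)^-1).
  have := is_deriveM (Fd x) (is_derive_cst (F 1)^-1 x 1).
  by rewrite scaler0 add0r [_ *: bump x]mulrC.
by move=> /is_derive1P[_ ->] x1; rewrite bump_out// mul0r.
Qed.

Lemma smooth_step_le0 x : x <= -1 -> smooth_step x = 0.
Proof. by move=> x1; rewrite /smooth_step -/(F x) F_left// mul0r. Qed.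

Lemma smooth_step_ge1 x : 1 <= x -> smooth_step x = 1.
Proof. by move=> x1; rewrite /smooth_step -/(F x) F_right// divff// gt_eqF. Qed.

Lemma smooth_step_itv x : 0 <= smooth_step x <= 1.
Proof.
rewrite /smooth_step -/(F x) -/(F 1) divr_ge0//= ler_pdivrMr// mul1r.
have [x1|/ltW x1] := leP x 1; first exact: F_nd.
by rewrite F_right.
Qed.

Lemma vanishing_derive1 f (N : R) : (forall x, N < `|x| -> f x = 0) ->
  forall x, N < `|x| -> derive1 f x = 0.
Proof.
move=> f0 x Nx.
suff /is_derive1P[_ ->] : is_derive x 1 f 0 by [].
have := is_derive_cst (0 : R) x 1; apply: near_eq_is_derive.
have /cvgr_gt/(_ _ Nx) := @norm_continuous _ _ x.
by apply: filterS => y /= Ny; rewrite f0.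
Qed.

Lemma is_derive_prod f g (z : R * R) : smooth f -> smooth g ->
  is_derive z ((1, 0) : R * R) (fun z : R * R => f z.1 * g z.2) (derive1 f z.1 * g z.2) /\
  is_derive z ((0, 1) : R * R) (fun z : R * R => f z.1 * g z.2) (f z.1 * derive1 g z.2).
Proof.
move=> sf sg; have fd := smooth_is_derive z.1 sf; have gd := smooth_is_derive z.2 sg.
have qf h (x : R) : smooth h -> (fun r : R => r^-1 *: (h (r + x) - h x)) @ 0^' --> derive1 h x.
  move=> sh; have := smooth_is_derive x sh => -[/cvg_ex[l hl]]; rewrite derive1E => _.
  have -> : 'D_1 h x = l by apply/cvg_lim => //; exact: hl.
  apply: cvg_trans hl; apply: near_eq_cvg; near=> r.
  by rewrite /= [_%:A]mulr1.
have conc (h : R * R -> R) v l : (fun r : R => r^-1 *: (h (r *: v + z) - h z)) @ 0^' --> l ->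
   is_derive z v h l.
  move=> hl; apply: DeriveDef; first by apply/cvg_ex; exists l; exact: hl.
  by apply/cvg_lim => //; exact: hl.
split; apply: conc.
  have hl : (fun r : R => r^-1 *: (f (r + z.1) - f z.1) * g z.2) @ 0^' --> derive1 f z.1 * g z.2.
    by apply: cvgM; [exact: qf|exact: cvg_cst].
  apply: (cvg_trans _ hl).
  apply: near_eq_cvg; near=> r.
  by rewrite /= [r *: 1]mulr1 [r *: 0]mulr0 add0r -mulrBl -scalerAl.
have hl : (fun r : R => f z.1 * (r^-1 *: (g (r + z.2) - g z.2))) @ 0^' --> f z.1 * derive1 g z.2.
  by apply: cvgM; [exact: cvg_cst|exact: qf].
apply: (cvg_trans _ hl).
apply: near_eq_cvg; near=> r.
by rewrite /= [r *: 1]mulr1 [r *: 0]mulr0 add0r -mulrBr -scalerAr.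
Unshelve. all: by end_near. Qed.

Lemma dx_prod f g : smooth f -> smooth g ->
  dx (fun z : R * R => f z.1 * g z.2) = (fun z : R * R => derive1 f z.1 * g z.2).
Proof.
move=> sf sg; apply/funext => z; have [h _] := is_derive_prod z sf sg.
by rewrite /dx derive_val.
Qed.

Lemma dt_prod f g : smooth f -> smooth g ->
  dt (fun z : R * R => f z.1 * g z.2) = (fun z : R * R => f z.1 * derive1 g z.2).
Proof.
move=> sf sg; apply/funext => z; have [_ h] := is_derive_prod z sf sg.
by rewrite /dt derive_val.
Qed.

(** Partial derivatives of a tensor product are tensor products, so smoothness in the plane reduces
    to one variable. *)
Lemma test_function_prod f g (N : R) : smooth f -> smooth g ->
  (forall x, N < `|x| -> f x = 0) -> (forall x, N < `|x| -> g x = 0) ->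
  test_function (fun z : R * R => f z.1 * g z.2).
Proof.
move=> sf sg f0 g0; split.
  move=> w; set h := foldr _ _ _.
  have [f' [g' [sf' sg' hE]]] : exists f' g', [/\ smooth f', smooth g' &
      h = (fun z : R * R => f' z.1 * g' z.2)].
    rewrite /h; elim: w {h} => [|b w [f' [g' [sf' sg' E]]]] /=; first by exists f, g.
    rewrite E.
    case: b.
      by exists f', (derive1 g'); rewrite dt_prod//; split=> //; exact: smooth_derive1.
    by exists (derive1 f'), g'; rewrite dx_prod//; split=> //; exact: smooth_derive1.
  rewrite hE; split.
    move=> z; apply: cvgM.
      by apply: cvg_comp; [exact: cvg_fst|exact: smooth_continuous].
    by apply: cvg_comp; [exact: cvg_snd|exact: smooth_continuous].
  by move=> z; have [[h1 _] [h2 _]] := is_derive_prod z sf' sg'.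
have cA : compact (`[-N, N] `*` `[-N, N] : set (R * R)).
  by apply: compact_setX; exact: segment_compact.
apply: (subclosed_compact _ cA); first exact: closed_closure.
rewrite closureE; apply: smallest_sub.
  by apply: compact_closed cA; exact: norm_hausdorff.
by move=> z /= z0; split; rewrite /= in_itv/= -ler_norml leNgt; apply: contra z0 => zN;
  rewrite ?(f0 _ zN) ?(g0 _ zN) ?mul0r ?mulr0.
Qed.

End bump.

(** * Null sets and Tonelli's theorem *)

Section ae_generic.
Context d (T : measurableType d) (R : realType).
Variable m : {measure set T -> \bar R}.

Lemma ae_mono (P Q : T -> Prop) : (forall x, P x -> Q x) ->
  {ae m, forall x, P x} -> {ae m, forall x, Q x}.
Proof. by move=> PQ; apply: (@filterS _ _ (ae_filter_ringOfSetsType m)). Qed.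

Lemma Linfty_bound (f : T -> R) : f \in Lfun m +oo%E ->
  measurable_fun setT f /\ exists2 M, 0 <= M & {ae m, forall x, `|f x| <= M}.
Proof.
move=> /andP[]; rewrite !inE/= => mf ff; split; first exact: mf.
move: ff; rewrite /finite_norm unlock /=; case: ifPn => [m0 ff|m0 _].
  have [M hM] := ess_supr_bounded ff.
  exists (Num.max M 0); first by rewrite le_max lexx orbT.
  by move: hM; apply: ae_mono => x /= h; rewrite le_max h.
rewrite -leNgt in m0; exists 0 => //.
exists setT; split => //; apply/eqP; rewrite eq_le m0/=; exact: measure_ge0.
Qed.

End ae_generic.

Section fubini_null.
Context d1 d2 (T1 : measurableType d1) (T2 : measurableType d2) (R : realType).
Variable m1 : {sigma_finite_measure set T1 -> \bar R}.
Variable m2 : {sigma_finite_measure set T2 -> \bar R}.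

Lemma ae_prod2 (P : T1 * T2 -> Prop) : {ae (m1 \x m2)%E, forall z, P z} ->
  {ae m2, forall y, {ae m1, forall x, P (x, y)}}.
Proof.
move=> [N [mN N0 sN]].
have mi : measurable_fun setT (EFin \o (\1_N : T1 * T2 -> R)) by exact/measurable_EFinP.
have i0 z : (0 <= (EFin \o (\1_N : T1 * T2 -> R)) z)%E by rewrite lee_fin.
have := @fubini_tonelli2 _ _ _ _ _ m1 m2 _ mi i0.
rewrite [LHS]integral_indic// setIT [LHS]N0 => /esym G0.
have mG := @measurable_fun_fubini_tonelli_G _ _ _ _ _ m1 _ mi i0.
have Gpos y : (0 <= fubini_G m1 (EFin \o (\1_N : T1 * T2 -> R)) y)%E by exact: integral_ge0.
have : (\int[m2]_y `|fubini_G m1 (EFin \o (\1_N : T1 * T2 -> R)) y| = 0)%E.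
  by rewrite -[RHS]G0; apply: eq_integral => y _; rewrite gee0_abs.
move=> /(ae_eq_integral_abs m2 measurableT mG); apply: ae_mono => y /(_ I) h.
exists (ysection N y); split; first exact: measurable_ysection.
  have h' : (\int[m1]_x (\1_N (x, y) : R)%:E = 0)%E by exact: h.
  rewrite -[RHS]h'.
  rewrite -[in LHS](setIT (ysection N y)) -integral_indic//; last exact: measurable_ysection.
  by apply: eq_integral => x _; rewrite !indicE mem_ysection.
by move=> x /= nP; rewrite /ysection/= inE; apply: sN.
Qed.

(** Both iterated integrals of the indicator of N are its product measure. This exchanges the
    quantifiers: null for almost every time becomes null for almost every curve. *)
Lemma ae_prod_null (N : set (T1 * T2)) : measurable N ->
  {ae m2, forall y, {ae m1, forall x, ~ N (x, y)}} ->
  {ae m1, forall x, {ae m2, forall y, ~ N (x, y)}}.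
Proof.
move=> mN aeN.
have mi : measurable_fun setT (EFin \o (\1_N : T1 * T2 -> R)) by exact/measurable_EFinP.
have i0 z : (0 <= (EFin \o (\1_N : T1 * T2 -> R)) z)%E by rewrite lee_fin.
have E1 := @fubini_tonelli1 _ _ _ _ _ m1 m2 _ mi i0.
have E2 := @fubini_tonelli2 _ _ _ _ _ m1 m2 _ mi i0.
have mG := @measurable_fun_fubini_tonelli_G _ _ _ _ _ m1 _ mi i0.
have mF := @measurable_fun_fubini_tonelli_F _ _ _ _ _ m2 _ mi i0.
have G0 : (\int[m2]_y fubini_G m1 (EFin \o (\1_N : T1 * T2 -> R)) y = 0)%E.
  rewrite (ae_eq_integral (cst 0%E))//; first by rewrite integral0.
  move: aeN; apply: ae_mono => y h _; rewrite /fubini_G.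
  rewrite (ae_eq_integral (cst 0%E))//; first by rewrite integral0.
    exact: measurableT_comp.
  by move: h; apply: ae_mono => x nN _; rewrite /= indicE memNset.
have : (\int[m1]_x `|fubini_F m2 (EFin \o (\1_N : T1 * T2 -> R)) x| = 0)%E.
  rewrite -[RHS]G0 -E2 E1; apply: eq_integral => y _; rewrite gee0_abs//.
  exact: integral_ge0.
move=> /(ae_eq_integral_abs m1 measurableT mF); apply: ae_mono => x /(_ I) h.
have mx : measurable_fun setT (fun y => (\1_N (x, y) : R)%:E).
  by apply: (measurableT_comp mi).
have : (\int[m2]_y `|(\1_N (x, y) : R)%:E| = 0)%E.
  have h' : (\int[m2]_y (\1_N (x, y) : R)%:E = 0)%E by exact: h.
  by rewrite -[RHS]h'; apply: eq_integral => y _; rewrite gee0_abs// lee_fin.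
move=> /(ae_eq_integral_abs m2 measurableT mx); apply: ae_mono => y /(_ I).
by move=> /= + Nxy; rewrite indicE mem_set//= => -[] /eqP; rewrite oner_eq0.
Qed.

End fubini_null.

(** * The continuity equation *)

Section Rint_ae.
Context d (T : measurableType d) (R : realType).
Variable m : {measure set T -> \bar R}.
Variable D : set T.
Hypothesis mD : measurable D.
Implicit Types f g : T -> R.

Lemma integrableR_measurable f : m.-integrable D (EFin \o f) -> measurable_fun D f.
Proof. by move=> /integrableP[/measurable_EFinP]. Qed.

Lemma Rint_ae_le f g : m.-integrable D (EFin \o f) -> m.-integrable D (EFin \o g) ->
  {ae m, forall x, D x -> f x <= g x} ->
  \int[m]_(x in D) f x <= \int[m]_(x in D) g x.
Proof.
(* Replacing f by the minimum changes it on a null set and makes the inequality hold everywhere. *)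
move=> fi gi fg; pose f' x := Num.min (f x) (g x).
have mf' : measurable_fun D f'.
  by apply: measurable_minr; exact: integrableR_measurable.
have fi' : m.-integrable D (EFin \o f').
  apply: (@integrableR_le _ _ _ m _ mD _ (fun x => `|f x| + `|g x|)) => //.
    move=> x _; rewrite /f' /Order.min; case: ifP => _; first by rewrite lerDl.
    by rewrite lerDr.
  by apply: integrableRD => //; exact: integrable_norm.
rewrite [leLHS](_ : _ = \int[m]_(x in D) f' x).
  by apply: le_Rintegral => // x _; rewrite /f' ge_min lexx orbT.
rewrite /Rintegral; congr fine; apply: ae_eq_integral => //.
- exact/measurable_EFinP/integrableR_measurable.
- exact/measurable_EFinP.
- by move: fg; apply: ae_mono => x h Dx; rewrite /f' min_l// h.
Qed.

Lemma Rint_ae_norm_le f g : measurable_fun D f -> m.-integrable D (EFin \o g) ->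
  {ae m, forall x, D x -> `|f x| <= g x} ->
  `|\int[m]_(x in D) f x| <= \int[m]_(x in D) g x.
Proof.
move=> mf gi fg; have fi : m.-integrable D (EFin \o f) by exact: integrableR_ae_le gi.
by apply: (le_trans (le_normr_Rintegral mD fi)); apply: Rint_ae_le => //; exact: integrable_norm.
Qed.

Lemma Rint_ae_eq f g : measurable_fun D f -> measurable_fun D g ->
  {ae m, forall x, D x -> f x = g x} ->
  \int[m]_(x in D) f x = \int[m]_(x in D) g x.
Proof.
move=> mf mg fg; rewrite /Rintegral; congr fine; apply: ae_eq_integral => //.
- exact/measurable_EFinP.
- exact/measurable_EFinP.
- by move: fg; apply: ae_mono => x h Dx /=; rewrite h.
Qed.

End Rint_ae.

Section pairing.
Variable R : realType.
Notation mu := (@lebesgue_measure R).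
Variables (a v : R * R -> R) (v0 : R -> R) (w : R -> R -> R).
Hypothesis ha : L1loc_Linfty a.
Hypothesis hw : weak_star_representative v v0 w.
Implicit Types (f g h : R -> R) (s t r x : R).

Definition ext_density : R * R -> R := v \_ (@halfplane R).
Notation vv := ext_density.

Definition pairing h t : R := \int[mu]_x (w t x * h x).

Lemma density_bound : Linfty_halfplane v -> measurable_fun setT vv /\
  exists2 M, 0 <= M & {ae mu, forall t, {ae mu, forall x, `|vv (x, t)| <= M}}.
Proof.
move=> hv; have [mv [M M0 vM]] := Linfty_bound hv; split; first exact: mv.
by exists M => //; exact: ae_prod2 vM.
Qed.

Variable M : R.
Hypothesis M0 : 0 <= M.
Hypothesis mvv : measurable_fun setT vv.
Hypothesis vM : {ae mu, forall t, {ae mu, forall x, `|vv (x, t)| <= M}}.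

Definition regular_time t := [/\ good_time a t,
  {ae mu, forall x, w t x = vv (x, t)} & {ae mu, forall x, `|vv (x, t)| <= M}].

Lemma regular_time_ae : {ae mu, forall t, 0 <= t -> regular_time t}.
Proof.
have h1 := good_time_ae ha; have [_ h2 _ _] := hw.
have h12 := ae_imp2 (fun x => @conj _ _) h1 h2.
move: h12 vM; apply: ae_imp2 => t [gt wt] vt t0; split => //; first exact: gt.
move: (wt t0); apply: ae_imp => x ->; by rewrite /vv patchE mem_set.
Qed.

Lemma w_bound t : 0 <= t -> measurable_fun setT (w t) /\
  exists2 C, 0 <= C & {ae mu, forall x, `|w t x| <= C}.
Proof. by move=> t0; have [h _ _ _] := hw; have [mw [C C0 hC]] := Linfty_bound (h t t0); split=> //; exists C. Qed.

Lemma integrable_pairing t h : 0 <= t -> mu.-integrable setT (EFin \o h) ->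
  mu.-integrable setT (EFin \o (fun x => w t x * h x)).
Proof.
move=> t0 ih; have [mw [C C0 wC]] := w_bound t0.
apply: (@integrableR_ae_le _ _ _ mu _ _ (fun x => C * `|h x|)) => //.
- by apply: measurable_funM => //; exact: integrableR_measurable ih.
- by move: wC; apply: ae_imp => x wx _; rewrite normrM ler_wpM2r.
- by apply: integrableRZ => //; exact: integrable_norm.
Qed.

Lemma pairing_continuous h r : mu.-integrable setT (EFin \o h) -> 0 <= r ->
  forall e, 0 < e -> exists2 d, 0 < d & forall t, 0 <= t -> `|t - r| < d ->
    `|pairing h t - pairing h r| < e.
Proof.
move=> ih r0 e e0; have [_ _ _ hc] := hw.
have /subspace_continuousP/(_ r) := hc h ih.
rewrite /= in_itv/= andbT => /(_ r0)/cvgrPdist_lt/(_ _ e0).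
rewrite near_withinE => -[d /= d0 hd].
exists d => // t t0 tr; rewrite distrC; apply: hd; rewrite /= ?in_itv/= ?t0//.
by rewrite distrC.
Qed.

(** The bound M for the density is available at almost every time only; weak-* continuity carries
    the inequality over from regular times arbitrarily close to t on its right. *)
Lemma pairing_bound h t : 0 <= t -> mu.-integrable setT (EFin \o h) ->
  `|pairing h t| <= M * \int[mu]_x `|h x|.
Proof.
move=> t0 ih; rewrite leNgt; apply/negP => hlt.
pose e := `|pairing h t| - M * \int[mu]_x `|h x|.
have e0 : 0 < e by rewrite /e subr_gt0.
have [d d0 hd] := pairing_continuous ih t0 e0.
have td : t < t + d by rewrite ltrDl.
have [r /andP[tr rd] hr] := ae_itv_ex td regular_time_ae.
have r0 : 0 <= r by lra.
have [_ wr vr] := hr r0.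
have := hd r r0; rewrite ger0_norm; last by lra.
have rd' : r - t < d by lra.
move=> /(_ rd'); apply/negP; rewrite -leNgt.
have key : `|pairing h r| <= M * \int[mu]_x `|h x|.
  rewrite -RintegralZl//; last exact: integrable_norm.
  have [mw _] := w_bound r0.
  apply: Rint_ae_norm_le => //.
  - by apply: measurable_funM => //; exact: integrableR_measurable ih.
  - by apply: integrableRZ => //; exact: integrable_norm.
  - move: wr vr; apply: ae_imp2 => x -> vx _; by rewrite normrM ler_wpM2r.
have := lerB_dist (pairing h t) (pairing h r); rewrite distrC /e; lra.
Qed.

End pairing.

Section param_integral.
Context d1 d2 (T1 : measurableType d1) (T2 : measurableType d2) (R : realType).
Variable m1 : {sigma_finite_measure set T1 -> \bar R}.

Lemma measurable_param_integral (f : T1 * T2 -> \bar R) : measurable_fun setT f ->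
  measurable_fun setT (fun y => \int[m1]_x f (x, y))%E.
Proof.
move=> mf.
have -> : (fun y => \int[m1]_x f (x, y))%E =
   (fun y => fubini_G m1 f^\+ y - fubini_G m1 f^\- y)%E.
  apply/funext => y; rewrite [LHS]integralE; congr (_ - _)%E.
    by rewrite /fubini_G; apply: eq_integral => x _; rewrite funepos_comp.
  by rewrite /fubini_G; apply: eq_integral => x _; rewrite funeneg_comp.
apply: emeasurable_funB.
  by apply: measurable_fun_fubini_tonelli_G => //; exact: measurable_funepos.
by apply: measurable_fun_fubini_tonelli_G => //; exact: measurable_funeneg.
Qed.

End param_integral.

Section calculus.
Variable R : realType.
Notation mu := (@lebesgue_measure R).
Implicit Types (f g h : R -> R) (s t r x N : R).

Lemma continuous_integrable_itv f s t : continuous f -> mu.-integrable `[s, t] (EFin \o f).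
Proof.
move=> cf; apply: continuous_compact_integrable; first exact: segment_compact.
exact: continuous_subspaceT.
Qed.

Lemma integrable_vanishing f N : continuous f -> (forall x, N < `|x| -> f x = 0) ->
  mu.-integrable setT (EFin \o f).
Proof.
move=> cf f0.
have : mu.-integrable setT (EFin \o (f \_ `[-N, N])).
  rewrite -restrict_EFin; apply/integrable_restrict => //; rewrite setTI.
  exact: continuous_integrable_itv.
apply: eq_integrable => // x _ /=; rewrite patchE; case: ifPn => //.
rewrite notin_setE/= in_itv/= -ler_norml => /negP; rewrite -ltNge => xN.
by rewrite f0.
Qed.

Lemma Rint_derive f s t : smooth f -> s <= t ->
  \int[mu]_(x in `[s, t]) derive1 f x = f t - f s.
Proof.
rewrite le_eqVlt => sf /predU1P[->|st].
  by rewrite set_itv1 Rintegral_set1 subrr.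
have cf := smooth_continuous sf.
rewrite /Rintegral (@continuous_FTC2 _ _ f)//.
- by apply: continuous_subspaceT; apply: smooth_continuous; exact: smooth_derive1.
- split; first by move=> x _; have [] := smooth_is_derive x sf.
    exact: cvg_at_right_filter (cf s).
  exact: cvg_at_left_filter (cf t).
Qed.

End calculus.

Section evolution.
Variable R : realType.
Notation mu := (@lebesgue_measure R).
Variables (a v : R * R -> R) (v0 : R -> R) (w : R -> R -> R).
Hypothesis ha : L1loc_Linfty a.
Hypothesis hv0 : Linfty v0.
Hypothesis hw : weak_star_representative v v0 w.
Hypothesis hsol : weak_solution a v v0.
Implicit Types (f g h : R -> R) (s t r x N : R).
Notation vv := (ext_density v).
Notation aa := (ext_field a).
Notation P := (pairing w).
Variable M : R.
Hypothesis M0 : 0 <= M.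
Hypothesis mvv : measurable_fun setT vv.
Hypothesis vM : {ae mu, forall t, {ae mu, forall x, `|vv (x, t)| <= M}}.
Notation regular := (regular_time a v w M).

(** The time derivative, in integrated form, of the pairing with a fixed test function g. *)
Definition flux g t : R := \int[mu]_x (aa (x, t) * derive1 g x * vv (x, t)).

Let maa : measurable_fun setT aa := measurable_ext_field ha.1.

Section flux.
Variable g : R -> R.
Hypothesis ig' : mu.-integrable setT (EFin \o derive1 g).

Let mg' : measurable_fun setT (derive1 g) := integrableR_measurable ig'.

Lemma measurable_slice (f : R * R -> R) t : measurable_fun setT f -> measurable_fun setT (fun x => f (x, t)).
Proof. by move=> mf; apply: (measurableT_comp mf); exact: measurable_fun_pair. Qed.

Lemma flux_integrable t : regular t ->
  mu.-integrable setT (EFin \o (fun x => aa (x, t) * derive1 g x * vv (x, t))).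
Proof.
move=> [gt wt vt]; apply: (@integrableR_ae_le _ _ _ mu _ _ (fun x => speed a t * M * `|derive1 g x|)) => //.
- by apply: measurable_funM; [apply: measurable_funM => //|]; exact: measurable_slice.
- have [t0 at0] := gt; move: at0 vt; apply: ae_imp2 => x ax vx _.
  rewrite ext_fieldE// !normrM mulrAC ler_wpM2r//; apply: ler_pM => //.
- by apply: integrableRZ => //; exact: integrable_norm.
Qed.

Lemma flux_bound t : regular t ->
  `|flux g t| <= M * (\int[mu]_x `|derive1 g x|) * speed a t.
Proof.
move=> rt; have [gt wt vt] := rt.
have ing : mu.-integrable setT (EFin \o (fun x => `|derive1 g x|)) by exact: integrable_norm.
rewrite -mulrA [X in _ <= _ * X]mulrC mulrA -RintegralZl//.
apply: Rint_ae_norm_le => //.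
- exact: integrableR_measurable (flux_integrable rt).
- exact: integrableRZ.
- have [t0 at0] := gt; move: at0 vt; apply: ae_imp2 => x ax vx _.
  rewrite ext_fieldE// !normrM mulrAC ler_wpM2r// mulrC; apply: ler_pM => //.
Qed.

Lemma measurable_flux : measurable_fun setT (flux g).
Proof.
have mF : measurable_fun setT (fun z : R * R => (aa z * derive1 g z.1 * vv z)%:E).
  apply/measurable_EFinP; apply: measurable_funM => //; apply: measurable_funM => //.
  exact: (measurableT_comp mg').
have := measurable_param_integral mu mF.
by move=> h; exact: (measurableT_comp (fine_measurable measurableT) h).
Qed.

Lemma flux_integrable_itv s t : 0 <= s -> mu.-integrable `[s, t] (EFin \o flux g).
Proof.
move=> s0; apply: (@integrableR_ae_le _ _ _ mu _ _ (fun x => M * (\int[mu]_x `|derive1 g x|) * speed a x)) => //.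
- by apply: measurable_funTS; exact: measurable_flux.
- have := regular_time_ae ha hw vM; apply: ae_imp => r hr; rewrite /= in_itv/= => /andP[sr _].
  by apply: flux_bound; apply: hr; exact: le_trans sr.
- by apply: integrableRZ => //; exact: integrable_speed.
Qed.

End flux.

Section fixed_test.
Variables (g : R -> R) (N : R).
Hypotheses (sg : smooth g) (g0 : forall x, N < `|x| -> g x = 0).

Let sg' := smooth_derive1 sg.
Let g'0 : forall x, N < `|x| -> derive1 g x = 0 := vanishing_derive1 g0.
Let ig : mu.-integrable setT (EFin \o g) := integrable_vanishing (smooth_continuous sg) g0.
Let ig' : mu.-integrable setT (EFin \o derive1 g) := integrable_vanishing (smooth_continuous sg') g'0.

Let mg : measurable_fun setT g := integrableR_measurable ig.
Let mg' : measurable_fun setT (derive1 g) := integrableR_measurable ig'.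

Lemma measurable_pairing : measurable_fun (`[0, +oo[ : set R) (P g).
Proof.
have [_ _ _ hc] := hw.
by apply: subspace_continuous_measurable_fun => //; exact: hc.
Qed.

Section cutoff.
Variables (r e : R).
Hypotheses (e0 : 0 < e) (er : e <= r).

(** Equal to 1 on [-1, r - e] and to 0 beyond r + e, so that its negative derivative is a mollifier
    of mass one about r. The factor in t + 2 gives compact support on the side of negative times,
    rising between -3 and -1; the value at t = 0 stays 1 and produces the initial term. *)
Definition cutoff t : R :=
  smooth_step (1 * t + 2) * (1 + (-1) * smooth_step (e^-1 * t + - (r / e))).

Let smooth_cutoff : smooth cutoff.
Proof.
apply: smoothM; first by apply: smooth_affine; exact: smooth_smooth_step.
apply: smoothD; first exact: smooth_cst.
apply: smoothM; first exact: smooth_cst.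
by apply: smooth_affine; exact: smooth_smooth_step.
Qed.

Let argE t : e^-1 * t + - (r / e) = (t - r) / e.
Proof. by rewrite mulrBl [_ * t]mulrC. Qed.

Let cutoffE t : -1 <= t -> cutoff t = 1 - smooth_step ((t - r) / e).
Proof. by move=> t0; rewrite /cutoff argE smooth_step_ge1 ?mul1r ?mulN1r//; (move: (e0) (er) => ? ?; lra). Qed.

Let cutoff_vanish t : r + e + 3 < `|t| -> cutoff t = 0.
Proof.
rewrite ltr_normr => /orP[h|h].
  rewrite cutoffE; last first.
    by move: (e0) (er); lra.
  by rewrite smooth_step_ge1 ?subrr// ler_pdivlMr//; (move: (e0) (er) => ? ?; lra).
by rewrite /cutoff smooth_step_le0 ?mul0r//; (move: (e0) (er) => ? ?; lra).
Qed.

Let cutoff1 t : -1 <= t -> t <= r - e -> cutoff t = 1.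
Proof.
by move=> t1 tr; rewrite cutoffE// smooth_step_le0 ?subr0// ler_pdivrMr//; (move: (e0) (er) => ? ?; lra).
Qed.

Let cutoff0 t : -1 <= t -> r + e <= t -> cutoff t = 0.
Proof.
by move=> t1 tr; rewrite cutoffE// smooth_step_ge1 ?subrr// ler_pdivlMr//; (move: (e0) (er) => ? ?; lra).
Qed.

Let cutoff_itv t : 0 <= t -> 0 <= cutoff t <= 1.
Proof.
move=> t0; rewrite cutoffE; last by (move: (e0) (er) => ? ?; lra).
by have /andP[? ?] := smooth_step_itv ((t - r) / e); apply/andP; split; (move: (e0) (er) => ? ?; lra).
Qed.

Let cutoff'E t : 0 <= t -> derive1 cutoff t = - (e^-1 * derive1 (@smooth_step R) ((t - r) / e)).
Proof.
move=> t0.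
have haff : is_derive t 1 (fun x => e^-1 * x + - (r / e)) (e^-1).
  have := is_deriveD (is_deriveZ e^-1 (is_derive_id t 1)) (is_derive_cst (- (r / e)) t 1).
  by rewrite addr0 [_ *: 1]mulr1.
have h1 := @is_derive1_comp _ (@smooth_step R) (fun x => e^-1 * x + - (r / e)) t _ _
  (smooth_is_derive _ (@smooth_smooth_step R)) haff.
have := is_deriveB (is_derive_cst (1 : R) t 1) h1; rewrite sub0r argE => h2; rewrite [e^-1 * _]mulrC.
suff /is_derive1P[_ ->] : is_derive t 1 cutoff (- (derive1 (@smooth_step R) ((t - r) / e) / e)) by [].
move: h2; apply: near_eq_is_derive; near=> y.
rewrite cutoffE; first by rewrite -argE.
apply: ltW; near: y; apply: lt_nbhsr; (move: (e0) (er) => ? ?; lra).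
Unshelve. all: by end_near. Qed.

Let cutoff'_le0 t : 0 <= t -> derive1 cutoff t <= 0.
Proof.
move=> t0; rewrite cutoff'E// oppr_le0 mulr_ge0 ?invr_ge0 ?(ltW e0)//.
exact: smooth_step_derive_ge0.
Qed.

Let cutoff'0 t : 0 <= t -> e <= `|t - r| -> derive1 cutoff t = 0.
Proof.
move=> t0 et; rewrite cutoff'E// smooth_step_derive_out ?mulr0 ?oppr0//.
by rewrite normrM normfV (gtr0_norm e0) ler_pdivlMr// mul1r.
Qed.

Let h t := derive1 cutoff t * P g t + cutoff t * flux g t.

Let inner t := (\int[mu]_x ((dt (fun z => (g z.1 * cutoff z.2)%R) (x, t) +
   a (x, t) * dx (fun z => (g z.1 * cutoff z.2)%R) (x, t)) * v (x, t))%:E)%E.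

Let innerE t : 0 <= t -> inner t = (\int[mu]_x ((derive1 cutoff t * g x +
   aa (x, t) * (derive1 g x * cutoff t)) * vv (x, t))%:E)%E.
Proof.
move=> t0; apply: eq_integral => x _; rewrite dt_prod// dx_prod//= ext_fieldE//.
by rewrite /ext_density patchE mem_set// [g x * _]mulrC.
Qed.

Let inner_regular t : regular t -> inner t = (h t)%:E.
Proof.
move=> rt; have [gt wt vt] := rt; have t0 := gt.1.
have [mw _] := w_bound hw t0.
have i1 : mu.-integrable setT (EFin \o (fun x => g x * vv (x, t))).
  apply: (@integrableR_ae_le _ _ _ mu _ _ (fun x => M * `|g x|)) => //.
  - by apply: measurable_funM => //; exact: measurable_slice.
  - by move: vt; apply: ae_imp => x vx _; rewrite normrM mulrC ler_wpM2r.
  - by apply: integrableRZ => //; exact: integrable_norm.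
have i2 := (flux_integrable ig' rt).
rewrite innerE//.
transitivity ((\int[mu]_x (derive1 cutoff t * (g x * vv (x, t)) +
   cutoff t * (aa (x, t) * derive1 g x * vv (x, t))))%:E).
  rewrite /Rintegral fineK.
    by apply: eq_integral => x _; congr EFin; ring.
  apply: integrable_fin_num => //.
  by apply: integrableRD => //; exact: integrableRZ.
rewrite RintegralD//; [|exact: integrableRZ|exact: integrableRZ].
rewrite !RintegralZl//; congr (_ * _ + _)%:E.
apply: Rint_ae_eq => //.
- exact: integrableR_measurable i1.
- exact: measurable_funM.
- by move: wt; apply: ae_imp => x -> _; rewrite mulrC.
Qed.

Let measurable_inner : measurable_fun (`[0, +oo[ : set R) inner.
Proof.
have mF : measurable_fun setT (fun z : R * R => ((derive1 cutoff z.2 * g z.1 +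
   aa z * (derive1 g z.1 * cutoff z.2)) * vv z)%:E).
  have mc : measurable_fun setT cutoff.
    by apply: continuous_measurable_fun; exact: smooth_continuous smooth_cutoff.
  have mc' : measurable_fun setT (derive1 cutoff).
    by apply: continuous_measurable_fun; apply: smooth_continuous; exact: smooth_derive1 smooth_cutoff.
  apply/measurable_EFinP; apply: measurable_funM => //; apply: measurable_funD.
    apply: measurable_funM; first exact: (measurableT_comp mc').
    exact: (measurableT_comp mg).
  apply: measurable_funM => //; apply: measurable_funM; first exact: (measurableT_comp mg').
  exact: (measurableT_comp mc).
have := measurable_param_integral mu mF.
move=> H; apply: (@eq_measurable_fun _ _ _ _ _ _ _ _ (measurable_funTS H)).
by move=> t; rewrite inE/= in_itv/= andbT => t0; rewrite innerE.
Qed.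

Let measurable_h : measurable_fun (`[0, +oo[ : set R) h.
Proof.
have mc : measurable_fun setT cutoff.
  by apply: continuous_measurable_fun; exact: smooth_continuous smooth_cutoff.
have mc' : measurable_fun setT (derive1 cutoff).
  by apply: continuous_measurable_fun; apply: smooth_continuous; exact: smooth_derive1 smooth_cutoff.
apply: measurable_funD; apply: measurable_funM.
- exact: measurable_funTS.
- exact: measurable_pairing.
- exact: measurable_funTS.
- apply: measurable_funTS; exact: (measurable_flux ig').
Qed.

Let T := r + e.

Let T0 : 0 <= T. Proof. by rewrite /T; (move: (e0) (er) => ? ?; lra). Qed.

Let h_int : mu.-integrable `[0, T] (EFin \o h).
Proof.
apply: (@integrableR_ae_le _ _ _ mu _ _ (fun t => (M * \int[mu]_x `|g x|) * `|derive1 cutoff t| + `|flux g t|)) => //.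
- by apply: measurable_funS measurable_h => //; apply: subset_itvl; rewrite bnd_simp.
- apply: aeW => t; rewrite /= in_itv/= => /andP[t0 tT].
  apply: (le_trans (ler_normD _ _)); rewrite (normrM (derive1 cutoff t)) (normrM (cutoff t)); apply: lerD.
    by rewrite mulrC ler_wpM2r//; exact: (pairing_bound ha hw vM).
  have /andP[c0 c1] := cutoff_itv t0.
  by rewrite (ger0_norm c0) ler_piMl.
- apply: integrableRD => //.
    apply: integrableRZ => //; apply: (@integrable_norm _ _ _ mu) => //.
    by apply: continuous_integrable_itv; apply: smooth_continuous; exact: smooth_derive1 smooth_cutoff.
  by apply: (@integrable_norm _ _ _ mu) => //; exact: (flux_integrable_itv ig').
Qed.

Let weak_identity : \int[mu]_(t in `[0, T]) h t = - P g 0.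
Proof.
have := hsol (@test_function_prod _ g cutoff (Num.max N (r + e + 3)) sg smooth_cutoff _ _).
have vg x : Num.max N (r + e + 3) < `|x| -> g x = 0.
  by rewrite gt_max => /andP[/g0].
have vc x : Num.max N (r + e + 3) < `|x| -> cutoff x = 0.
  by rewrite gt_max => /andP[_ /cutoff_vanish].
move=> /(_ vg vc).
have -> : (\int[mu]_x (g x * cutoff 0 * v0 x)%:E = (P g 0)%:E)%E.
  rewrite /pairing /Rintegral fineK; last first.
    by apply: integrable_fin_num => //; exact: (integrable_pairing hw).
  have [mw _] := w_bound hw (lexx 0).
  have [mv0 _] := Linfty_bound hv0.
  apply: ae_eq_integral => //.
  - by apply/measurable_EFinP; apply: measurable_funM => //; exact: measurable_funM.
  - by apply/measurable_EFinP; exact: measurable_funM.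
  - have [_ _ w0 _] := hw; move: w0; apply: ae_imp => x wx _ /=.
    by rewrite wx cutoff1 ?mulr1 1?mulrC//; (move: (e0) (er) => ? ?; lra).
have -> : (\int[mu]_(t in `[0%R, +oo[) inner t = (\int[mu]_(t in `[0, T]) h t)%:E)%E.
  transitivity (\int[mu]_(t in `[0%R, +oo[) (h t)%:E)%E.
    apply: ae_eq_integral => //; first exact/measurable_EFinP.
    have := regular_time_ae ha hw vM; apply: ae_imp => t rt; rewrite /= in_itv/= andbT => t0.
    by rewrite inner_regular//; exact: rt.
  rewrite /Rintegral fineK; last exact: integrable_fin_num.
  rewrite [LHS]integral_mkcond [RHS]integral_mkcond; apply: eq_integral => t _.
  rewrite !patchE; case: ifPn => [|nt].
    rewrite inE/= in_itv/= andbT => t0; case: ifPn => //.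
    rewrite notin_setE/= in_itv/= t0/= => /negP; rewrite -ltNge /T => tT.
    rewrite /h cutoff'0// ?cutoff0 ?mul0r ?addr0//; try by (move: (e0) (er) => ? ?; lra).
    by rewrite ger0_norm; (move: (e0) (er) => ? ?; lra).
  case: ifPn => //; move: nt; rewrite notin_setE inE/= !in_itv/= andbT => nt /andP[t0 _].
  by case: nt.
by rewrite -EFinD => /eqP; rewrite eqe addr_eq0 => /eqP.
Qed.

Let flux_int s t : 0 <= s -> mu.-integrable `[s, t] (EFin \o flux g) := @flux_integrable_itv g ig' s t.

Let cutoff'_int s t : mu.-integrable `[s, t] (EFin \o derive1 cutoff).
Proof.
by apply: continuous_integrable_itv; apply: smooth_continuous; exact: smooth_derive1 smooth_cutoff.
Qed.

(** In the weak identity the term with the derivative of [cutoff] averages the pairing near r, at a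
    cost of eta. In the flux term [cutoff] differs from the indicator of [0, r] only on
    [r - e, r + e]; each of the two flux integrals there costs at most the integral of the absolute
    value. *)
Lemma evolution_approx eta : 
  (forall t, 0 <= t -> `|t - r| < e -> `|P g t - P g r| <= eta) ->
  `|P g r - P g 0 - \int[mu]_(t in `[0, r]) flux g t| <=
    eta + 2 * \int[mu]_(t in `[r - e, r + e]) `|flux g t|.
Proof.
move=> close.
have r0 : 0 <= r by (move: (e0) (er) => ? ?; lra).
have mc : measurable_fun setT cutoff.
  by apply: continuous_measurable_fun; exact: smooth_continuous smooth_cutoff.
have mPT : measurable_fun `[0, T] (P g).
  by apply: measurable_funS measurable_pairing => //; apply: subset_itvl; rewrite bnd_simp.
have i1 : mu.-integrable `[0, T] (EFin \o (fun t => derive1 cutoff t * P g t)).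
  apply: (@integrableR_le _ _ _ mu _ _ _ (fun t => (M * \int[mu]_x `|g x|) * `|derive1 cutoff t|)) => //.
  - by apply: measurable_funM => //; exact: integrableR_measurable (cutoff'_int _ _).
  - move=> t; rewrite /= in_itv/= => /andP[t0 _].
    by rewrite normrM mulrC ler_wpM2r//; exact: (pairing_bound ha hw vM).
  - apply: integrableRZ => //; exact: (@integrable_norm _ _ _ mu).
have i2 s t : 0 <= s -> mu.-integrable `[s, t] (EFin \o (fun t => cutoff t * flux g t)).
  move=> s0; apply: (@integrableR_le _ _ _ mu _ _ _ (fun t => `|flux g t|)) => //.
  - apply: measurable_funM; first exact: measurable_funTS.
    by apply: measurable_funTS; exact: (measurable_flux ig').
  - move=> x; rewrite /= in_itv/= => /andP[sx _].
    have /andP[c0 c1] := cutoff_itv (le_trans s0 sx).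
    by rewrite normrM ger0_norm// ler_piMl.
  - by apply: (@integrable_norm _ _ _ mu) => //; exact: flux_int.
have E := weak_identity; rewrite RintegralD// in E; last exact: i2.
have A1 : `|P g r + \int[mu]_(t in `[0, T]) (derive1 cutoff t * P g t)| <= eta.
  have c1 : \int[mu]_(t in `[0, T]) derive1 cutoff t = -1.
    by rewrite Rint_derive// cutoff0 ?cutoff1 ?sub0r// /T; (move: (e0) (er) => ? ?; lra).
  (* As the derivative of [cutoff] has integral -1, [P g r] can be moved under the integral sign. *)
  have -> : P g r + \int[mu]_(t in `[0, T]) (derive1 cutoff t * P g t) =
    \int[mu]_(t in `[0, T]) (derive1 cutoff t * P g t - P g r * derive1 cutoff t).
    rewrite RintegralB//; last exact: integrableRZ.
    by rewrite RintegralZl// c1 mulrN1 opprK addrC.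
  have -> : eta = \int[mu]_(t in `[0, T]) ((- eta) * derive1 cutoff t).
    by rewrite RintegralZl// c1 mulrNN mulr1.
  apply: Rint_ae_norm_le => //.
  - by apply: (@integrableR_measurable _ _ _ mu); apply: integrableRB => //; exact: integrableRZ.
  - exact: integrableRZ.
  - apply: aeW => t; rewrite /= in_itv/= => /andP[t0 tT].
    rewrite [P g r * _]mulrC -mulrBr normrM (ler0_norm (cutoff'_le0 t0)).
    have [te|et] := ltP `|t - r| e; last by rewrite cutoff'0// oppr0 mul0r mulr0.
    have -> : - eta * derive1 cutoff t = - derive1 cutoff t * eta by ring.
    by rewrite ler_wpM2l ?oppr_ge0 ?cutoff'_le0//; exact: close.
have re0 : 0 <= r - e by rewrite subr_ge0.
have reT : r - e <= T by rewrite /T; (move: (e0) (er) => ? ?; lra).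
have A2 : \int[mu]_(t in `[0, T]) (cutoff t * flux g t) - \int[mu]_(t in `[0, r]) flux g t =
  \int[mu]_(t in `[r - e, T]) (cutoff t * flux g t) - \int[mu]_(t in `[r - e, r]) flux g t.
  rewrite (Rint_split re0 reT (i2 _ _ (lexx 0))).
  have rer : r - e <= r by rewrite gerBl ltW.
  rewrite (Rint_split re0 rer (flux_int _ (lexx 0))).
  have -> : \int[mu]_(t in `[0, r - e]) (cutoff t * flux g t) = \int[mu]_(t in `[0, r - e]) flux g t.
    apply: eq_Rintegral => t; rewrite inE/= in_itv/= => /andP[t0 tr].
    by rewrite cutoff1 ?mul1r//; (move: (e0) (er) => ? ?; lra).
  by rewrite opprD addrACA subrr add0r.
have nf s t : 0 <= s -> mu.-integrable `[s, t] (EFin \o (fun t => `|flux g t|)).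
  by move=> s0; apply: (@integrable_norm _ _ _ mu) => //; exact: flux_int.
have A3 : `|\int[mu]_(t in `[r - e, T]) (cutoff t * flux g t)| <= \int[mu]_(t in `[r - e, T]) `|flux g t|.
  apply: Rint_ae_norm_le => //.
  - exact: integrableR_measurable (i2 _ _ re0).
  - exact: nf.
  - apply: aeW => t; rewrite /= in_itv/= => /andP[t0 tT].
    have /andP[c0 c1] := cutoff_itv (le_trans re0 t0).
    by rewrite normrM ger0_norm// ler_piMl.
have A4 : `|\int[mu]_(t in `[r - e, r]) flux g t| <= \int[mu]_(t in `[r - e, T]) `|flux g t|.
  apply: (@le_trans _ _ (\int[mu]_(t in `[r - e, r]) `|flux g t|)).
    by apply: le_normr_Rintegral => //; exact: flux_int.
  have rer : r - e <= r by rewrite gerBl ltW.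
  have rT : r <= T by rewrite /T; (move: (e0) (er) => ? ?; lra).
  by rewrite (Rint_split rer rT (nf _ _ re0)) lerDl Rintegral_ge0.
move: E A1 A2 A3 A4; rewrite /T.
set p1 := \int[mu]_(t in _) (derive1 cutoff t * _).
set p2 := \int[mu]_(t in `[0, r + e]) (cutoff t * _).
set p3 := \int[mu]_(t in `[0, r]) _.
set p4 := \int[mu]_(t in `[r - e, r + e]) (cutoff t * _).
set p5 := \int[mu]_(t in `[r - e, r]) _.
set p6 := \int[mu]_(t in `[r - e, r + e]) `|_|.
rewrite !ler_norml => E /andP[? ?] ? /andP[? ?] /andP[? ?].
by apply/andP; split; (move: (e0) (er) => ? ?; lra).
Qed.

End cutoff.
Lemma evolution0 r : 0 <= r -> P g r - P g 0 = \int[mu]_(t in `[0, r]) flux g t.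
Proof.
rewrite le_eqVlt => /predU1P[<-|r0]; first by rewrite set_itv1 Rintegral_set1 subrr.
apply/eqP; rewrite -subr_eq0 -normr_eq0 eq_le normr_ge0 andbT.
apply/ler_addgt0Pr => eta eta0; rewrite add0r.
have eta2 : 0 < eta / 2 by lra.
have eta4 : 0 < eta / 4 by lra.
have [d1 d10 hd1] := pairing_continuous hw ig (ltW r0) eta2.
have inf : mu.-integrable `[0, r + 1] (EFin \o (fun t => `|flux g t|)).
  by apply: (@integrable_norm _ _ _ mu) => //; exact: (flux_integrable_itv ig').
have [d2 d20 hd2] := ac_continuity (primitive_ac inf) eta4.
(* The four bounds keep the window in positive times and inside [0, r + 1], give closeness of the
   pairings, and make the window length 2 e less than d2. *)
pose e := Num.min (Num.min r 1) (Num.min d1 (d2 / 3)).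
have e0 : 0 < e by rewrite /e !lt_min r0 ltr01 d10/= divr_gt0.
have [er e1 ed1 ed2] : [/\ e <= r, e <= 1, e <= d1 & e <= d2 / 3].
  by have := lexx e; rewrite {2}/e !le_min => /andP[/andP[-> ->] /andP[-> ->]].
have h1 t : 0 <= t -> `|t - r| < e -> `|P g t - P g r| <= eta / 2.
  by move=> t0 tr; apply/ltW/hd1 => //; exact: lt_le_trans ed1.
have := evolution_approx e0 er h1.
have l1 : 0 <= r - e by lra.
have l2 : r - e <= r + e by lra.
have l3 : r + e <= r + 1 by lra.
have l4 : (r + e) - (r - e) < d2 by lra.
have := hd2 _ _ l1 l2 l3 l4; rewrite (primitive_diff inf)//.
have p0 : 0 <= \int[mu]_(t in `[r - e, r + e]) `|flux g t| by exact: Rintegral_ge0.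
by rewrite (ger0_norm p0); lra.
Qed.

Lemma evolution s t : 0 <= s -> s <= t -> P g t - P g s = \int[mu]_(r in `[s, t]) flux g r.
Proof.
move=> s0 st; have := evolution0 s0; have := evolution0 (le_trans s0 st).
rewrite (Rint_split s0 st (@flux_integrable_itv g ig' 0 t (lexx 0))); lra.
Qed.

End fixed_test.
End evolution.

(** * Mollified steps *)

Section supported.
Variable R : realType.
Notation mu := (@lebesgue_measure R).
Implicit Types (f g h : R -> R) (x y z p q N C : R).

Lemma vanishing_bounded f N : continuous f -> (forall x, N < `|x| -> f x = 0) ->
  exists2 K, 0 <= K & forall x, `|f x| <= K.
Proof.
move=> cf f0; pose n := Num.max N 0.
have n0 : 0 <= n by rewrite /n le_max lexx orbT.
have nn : - n <= n by lra.
have cnf : continuous (fun x => `|f x|) by move=> x; apply: cvg_norm; exact: cf.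
have [c cin hc] := EVT_max nn (continuous_subspaceT cnf).
exists `|f c| => // x; have [xn|nx] := leP `|x| n.
  by apply: hc; rewrite in_itv/= -ler_norml.
by rewrite f0 ?normr0//; apply: le_lt_trans nx; rewrite /n le_max lexx.
Qed.

Lemma integrable_cst_itv p q C : mu.-integrable setT (EFin \o ((fun=> C) \_ `[p, q])).
Proof.
rewrite -restrict_EFin; apply/integrable_restrict => //; rewrite setTI.
by apply: (@integrable_bounded_itv _ _ _ _ `|C|).
Qed.

Lemma Rint_cst_itv p q C : p <= q -> \int[mu]_x ((fun=> C) \_ `[p, q]) x = C * (q - p).
Proof. by move=> pq; rewrite -Rintegral_mkcond Rint_cst. Qed.

Lemma Rint_norm_supp f p q C : p <= q -> mu.-integrable setT (EFin \o f) ->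
  (forall x, `|f x| <= C) -> (forall x, x < p \/ q < x -> f x = 0) ->
  \int[mu]_x `|f x| <= C * (q - p).
Proof.
move=> pq fi fC f0; rewrite -(Rint_cst_itv _ pq).
apply: le_Rintegral => //; [exact: integrable_norm|exact: integrable_cst_itv|].
move=> x _; rewrite patchE; case: ifPn => // nx; rewrite f0 ?normr0//.
move: nx; rewrite notin_setE/= in_itv/= => /negP; rewrite negb_and -!ltNge => /orP[]; by [left|right].
Qed.

Lemma smooth_mvt f x y : smooth f -> exists c, `|c - x| <= `|y - x| /\
  f y - f x = derive1 f c * (y - x).
Proof.
move=> sf; have cf : forall u v, {within `[u, v], continuous f}.
  by move=> u v; apply: continuous_subspaceT; exact: smooth_continuous.
have key u v : u <= v -> exists2 c, u <= c <= v & f v - f u = derive1 f c * (v - u).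
  move=> uv; have [c ci cE] := @MVT_segment _ f (derive1 f) u v uv (fun x _ => smooth_is_derive x sf) (cf u v).
  by exists c => //; move: ci; rewrite in_itv.
have [xy|/ltW yx] := leP x y.
  have [c /andP[c1 c2] cE] := key _ _ xy; exists c; split=> //.
  by rewrite !ger0_norm ?subr_ge0// lerB.
have [c /andP[c1 c2] cE] := key _ _ yx; exists c; split; last by lra.
by rewrite !ler0_norm ?subr_le0//; lra.
Qed.

Lemma smooth_lipschitz f K x y : smooth f -> (forall x, `|derive1 f x| <= K) ->
  `|f y - f x| <= K * `|y - x|.
Proof.
by move=> sf fK; have [c [_ ->]] := smooth_mvt x y sf; rewrite normrM ler_wpM2r.
Qed.

(** The mean value theorem is applied to f and then to its derivative; this gives K instead of K/2,
    which is enough. *)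
Lemma smooth_taylor f K x (h : R) : smooth f -> (forall x, `|derive1 (derive1 f) x| <= K) ->
  `|f (x - h) - f x + h * derive1 f x| <= K * h ^+ 2.
Proof.
move=> sf fK; have [c [cx ->]] := smooth_mvt x (x - h) sf.
have -> : derive1 f c * (x - h - x) + h * derive1 f x = h * (derive1 f x - derive1 f c) by ring.
rewrite normrM; have := smooth_lipschitz c x (smooth_derive1 sf) fK => l1.
have K0 : 0 <= K by apply: le_trans (fK 0).
have hx : `|x - c| <= `|h| by move: cx; rewrite distrC addrAC subrr add0r normrN.
apply: (@le_trans _ _ (`|h| * (K * `|h|))).
  by rewrite ler_wpM2l// (le_trans l1)// ler_wpM2l.
by rewrite -[h ^+ 2]real_normK ?num_real// expr2 mulrCA.
Qed.

End supported.

Section hstep.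
Variable R : realType.
Notation mu := (@lebesgue_measure R).
Implicit Types (x y z : R).

(** A mollified Heaviside function of width d at z. It is not integrable itself; differences, which
    are mollified indicators of intervals, and derivatives are. *)
Definition hstep (d z x : R) : R := smooth_step (d^-1 * x + - (z / d)).

Lemma hstepE d z x : hstep d z x = smooth_step ((x - z) / d).
Proof. by rewrite /hstep mulrBl [_ * x]mulrC. Qed.

Lemma smooth_hstep d z : smooth (hstep d z).
Proof. by apply: smooth_affine; exact: smooth_smooth_step. Qed.

Lemma derive1_affine (f : R -> R) b c : smooth f ->
  derive1 (fun x => f (b * x + c)) = (fun x => b * derive1 f (b * x + c)).
Proof.
move=> sf; apply: (is_derive_fun _).2 => x.
have haff : is_derive x 1 (fun x => b * x + c) b.
  have := is_deriveD (is_deriveZ b (is_derive_id x 1)) (is_derive_cst c x 1).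
  by rewrite addr0 [b *: 1]mulr1.
have := @is_derive1_comp _ f (fun x => b * x + c) x _ _ (smooth_is_derive _ sf) haff.
by rewrite [_ * b]mulrC.
Qed.

Lemma smoothZ (f : R -> R) b : smooth f -> smooth (fun x => b * f x).
Proof. by move=> sf; apply: smoothM => //; exact: smooth_cst. Qed.

Lemma derive1Z (f : R -> R) b : smooth f ->
  derive1 (fun x => b * f x) = (fun x => b * derive1 f x).
Proof.
move=> sf; apply: (is_derive_fun _).2 => x.
have := is_deriveZ b (smooth_is_derive x sf); exact.
Qed.

Variable d : R.
Hypothesis d0 : 0 < d.

Lemma hstep_derive z x : derive1 (hstep d z) x = d^-1 * derive1 (@smooth_step R) ((x - z) / d).
Proof.
rewrite /hstep derive1_affine; last exact: smooth_smooth_step.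
by rewrite mulrBl [x / d]mulrC.
Qed.

Lemma hstep_derive2 z x : derive1 (derive1 (hstep d z)) x =
  d^-1 * (d^-1 * derive1 (derive1 (@smooth_step R)) ((x - z) / d)).
Proof.
have S1 := @smooth_smooth_step R; have S2 := smooth_derive1 S1.
have E1 : derive1 (hstep d z) = (fun x => d^-1 * derive1 (@smooth_step R) (d^-1 * x + - (z / d))).
  exact: derive1_affine.
have E2 := derive1Z d^-1 (smooth_affine d^-1 (- (z / d)) S2).
have E3 := derive1_affine d^-1 (- (z / d)) S2.
have -> : (x - z) / d = d^-1 * x + - (z / d) by rewrite mulrBl mulrC.
by rewrite E1 E2 E3.
Qed.

Lemma hstep_left z x : x <= z - d -> hstep d z x = 0.
Proof. by move=> h; rewrite hstepE smooth_step_le0// ler_pdivrMr//; lra. Qed.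

Lemma hstep_right z x : z + d <= x -> hstep d z x = 1.
Proof. by move=> h; rewrite hstepE smooth_step_ge1// ler_pdivlMr//; lra. Qed.

Lemma hstep_itv z x : 0 <= hstep d z x <= 1.
Proof. by rewrite hstepE smooth_step_itv. Qed.

Lemma hstep_derive_ge0 z x : 0 <= derive1 (hstep d z) x.
Proof. by rewrite hstep_derive mulr_ge0 ?invr_ge0 ?(ltW d0)// smooth_step_derive_ge0. Qed.

Lemma hstep_derive_out z x : d <= `|x - z| -> derive1 (hstep d z) x = 0.
Proof.
move=> h; rewrite hstep_derive smooth_step_derive_out ?mulr0//.
by rewrite normrM normfV (gtr0_norm d0) ler_pdivlMr// mul1r.
Qed.

Lemma far_from (z x : R) : `|z| + d < `|x| -> d < `|x - z|.
Proof. by have := lerB_dist x z; lra. Qed.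

Lemma integrable_hstep_derive z : mu.-integrable setT (EFin \o derive1 (hstep d z)).
Proof.
apply: (@integrable_vanishing _ _ (`|z| + d)).
  by apply: smooth_continuous; apply: smooth_derive1; exact: smooth_hstep.
by move=> x /far_from/ltW; exact: hstep_derive_out.
Qed.

Lemma hstep_derive_vanish z x : `|z| + d < `|x| -> derive1 (hstep d z) x = 0.
Proof. by move=> /far_from/ltW; exact: hstep_derive_out. Qed.

Lemma Rint_hstep_derive z : \int[mu]_x `|derive1 (hstep d z) x| = 1.
Proof.
have -> : \int[mu]_x `|derive1 (hstep d z) x| = \int[mu]_(x in `[z - d, z + d]) derive1 (hstep d z) x.
  rewrite [RHS]Rintegral_mkcond; apply: eq_Rintegral => x _.
  rewrite patchE; case: ifPn => [_|]; first by rewrite ger0_norm// hstep_derive_ge0.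
  rewrite notin_setE/= in_itv/= => /negP nx; rewrite hstep_derive_out ?normr0//.
  by rewrite leNgt; apply: contra nx; rewrite ltr_distlC => /andP[? ?]; apply/andP; split; lra.
rewrite Rint_derive; [|exact: smooth_hstep|by move: (d0); lra].
by rewrite (hstep_right (lexx (z + d))) (hstep_left (lexx (z - d))) subr0.
Qed.

(** The bound is of order d^-2 but uniform in the centre z, which is what moving centres need while
    d is fixed. *)
Lemma hstep_derive2_bound : exists2 K, 0 <= K & forall z x,
  `|derive1 (derive1 (hstep d z)) x| <= K.
Proof.
have S1 := @smooth_smooth_step R.
have cS : continuous (derive1 (derive1 (@smooth_step R))).
  by apply: smooth_continuous; do 2!apply: smooth_derive1.
have vS : forall x : R, 1 < `|x| -> derive1 (derive1 (@smooth_step R)) x = 0.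
  by apply: vanishing_derive1 => x x1; rewrite smooth_step_derive_out// ltW.
have [K K0 hK] := vanishing_bounded cS vS.
exists (d^-1 * (d^-1 * K)); first by rewrite !mulr_ge0 ?invr_ge0 ?(ltW d0).
move=> z x; rewrite hstep_derive2 !normrM normfV (gtr0_norm d0).
by rewrite !ler_wpM2l ?invr_ge0 ?(ltW d0).
Qed.

Lemma hstep_derive2_int K z : (forall z x, `|derive1 (derive1 (hstep d z)) x| <= K) ->
  mu.-integrable setT (EFin \o derive1 (derive1 (hstep d z))) /\
  \int[mu]_x `|derive1 (derive1 (hstep d z)) x| <= K * (2 * d).
Proof.
move=> hK; have dp := d0.
have vS : forall x : R, 1 < `|x| -> derive1 (derive1 (@smooth_step R)) x = 0.
  by apply: vanishing_derive1 => x x1; rewrite smooth_step_derive_out// ltW.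
have out x : d < `|x - z| -> derive1 (derive1 (hstep d z)) x = 0.
  move=> h; rewrite hstep_derive2 vS ?mulr0//.
  by rewrite normrM normfV (gtr0_norm d0) ltr_pdivlMr// mul1r.
have ir : mu.-integrable setT (EFin \o derive1 (derive1 (hstep d z))).
  apply: (@integrable_vanishing _ _ (`|z| + d)); last by move=> x /far_from; exact: out.
  by apply: smooth_continuous; do 2!apply: smooth_derive1; exact: smooth_hstep.
split => //; have pq : z - d <= z + d by lra.
have := Rint_norm_supp pq ir (hK z).
have -> : z + d - (z - d) = 2 * d by ring.
by apply=> x [h|h]; apply: out; rewrite ltr_normr; apply/orP; [right|left]; lra.
Qed.

Lemma hstep_diff_vanish z1 z2 x : `|z1| + `|z2| + d < `|x| -> hstep d z1 x - hstep d z2 x = 0.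
Proof.
rewrite ltr_normr => /orP[h|h].
  rewrite !hstep_right ?subrr//.
    by have := ler_norm z2; have := normr_ge0 z1; lra.
  by have := ler_norm z1; have := normr_ge0 z2; lra.
rewrite !hstep_left ?subrr//.
  by have := ler_norm (- z2); have := normr_ge0 z1; rewrite normrN; lra.
by have := ler_norm (- z1); have := normr_ge0 z2; rewrite normrN; lra.
Qed.

Lemma smooth_hstep_diff z1 z2 : smooth (fun x => hstep d z1 x - hstep d z2 x).
Proof.
have -> : (fun x => hstep d z1 x - hstep d z2 x) = (fun x => hstep d z1 x + (-1) * hstep d z2 x).
  by apply/funext => x; rewrite mulN1r.
by apply: smoothD; [|apply: smoothZ]; exact: smooth_hstep.
Qed.

Lemma integrable_hstep_diff z1 z2 : mu.-integrable setT (EFin \o (fun x => hstep d z1 x - hstep d z2 x)).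
Proof.
apply: (@integrable_vanishing _ _ (`|z1| + `|z2| + d)).
  by apply: smooth_continuous; exact: smooth_hstep_diff.
exact: hstep_diff_vanish.
Qed.

Lemma derive1_hstep_diff z1 z2 x : derive1 (fun x => hstep d z1 x - hstep d z2 x) x =
  derive1 (hstep d z1) x - derive1 (hstep d z2) x.
Proof.
have := is_deriveB (smooth_is_derive x (smooth_hstep d z1)) (smooth_is_derive x (smooth_hstep d z2)).
by move=> /is_derive1P[].
Qed.

(** Moving the centre amounts to translating the argument, so [smooth_taylor] bounds the remainder
    pointwise. As z' stays within d of z, the remainder lives on an interval of length 4 d. *)
Lemma hstep_taylor K z z' : (forall z x, `|derive1 (derive1 (hstep d z)) x| <= K) ->
  `|z' - z| <= d ->
  mu.-integrable setT (EFin \o (fun x => hstep d z' x - hstep d z x + (z' - z) * derive1 (hstep d z) x)) /\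
  \int[mu]_x `|hstep d z' x - hstep d z x + (z' - z) * derive1 (hstep d z) x| <= 4 * d * K * (z' - z) ^+ 2.
Proof.
move=> hK zd; have dp := d0.
have ir : mu.-integrable setT (EFin \o (fun x => hstep d z' x - hstep d z x + (z' - z) * derive1 (hstep d z) x)).
  apply: integrableRD => //; first exact: integrable_hstep_diff.
  by apply: integrableRZ => //; exact: integrable_hstep_derive.
split => //.
have pq : z - 2 * d <= z + 2 * d by lra.
have := Rint_norm_supp pq ir (C := K * (z' - z) ^+ 2).
have -> : z + 2 * d - (z - 2 * d) = 4 * d by ring.
move=> H; apply: (le_trans (H _ _)).
- move=> x; have -> : hstep d z' x = hstep d z (x - (z' - z)).
    by rewrite !hstepE; congr smooth_step; congr (_ / _); ring.
  exact: smooth_taylor (smooth_hstep d z) (hK z).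
- move: zd; rewrite ler_norml => /andP[? ?] x [h|h].
    rewrite !hstep_left ?hstep_derive_out ?mulr0 ?subrr ?addr0//; try lra.
    by rewrite ler_normr; apply/orP; right; lra.
  rewrite !hstep_right ?hstep_derive_out ?mulr0 ?subrr ?addr0//; try lra.
  by rewrite ler_normr; apply/orP; left; lra.
- by rewrite [leLHS](_ : _ = 4 * d * K * (z' - z) ^+ 2)//; ring.
Qed.

End hstep.

(** * Two curves *)

Lemma acZ (R : realType) (f : R -> R) (c s t : R) : absolutely_continuous_on f s t ->
  absolutely_continuous_on (fun x => f x * c) s t.
Proof.
move=> acf e e0; have c1 : 0 < `|c| + 1 by rewrite ltr_wpDl.
have [d d0 h] := acf _ (divr_gt0 e0 c1); exists d => // n l r lr tI sd.
have := h n l r lr tI sd; rewrite ltr_pdivlMr//; apply: le_lt_trans.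
rewrite mulr_suml; apply: ler_sum => i _.
by rewrite -mulrBl normrM ler_wpM2l// lerDl.
Qed.

Section two_curves.
Variable R : realType.
Notation mu := (@lebesgue_measure R).
Variables (a v : R * R -> R) (v0 : R -> R) (w : R -> R -> R).
Hypothesis ha : L1loc_Linfty a.
Hypothesis hv0 : Linfty v0.
Hypothesis hw : weak_star_representative v v0 w.
Hypothesis hsol : weak_solution a v v0.
Implicit Types (f g h : R -> R) (s t r x z : R).
Notation vv := (ext_density v).
Notation aa := (ext_field a).
Notation P := (pairing w).
Variable M : R.
Hypothesis M0 : 0 <= M.
Hypothesis mvv : measurable_fun setT vv.
Hypothesis vM : {ae mu, forall t, {ae mu, forall x, `|vv (x, t)| <= M}}.
Notation regular := (regular_time a v w M).
Notation speed := (speed a).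

Definition osc (d z t : R) : R := esup a d z t - einf a d z t.

Lemma pairingD h1 h2 (c t : R) : 0 <= t -> mu.-integrable setT (EFin \o h1) ->
  mu.-integrable setT (EFin \o h2) ->
  P (fun x => h1 x + c * h2 x) t = P h1 t + c * P h2 t.
Proof.
move=> t0 i1 i2; have j1 := integrable_pairing hw t0 i1; have j2 := integrable_pairing hw t0 i2.
rewrite /pairing -RintegralZl// -RintegralD//; last exact: integrableRZ.
by apply: eq_Rintegral => x _; ring.
Qed.

Variable d : R.
Hypothesis d0 : 0 < d.
Notation k := (fun z => derive1 (hstep d z)).
Variable K : R.
Hypothesis K0 : 0 <= K.
Hypothesis hK : forall z x, `|derive1 (derive1 (hstep d z)) x| <= K.

Notation Phi z := (flux a v (hstep d z)).

Let ik z : mu.-integrable setT (EFin \o derive1 (hstep d z)) := integrable_hstep_derive d0 z.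

(** The derivative of the step has mass one and is supported in the ball of radius d, so replacing
    the field by c there costs at most M th. *)
Lemma flux_osc r z c th : regular r -> 
  {ae mu, forall x, z - d < x < z + d -> `|aa (x, r) - c| <= th} ->
  `|Phi z r - c * P (derive1 (hstep d z)) r| <= M * th.
Proof.
move=> rr hth; have [gt wt vt] := rr; have r0 := gt.1.
have th0 : 0 <= th.
  have zz : z - d < z + d by move: (d0); lra.
  have [x xz hx] := ae_itv_ex zz hth; exact: le_trans (hx xz).
have i1 := flux_integrable ha mvv (ik z) rr.
have i2 := integrable_pairing hw r0 (ik z).
rewrite /pairing -RintegralZl// -RintegralB//; last exact: integrableRZ.
have -> : M * th = \int[mu]_x (M * th * `|derive1 (hstep d z) x|).
  by rewrite RintegralZl//; [rewrite (Rint_hstep_derive d0) mulr1|exact: integrable_norm].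
apply: Rint_ae_norm_le => //.
- apply: (@integrableR_measurable _ _ _ mu); apply: integrableRB => //; exact: integrableRZ.
- by apply: integrableRZ => //; exact: integrable_norm.
- move: hth (ae_imp2 (fun x => @conj _ _) wt vt); apply: ae_imp2 => x hx [-> vx] _.
  have -> : aa (x, r) * derive1 (hstep d z) x * vv (x, r) - c * (vv (x, r) * derive1 (hstep d z) x)
    = vv (x, r) * (aa (x, r) - c) * derive1 (hstep d z) x by ring.
  rewrite 2!normrM.
  have [xz|zx] := ltP `|x - z| d; last by rewrite hstep_derive_out// normr0 !mulr0.
  rewrite ler_wpM2r//; apply: ler_pM => //; apply: hx.
  by move: xz; rewrite ltr_norml => /andP[? ?]; apply/andP; split; lra.
Qed.

Lemma pairing_kernel_dist r r1 z : 0 <= r -> r <= r1 ->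
  `|P (derive1 (hstep d z)) r1 - P (derive1 (hstep d z)) r| <=
     M * (K * (2 * d)) * \int[mu]_(x in `[r, r1]) speed x.
Proof.
move=> r0 rr1.
have sk := smooth_derive1 (smooth_hstep d z).
have [ik2 bk2] := hstep_derive2_int d0 z hK.
rewrite (evolution ha hv0 hw hsol mvv vM sk (hstep_derive_vanish d0 (z := z)) r0 rr1).
have is_ := @integrable_speed _ _ ha r r1 r0.
have C0 : 0 <= M * (K * (2 * d)) by rewrite !mulr_ge0// ltW.
rewrite -RintegralZl//; apply: Rint_ae_norm_le => //.
- apply: measurable_funTS; exact: (measurable_flux ha mvv ik2).
- exact: integrableRZ.
- have := regular_time_ae ha hw vM; apply: ae_imp => x hx; rewrite /= in_itv/= => /andP[rx _].
  have rx' := hx (le_trans r0 rx).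
  apply: (le_trans (flux_bound ha mvv ik2 rx')).
  by rewrite ler_wpM2r ?speed_ge0// ler_wpM2l.
Qed.

Section one_curve.
Variables (s : R) (g : R -> R).
Hypotheses (s0 : 0 <= s) (gc : filippov_curve a s g).

Lemma integrable_osc dd u v' : 0 < dd -> s <= u -> mu.-integrable `[u, v'] (EFin \o (fun r => osc dd (g r) r)).
Proof.
move=> dd0 su; have [uv|vu] := leP u v'; last first.
  by rewrite set_itv_ge ?bnd_simp -?ltNge//; exact: integrable_set0.
have acg : absolutely_continuous_on g u v'.
  by apply: acS (gc.1 v' _) => //; exact: le_trans uv.
apply: integrableRB => //.
  by apply: integrable_esup => //; exact: le_trans su.
by apply: integrable_einf => //; exact: le_trans su.
Qed.

(** With the centre frozen at [g r0], the flux integral and the later shift of the centre to [g r1]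
    are, up to errors, opposite multiples of q, the pairing with the kernel at time r1. The curve
    stays within d of [g r0], so the kernel's ball lies in the ball of radius 2 d about the current
    position. The constant 6 is 4 from the Taylor remainder plus 2 from taking the kernel pairing at
    time r1 instead of r. *)
Lemma one_curve r0 r1 : s <= r0 -> r0 <= r1 -> \int[mu]_(x in `[r0, r1]) speed x <= d ->
  `|\int[mu]_(r in `[r0, r1]) Phi (g r0) r + P (fun x => hstep d (g r1) x - hstep d (g r0) x) r1| <=
   M * \int[mu]_(r in `[r0, r1]) osc (2 * d) (g r) r +
   6 * M * K * d * (\int[mu]_(x in `[r0, r1]) speed x) ^+ 2.
Proof.
move=> sr0 r01 small; have dp := d0.
set dA := \int[mu]_(x in `[r0, r1]) speed x in small *.
have dA0 : 0 <= dA by apply: Rintegral_ge0 => x _; exact: speed_ge0.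
have r0p : 0 <= r0 by exact: le_trans sr0.
have r1p : 0 <= r1 by exact: le_trans r01.
set z := g r0; set z' := g r1; set q := P (derive1 (hstep d z)) r1.
have isp u t : r0 <= u -> mu.-integrable `[u, t] (EFin \o speed).
  by move=> ru; apply: integrable_speed => //; exact: le_trans ru.
have part u : r0 <= u -> u <= r1 -> \int[mu]_(x in `[r0, u]) speed x <= dA /\ \int[mu]_(x in `[u, r1]) speed x <= dA.
  move=> ru ur; rewrite /dA (Rint_split ru ur (isp _ _ (lexx r0))) lerDl lerDr.
  by split; apply: Rintegral_ge0 => x _; exact: speed_ge0.
have gz u : r0 <= u -> u <= r1 -> `|g u - z| <= dA.
  by move=> ru ur; apply: (le_trans (curve_dist ha s0 gc sr0 ru)); have [] := part _ ru ur.
have zz : `|z' - z| <= dA by exact: gz.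
have A : `|P (fun x => hstep d z' x - hstep d z x) r1 + (z' - z) * q| <= M * (4 * d * K * dA ^+ 2).
  have [it bt] := hstep_taylor d0 hK (le_trans zz small).
  rewrite /q -pairingD//; last exact: integrable_hstep_diff.
  apply: (le_trans (pairing_bound ha hw vM r1p it)); rewrite ler_wpM2l//.
  apply: (le_trans bt); rewrite ler_wpM2l//; first by rewrite !mulr_ge0// ltW.
  by rewrite -[(z' - z) ^+ 2]real_normK ?num_real// lerXn2r ?nnegrE.
have acg : absolutely_continuous_on g r0 r1 by apply: acS (gc.1 r1 _) => //; exact: le_trans r01.
have iPhi u t : r0 <= u -> mu.-integrable `[u, t] (EFin \o Phi z).
  by move=> ru; apply: (flux_integrable_itv ha hw mvv vM (ik z)); exact: le_trans ru.
have io := integrable_osc r1 (mulr_gt0 (ltr0Sn R 1) d0) sr0.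
(* The first term bounds the deviation of the field from the velocity of the curve on the kernel's
   support; the second bounds the variation of the kernel pairing between r and r1, multiplied by
   the velocity. *)
pose Th r := M * osc (2 * d) (g r) r + M * (K * (2 * d)) * dA * speed r.
have iTh : mu.-integrable `[r0, r1] (EFin \o Th).
  by apply: integrableRD => //; apply: integrableRZ => //; exact: isp.
have IThE : \int[mu]_(r in `[r0, r1]) Th r = M * \int[mu]_(r in `[r0, r1]) osc (2 * d) (g r) r
    + M * (K * (2 * d)) * dA * dA.
  rewrite RintegralD//; [|exact: integrableRZ|by apply: integrableRZ => //; exact: isp].
  by rewrite !RintegralZl//; exact: isp.
have bnd : {ae mu, forall r, r0 < r < r1 -> [/\ derivable g r 1, is_derive r 1 (fun y => \int[mu]_(x in `[r0, y]) Phi z x) (Phi z r) &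
    `|Phi z r - derive1 g r * q| <= Th r]}.
  have h1 := curve_derive ha s0 gc; have h2 := regular_time_ae ha hw vM.
  have h3 := primitive_is_derive (iPhi r0 r1 (lexx r0)).
  move: (ae_imp2 (fun x => @conj _ _) h1 h2) h3; apply: ae_imp2 => r [k1 k2] k3 r01'.
  have /andP[r0r rr1] := r01'.
  have [dg gt env] := k1 (le_lt_trans sr0 r0r).
  have rr := k2 (le_trans r0p (ltW r0r)).
  split => //; first exact: k3.
  have d2 : 0 < 2 * d by lra.
  have /andP[e1 e2] := env _ d2.
  have hg := gz _ (ltW r0r) (ltW rr1).
  have B1 : `|Phi z r - derive1 g r * P (derive1 (hstep d z)) r| <= M * osc (2 * d) (g r) r.
    apply: flux_osc => //; have := good_ae_between (g r) gt d2; apply: ae_imp => x hx /andP[zx xz].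
    move: (le_trans hg small); rewrite ler_norml => /andP[g1 g2].
    have /hx /andP[a1 a2] : g r - 2 * d < x < g r + 2 * d by apply/andP; split; lra.
    by rewrite ext_fieldE ?gt.1// ler_norml /osc; apply/andP; split; lra.
  have [_ _ s1 s2 s3] := good_ball_bounds (g r) gt d2.
  have B2 : `|derive1 g r| <= speed r by rewrite ler_norml; apply/andP; split; lra.
  have B3 := pairing_kernel_dist z (le_trans r0p (ltW r0r)) (ltW rr1).
  have [_ p2] := part _ (ltW r0r) (ltW rr1).
  have C0 : 0 <= M * (K * (2 * d)) by rewrite !mulr_ge0// ltW.
  have -> : Phi z r - derive1 g r * q = (Phi z r - derive1 g r * P (derive1 (hstep d z)) r)
     - derive1 g r * (q - P (derive1 (hstep d z)) r) by ring.
  apply: (le_trans (ler_normB _ _)); apply: lerD => //.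
  rewrite normrM mulrC; apply: ler_pM => //; apply: (le_trans B3).
  by rewrite ler_wpM2l.
have key : `|\int[mu]_(r in `[r0, r1]) Phi z r - (z' - z) * q| <= \int[mu]_(r in `[r0, r1]) Th r.
  (* An absolutely continuous function whose derivative is the quantity bounded by [Th]; no change
     of variable along g is needed. *)
  pose f y := \int[mu]_(x in `[r0, y]) Phi z x - g y * q.
  have acf : absolutely_continuous_on f r0 r1.
    apply: acD; first by apply: primitive_ac; exact: iPhi.
    by apply: acN; exact: acZ.
  have fE : f r1 - f r0 = \int[mu]_(r in `[r0, r1]) Phi z r - (z' - z) * q.
    by rewrite /f set_itv1 Rintegral_set1 -/z -/z'; ring.
  have fd r : derivable g r 1 -> is_derive r 1 (fun y => \int[mu]_(x in `[r0, y]) Phi z x) (Phi z r) ->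
     is_derive r 1 f (Phi z r - derive1 g r * q).
    move=> dg dP; have := is_deriveB dP (is_deriveM (derivable_is dg) (is_derive_cst q r 1)).
    by rewrite scaler0 add0r [_ *: derive1 g r]mulrC.
  rewrite -fE ler_norml; apply/andP; split; last first.
    apply: ac_le_integral => //; move: bnd; apply: ae_imp => r h /h[dg dP].
    by have /is_derive1P[df ->] := fd _ dg dP; rewrite ler_norml => /andP[].
  rewrite lerNl opprB -[X in X <= _](_ : - f r1 - - f r0 = _); last by ring.
  apply: (@ac_le_integral _ (fun y => - f y)) => //; first exact: acN.
  move: bnd; apply: ae_imp => r h /h[dg dP].
  have /is_derive1P[df ->] := is_deriveN (fd _ dg dP).
  by rewrite ler_norml => /andP[? ?]; split=> //; rewrite lerNl.
rewrite IThE in key.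
have -> : \int[mu]_(r in `[r0, r1]) Phi z r + P (fun x => hstep d z' x - hstep d z x) r1 =
  (\int[mu]_(r in `[r0, r1]) Phi z r - (z' - z) * q) +
  (P (fun x => hstep d z' x - hstep d z x) r1 + (z' - z) * q) by ring.
apply: (le_trans (ler_normD _ _)); apply: (le_trans (lerD key A)).
by rewrite [leLHS](_ : _ = M * \int[mu]_(r in `[r0, r1]) osc (2 * d) (g r) r + 6 * M * K * d * dA ^+ 2)//; ring.
Qed.

End one_curve.
End two_curves.

Section two_curves.
Variable R : realType.
Notation mu := (@lebesgue_measure R).
Variables (a v : R * R -> R) (v0 : R -> R) (w : R -> R -> R).
Hypothesis ha : L1loc_Linfty a.
Hypothesis hv0 : Linfty v0.
Hypothesis hw : weak_star_representative v v0 w.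
Hypothesis hsol : weak_solution a v v0.
Implicit Types (f g h : R -> R) (s t r x z : R).
Notation vv := (ext_density v).
Notation P := (pairing w).
Variable M : R.
Hypothesis M0 : 0 <= M.
Hypothesis mvv : measurable_fun setT vv.
Hypothesis vM : {ae mu, forall t, {ae mu, forall x, `|vv (x, t)| <= M}}.
Notation speed := (speed a).
Notation osc := (osc a).

Lemma pairingB h1 h2 t : 0 <= t -> mu.-integrable setT (EFin \o h1) ->
  mu.-integrable setT (EFin \o h2) ->
  P (fun x => h1 x - h2 x) t = P h1 t - P h2 t.
Proof.
move=> t0 i1 i2; have := pairingD hw (-1) t0 i1 i2; rewrite mulN1r => <-.
by congr pairing; apply/funext => x; rewrite mulN1r.
Qed.

(** Meant for steps, which cannot be paired one by one for lack of integrability; the regrouping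
    only uses differences. *)
Lemma pairing_exchange f1 f2 h1 h2 t : 0 <= t ->
  mu.-integrable setT (EFin \o (fun x => f1 x - f2 x)) ->
  mu.-integrable setT (EFin \o (fun x => h1 x - h2 x)) ->
  mu.-integrable setT (EFin \o (fun x => f1 x - h1 x)) ->
  mu.-integrable setT (EFin \o (fun x => f2 x - h2 x)) ->
  P (fun x => f1 x - f2 x) t - P (fun x => h1 x - h2 x) t =
  P (fun x => f1 x - h1 x) t - P (fun x => f2 x - h2 x) t.
Proof.
move=> t0 i1 i2 i3 i4; have <- := pairingB t0 i1 i2; have <- := pairingB t0 i3 i4.
by congr pairing; apply/funext => x; ring.
Qed.

Lemma Rint_scaled_sum c f g u t : mu.-integrable `[u, t] (EFin \o f) ->
  mu.-integrable `[u, t] (EFin \o g) ->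
  \int[mu]_(r in `[u, t]) (c * (f r + g r)) =
  c * \int[mu]_(r in `[u, t]) f r + c * \int[mu]_(r in `[u, t]) g r.
Proof.
move=> fi gi; rewrite RintegralZl//; last exact: integrableRD.
by rewrite RintegralD// mulrDr.
Qed.

Lemma increment_sum (H1 H0 p F1 F2 Q1 Q2 b1 b2 K d S : R) :
  `|F1 + Q1| <= b1 + 6 * M * K * d * S -> `|F2 + Q2| <= b2 + 6 * M * K * d * S ->
  p - H0 = F1 - F2 -> H1 - p = Q1 - Q2 -> `|H1 - H0| <= b1 + b2 + 12 * M * K * d * S.
Proof.
move=> A1 A2 E1 E2; have -> : H1 - H0 = (F1 + Q1) - (F2 + Q2) by lra.
apply: (le_trans (ler_normB _ _)); apply: (le_trans (lerD A1 A2)); by rewrite le_eqVlt; apply/orP; left; apply/eqP; ring.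
Qed.

(* A defect quadratic in the length of the step disappears under refinement. *)
Lemma quadratic_defect (H Th S : R -> R) (C d s t : R) : s <= t -> 0 <= C -> 0 < d ->
  (forall r, 0 <= S r) -> mu.-integrable `[s, t] (EFin \o S) ->
  mu.-integrable `[s, t] (EFin \o Th) ->
  (forall u v, s <= u -> u <= v -> v <= t -> \int[mu]_(r in `[u, v]) S r <= d ->
    `|H v - H u| <= \int[mu]_(r in `[u, v]) Th r + C * (\int[mu]_(r in `[u, v]) S r) ^+ 2) ->
  `|H t - H s| <= \int[mu]_(r in `[s, t]) Th r.
Proof.
move=> st C0 d0 S0 iS iTh hC.
suff h eps : 0 < eps -> `|H t - H s| <= \int[mu]_(r in `[s, t]) Th r + eps * \int[mu]_(r in `[s, t]) S r.
  apply/ler_addgt0Pr => e e0.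
  set I := \int[mu]_(r in `[s, t]) S r in h.
  have I0 : 0 <= I by apply: Rintegral_ge0.
  have I1 : 0 < I + 1 by rewrite ltr_wpDl.
  apply: (le_trans (h _ (divr_gt0 e0 I1))); rewrite lerD2l mulrAC ler_pdivrMr//.
  by rewrite ler_wpM2l ?ltW// ltrDl.
move=> eps0.
(* This bound is additive, so it is enough to have it on short intervals; where the integral of S is
   below eps/(C + 1), the square is absorbed. *)
pose D u v := `|H v - H u| <= \int[mu]_(r in `[u, v]) Th r + eps * \int[mu]_(r in `[u, v]) S r.
apply: (@cousin _ D) => //; last first.
  move=> x y z sx xy yz zt Dxy Dyz.
  have iT := integrable_itvS sx zt iTh; have iS' := integrable_itvS sx zt iS.
  rewrite /D (Rint_split xy yz iT) (Rint_split xy yz iS') mulrDr addrACA.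
  by apply: (le_trans (ler_distD (H y) _ _)); rewrite addrC; exact: lerD.
move=> x _.
have C1 : 0 < C + 1 by apply: ltr_wpDl.
have e0 : 0 < Num.min d (eps / (C + 1)) by rewrite lt_min d0 divr_gt0.
have [e e_gt0 he] := ac_continuity (primitive_ac iS) e0.
exists e => // u r su ux xr rt ur.
have ur' := le_trans ux xr.
have := he u r su ur' rt ur; rewrite (primitive_diff iS su ur' rt).
have I0 : 0 <= \int[mu]_(y in `[u, r]) S y by apply: Rintegral_ge0.
rewrite ger0_norm// lt_min => /andP[sd se].
apply: (le_trans (hC u r su ur' rt (ltW sd))); rewrite lerD2l expr2 mulrA ler_wpM2r//.
move: se; rewrite ltr_pdivlMr// => se; move: (ltW se).
by apply: le_trans; rewrite mulrC ler_wpM2l// lerDl.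
Qed.

Section window.
Variable d : R.
Hypothesis d0 : 0 < d.

Section curves.
Variables (s : R) (g1 g2 : R -> R).
Hypotheses (s0 : 0 <= s) (gc1 : filippov_curve a s g1) (gc2 : filippov_curve a s g2).

Let H r := P (fun x => hstep d (g1 r) x - hstep d (g2 r) x) r.
Let Th r := M * (osc (2 * d) (g1 r) r + osc (2 * d) (g2 r) r).

Let io g u t : filippov_curve a s g -> s <= u ->
  mu.-integrable `[u, t] (EFin \o (fun r => osc (2 * d) (g r) r)).
Proof. by move=> gc su; apply: (integrable_osc ha s0 gc) => //; rewrite mulr_gt0. Qed.

Let isp u t : s <= u -> mu.-integrable `[u, t] (EFin \o speed).
Proof. by move=> su; apply: integrable_speed => //; exact: le_trans su. Qed.

Let iTh u t : s <= u -> mu.-integrable `[u, t] (EFin \o Th).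
Proof. by move=> su; apply: integrableRZ => //; apply: integrableRD => //; exact: io. Qed.

(** The increment of H passes through the pairing with centres taken at r0 and density at r1: first
    a fixed test function evolves, then the centres move at a fixed time. Each end contributes the
    estimate of [one_curve], whence 12. *)
Lemma two_curves_step : exists2 C, 0 <= C & forall r0 r1, s <= r0 -> r0 <= r1 ->
  \int[mu]_(x in `[r0, r1]) speed x <= d ->
  `|H r1 - H r0| <= \int[mu]_(r in `[r0, r1]) Th r + C * (\int[mu]_(x in `[r0, r1]) speed x) ^+ 2.
Proof.
have [K K0 hK] := hstep_derive2_bound d0.
exists (12 * M * K * d); first by rewrite !mulr_ge0// ltW.
move=> r0 r1 sr0 r01 small.
have r0p : 0 <= r0 by exact: le_trans sr0.
have r1p : 0 <= r1 by exact: le_trans r01.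
have A1 := one_curve ha hv0 hw hsol M0 mvv vM d0 K0 hK s0 gc1 sr0 r01 small.
have A2 := one_curve ha hv0 hw hsol M0 mvv vM d0 K0 hK s0 gc2 sr0 r01 small.
have iF z : mu.-integrable `[r0, r1] (EFin \o flux a v (hstep d z)).
  exact: (flux_integrable_itv ha hw mvv vM (integrable_hstep_derive d0 z)).
have ID z1 z2 := integrable_hstep_diff d0 z1 z2.
have E1 : P (fun x => hstep d (g1 r0) x - hstep d (g2 r0) x) r1 - H r0 =
    \int[mu]_(r in `[r0, r1]) flux a v (hstep d (g1 r0)) r -
    \int[mu]_(r in `[r0, r1]) flux a v (hstep d (g2 r0)) r.
  rewrite (evolution ha hv0 hw hsol mvv vM (smooth_hstep_diff d _ _)
    (hstep_diff_vanish d0 (z1 := _) (z2 := _)) r0p r01) -RintegralB//.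
  have mD z1 z2 : measurable_fun setT (flux a v (fun x => hstep d z1 x - hstep d z2 x)).
    apply: (measurable_flux ha mvv).
    have -> : derive1 (fun x => hstep d z1 x - hstep d z2 x) =
       (fun x => derive1 (hstep d z1) x - derive1 (hstep d z2) x).
      by apply/funext => x; exact: derive1_hstep_diff.
    by apply: integrableRB => //; exact: integrable_hstep_derive.
  apply: Rint_ae_eq => //.
  - by apply: measurable_funTS; exact: mD.
  - by apply: integrableR_measurable; apply: integrableRB.
  - have := regular_time_ae ha hw vM; apply: ae_imp => r hr; rewrite /= in_itv/= => /andP[rx _].
    have rr := hr (le_trans r0p rx).
    rewrite /flux -RintegralB//; first by apply: eq_Rintegral => x _; rewrite derive1_hstep_diff mulrBr mulrBl.
    + exact: (flux_integrable ha mvv (integrable_hstep_derive d0 _) rr).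
    + exact: (flux_integrable ha mvv (integrable_hstep_derive d0 _) rr).
have E2 : H r1 - P (fun x => hstep d (g1 r0) x - hstep d (g2 r0) x) r1 =
    P (fun x => hstep d (g1 r1) x - hstep d (g1 r0) x) r1 -
    P (fun x => hstep d (g2 r1) x - hstep d (g2 r0) x) r1.
  exact: (pairing_exchange r1p (ID (g1 r1) (g2 r1)) (ID (g1 r0) (g2 r0)) (ID (g1 r1) (g1 r0)) (ID (g2 r1) (g2 r0))).
have IE : \int[mu]_(r in `[r0, r1]) Th r = M * \int[mu]_(r in `[r0, r1]) osc (2 * d) (g1 r) r +
     M * \int[mu]_(r in `[r0, r1]) osc (2 * d) (g2 r) r.
  exact: (Rint_scaled_sum M (io r1 gc1 sr0) (io r1 gc2 sr0)).
rewrite IE; exact: (increment_sum A1 A2 E1 E2).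
Qed.

Lemma two_curves t : s <= t -> `|H t - H s| <= \int[mu]_(r in `[s, t]) Th r.
Proof.
move=> st; have [C C0 hC] := two_curves_step.
apply: (quadratic_defect st C0 d0 _ (isp t (lexx s)) (iTh t (lexx s))).
  by move=> x; exact: speed_ge0.
by move=> u r su ur rt; exact: hC.
Qed.

End curves.
End window.
End two_curves.

(** * Conservation of mass between two curves *)

Section interval_mass.
Variable R : realType.
Notation mu := (@lebesgue_measure R).
Variables (a v : R * R -> R) (v0 : R -> R) (w : R -> R -> R).
Hypothesis ha : L1loc_Linfty a.
Hypothesis hv0 : Linfty v0.
Hypothesis hw : weak_star_representative v v0 w.
Hypothesis hsol : weak_solution a v v0.
Implicit Types (f g h : R -> R) (s t r x z : R).
Notation vv := (ext_density v).
Notation P := (pairing w).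
Variable M : R.
Hypothesis M0 : 0 <= M.
Hypothesis mvv : measurable_fun setT vv.
Hypothesis vM : {ae mu, forall t, {ae mu, forall x, `|vv (x, t)| <= M}}.
Notation speed := (speed a).
Notation osc := (osc a).

Lemma integrable_indic_itvco z1 z2 : mu.-integrable setT (EFin \o (\1_(`[z1, z2[) : R -> R)).
Proof.
have : mu.-integrable setT (EFin \o ((fun=> 1 : R) \_ `[z1, z2[)).
  rewrite -restrict_EFin; apply/integrable_restrict => //; rewrite setTI.
  apply: (@integrableS _ _ _ mu `[z1, z2]) => //; first by apply: subset_itv; rewrite bnd_simp.
  by apply: (@integrable_bounded_itv _ _ _ _ `|1|).
by apply: eq_integrable => // x _ /=; rewrite patchE indicE; case: ifPn.
Qed.

(** At each end the sharp and the mollified step differ by at most one, on an interval of length 2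
    d. *)
Lemma indic_hstep_close d z1 z2 r : 0 < d -> 0 <= r -> z1 <= z2 ->
  `|P (\1_(`[z1, z2[)) r - P (fun x => hstep d z1 x - hstep d z2 x) r| <= M * (4 * d).
Proof.
move=> d0 r0 z12.
have i1 := integrable_indic_itvco z1 z2; have i2 := integrable_hstep_diff d0 z1 z2.
have i3 : mu.-integrable setT (EFin \o (fun x => \1_(`[z1, z2[) x - (hstep d z1 x - hstep d z2 x))).
  exact: integrableRB.
rewrite -(pairingB hw r0 i1 i2); apply: (le_trans (pairing_bound ha hw vM r0 i3)).
rewrite ler_wpM2l//.
pose b z := (fun=> 1 : R) \_ `[z - d, z + d].
have ib z : mu.-integrable setT (EFin \o b z) by exact: integrable_cst_itv.
have -> : 4 * d = \int[mu]_x (b z1 x + b z2 x).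
  by rewrite RintegralD// !Rint_cst_itv ?mul1r; lra.
suff pw (x : R) : `|\1_(`[z1, z2[) x - (hstep d z1 x - hstep d z2 x)| <= b z1 x + b z2 x.
  apply: le_Rintegral => //.
    exact: (@integrable_norm _ _ _ mu).
  exact: (integrableRD measurableT (ib z1) (ib z2)).
have close (z : R) : `|(z <= x)%R%:R - hstep d z x| <= b z x.
  rewrite /b patchE; case: ifPn.
    rewrite inE/= in_itv/= => _; have := hstep_itv d z x => /andP[h0 h1].
    by rewrite ler_norml; case: (z <= x) => /=; apply/andP; split; lra.
  rewrite notin_setE/= in_itv/= => /negP; rewrite negb_and -!ltNge => /orP[xz|zx].
    have -> : (z <= x) = false by apply/negbTE; rewrite -ltNge; move: (d0); lra.
    by rewrite hstep_left ?(ltW xz)// subrr normr0.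
  have -> : z <= x by move: (d0); lra.
  by rewrite hstep_right ?(ltW zx)// subrr normr0.
have -> : \1_(`[z1, z2[) x = (z1 <= x)%R%:R - (z2 <= x)%R%:R :> R.
  rewrite indicE mem_setE in_itv/=; case: (leP z2 x) => zx.
    by rewrite (le_trans z12 zx)/= subrr.
  by rewrite andbT subr0.
move: (close z1) (close z2); generalize (hstep d z1 x) (hstep d z2 x) => p q k1 k2.
have -> : (z1 <= x)%R%:R - (z2 <= x)%R%:R - (p - q) = ((z1 <= x)%R%:R - p) - ((z2 <= x)%R%:R - q) :> R by ring.
by apply: (le_trans (ler_normB _ _)); exact: lerD.
Qed.

Lemma dist_detour (p1 p2 p3 p4 b c : R) : `|p1 - p2| <= b -> `|p3 - p4| <= b ->
  `|p2 - p4| <= c -> `|p1 - p3| <= b + c + b.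
Proof.
move=> k1 k2 k3; have -> : p1 - p3 = (p1 - p2) + (p2 - p4) - (p3 - p4) by ring.
by apply: (le_trans (ler_normB _ _)); apply: lerD => //; apply: (le_trans (ler_normD _ _)); exact: lerD.
Qed.

Lemma split_error (x i1 i2 : R) :
  M * (i1 + i2) + M * 4 * x = M * (4 * (x / 2)) + (M * i1 + M * i2) + M * (4 * (x / 2)).
Proof. by field. Qed.

(** The condition under which the error made at this end in [two_curves] disappears with the
    width. *)
Definition thin (s t : R) g :=
  (fun n => \int[mu]_(r in `[s, t]) osc (harmonic n) (g r) r) @ \oo --> 0.

Lemma interval_mass s t g1 g2 : 0 <= s -> s <= t ->
  filippov_curve a s g1 -> filippov_curve a s g2 ->
  thin s t g1 -> thin s t g2 -> g1 s <= g2 s -> g1 t <= g2 t ->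
  P (\1_(`[g1 t, g2 t[)) t = P (\1_(`[g1 s, g2 s[)) s.
Proof.
move=> s0 st gc1 gc2 th1 th2 gs gt; apply/eqP; rewrite -subr_eq0 -normr_le0.
have t0 := le_trans s0 st.
pose I g n := \int[mu]_(r in `[s, t]) osc (harmonic n) (g r) r.
pose u n := M * (I g1 n + I g2 n) + M * 4 * harmonic n.
have u0 : u @ \oo --> 0.
  have c1 : M * (I g1 n + I g2 n) @[n --> \oo] --> M * (0 + 0).
    by apply: cvgM; [exact: cvg_cst|exact: (cvgD th1 th2)].
  have c2 : M * 4 * harmonic n @[n --> \oo] --> M * 4 * 0.
    by apply: cvgM; [exact: cvg_cst|exact: cvg_harmonic].
  have h := cvgD c1 c2; rewrite addr0 !mulr0 addr0 in h; exact: h.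
apply: (ler_cvg_to (cvg_cst _) u0); near=> n.
(* Half of [harmonic n], as the oscillation is taken on balls of radius twice the width. *)
have d0 : 0 < harmonic n / 2 :> R by rewrite divr_gt0// harmonic_gt0.
have k1 := indic_hstep_close d0 t0 gt.
have k2 := indic_hstep_close d0 s0 gs.
have k3 := two_curves ha hv0 hw hsol M0 mvv vM d0 s0 gc1 gc2 st.
have io g : filippov_curve a s g -> mu.-integrable `[s, t] (EFin \o (fun r => osc (harmonic n) (g r) r)).
  by move=> gc; apply: (integrable_osc ha s0 gc) => //; exact: harmonic_gt0.
rewrite [2 * (_ / 2)]mulrC divfK// in k3.
rewrite (Rint_scaled_sum M (io _ gc1) (io _ gc2)) in k3.
rewrite /u split_error; exact: (dist_detour k1 k2 k3).
Unshelve. all: by end_near.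
Qed.

Lemma ae_neq x : {ae mu, forall y, y <> x}.
Proof.
exists [set x]; split=> //; first exact: lebesgue_measure_set1.
by move=> y /= /contrapT.
Qed.

Lemma ae_itv_interior s t : {ae mu, forall r, `[s, t]%classic r -> s < r < t}.
Proof.
move: (ae_neq s) (ae_neq t); apply: ae_imp2 => r /eqP rs /eqP rt.
by rewrite /= in_itv/= 2!le_eqVlt eq_sym (negbTE rs) (negbTE rt).
Qed.

(** Dominated convergence: at good times the oscillation is at most twice [speed], which is
    integrable. *)
Lemma thin_of_ae s t g : 0 <= s -> s <= t -> filippov_curve a s g ->
  {ae mu, forall r, s < r < t -> (fun n => osc (harmonic n) (g r) r) @ \oo --> 0} -> thin s t g.
Proof.
move=> s0 st gc hosc.
pose f_ n r := (osc (harmonic n) (g r) r)%:E.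
have io n : mu.-integrable `[s, t] (f_ n).
  by apply: (integrable_osc ha s0 gc) => //; exact: harmonic_gt0.
have isp : mu.-integrable `[s, t] (EFin \o (fun r => 2 * speed r)).
  by apply: integrableRZ => //; exact: integrable_speed.
have mf n : measurable_fun `[s, t] (f_ n) by exact: measurable_int (io n).
have ff : {ae mu, forall r, `[s, t]%classic r -> f_ ^~ r @ \oo --> (cst 0%E : R -> \bar R) r}.
  move: hosc (ae_itv_interior s t); apply: ae_imp2 => r hr hi rst.
  by apply: cvg_EFin; [exact: nearW|apply: hr; exact: hi].
have dom : {ae mu, forall r n, `[s, t]%classic r -> (`|f_ n r| <= (EFin \o (fun r => 2 * speed r)%R) r)%E}.
  have := good_time_ae ha; apply: ae_imp => r hr n; rewrite /= in_itv/= => /andP[sr _].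
  have gt := hr (le_trans s0 sr).
  have [_ _ b1 b2 b3] := good_ball_bounds (g r) gt (@harmonic_gt0 R n).
  by rewrite /f_ lee_fin /osc ger0_norm ?subr_ge0// mulr_natl mulr2n lerD// lerNl.
have [_ _ h] := @dominated_convergence _ _ _ mu `[s, t] (measurable_itv _) f_ _ _ mf (measurable_cst _) ff isp dom.
rewrite integral0 in h; rewrite /thin.
exact: (fine_cvg h).
Qed.

End interval_mass.

(** * Transport of mass *)

Section oscillation.
Variable R : realType.
Notation mu := (@lebesgue_measure R).
Variable a : R * R -> R.
Notation osc := (osc a).
Implicit Types (d z r : R).

Lemma osc_le r d z l u : good_time a r -> 0 < d ->
  {ae mu, forall x, z - d < x < z + d -> l <= a (x, r) <= u} -> osc d z r <= u - l.
Proof.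
move=> gr d0 h; have [sE iE _ _ _] := good_ball_bounds z gr d0.
rewrite /osc lerB//.
  rewrite -lee_fin -sE; apply/ess_sup_ball_leP; move: h; apply: ae_imp => x hx /hx/andP[_].
  by rewrite ext_fieldE ?gr.1// lee_fin.
rewrite -lee_fin -iE; apply/ess_inf_ball_geP; move: h; apply: ae_imp => x hx /hx/andP[+ _].
by rewrite ext_fieldE ?gr.1// lee_fin.
Qed.

Lemma osc_ge0 r d z : good_time a r -> 0 < d -> 0 <= osc d z r.
Proof. by move=> gr d0; have [_ _ _ h _] := good_ball_bounds z gr d0; rewrite subr_ge0. Qed.

Lemma osc_mono r d d' z : good_time a r -> 0 < d -> d <= d' -> osc d z r <= osc d' z r.
Proof.
move=> gr d0 dd; have [] := @good_mono _ a r z z d' d gr d0; [lra|lra|].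
by move=> h1 h2; exact: lerB.
Qed.

Definition rough k r z := forall n, harmonic k <= osc (harmonic n) z r.

Lemma harmonic_le (m n : nat) : (m <= n)%N -> harmonic n <= harmonic m :> R.
Proof. by move=> mn; rewrite /= lef_pV2 ?posrE ?ltr0n// ler_nat. Qed.

Lemma smooth_point r z : good_time a r -> (forall k, ~ rough k r z) ->
  (fun n => osc (harmonic n) z r) @ \oo --> 0.
Proof.
move=> gr h; apply/cvgrPdist_lt => e e0.
have [k ke] : exists k, harmonic k < e :> R.
  have /cvgrPdist_lt/(_ _ e0)[k _ hk] := @cvg_harmonic R.
  by exists k; have := hk k (leqnn k); rewrite sub0r normrN gtr0_norm// harmonic_gt0.
have /existsNP[n /negP] := h k; rewrite -ltNge => hn.
exists n => // m /= nm; rewrite sub0r normrN ger0_norm ?osc_ge0 ?harmonic_gt0//.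
apply: (le_lt_trans _ (lt_trans hn ke)); by apply: osc_mono => //; exact: harmonic_le.
Qed.

(* Only right limits matter: a rough point is isolated from the right among
   the points of the same roughness. *)
Lemma rough_countable r : good_time a r -> has_one_sided_limits (fun x => a (x, r)) ->
  countable [set z | exists k, rough k r z].
Proof.
move=> gr [b [ba bl]].
(* On ]z, q[ the representative b is nearly constant at scale k, so a second k-rough point cannot
   lie there: each of these countably many sets has at most one element. *)
pose A (kq : nat * rat) := [set z | rough kq.1 r z /\ z < ratr kq.2 /\
  exists L, forall x, z < x -> x < ratr kq.2 -> `|b x - L| <= harmonic kq.1 / 4].
apply: (@sub_countable _ _ _ (\bigcup_(kq in setT) A kq)).
  apply: subset_card_le => z [k hk].
  have [_ /cvg_ex[L hL]] := bl z.
  have e0 : 0 < harmonic k / 4 :> R by rewrite divr_gt0// harmonic_gt0.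
  have /cvgrPdist_le/(_ _ e0) := hL.
  rewrite near_withinE => -[d /= d0 hd].
  have zd : z < z + d by rewrite ltrDl.
  have [q] := rat_in_itvoo zd; rewrite in_itv/= => /andP[zq qd].
  exists (k, q) => //=; split => //; split => //; exists L => x zx xq.
  by rewrite distrC; apply: hd => //=; rewrite ltr_norml; apply/andP; split; lra.
apply: bigcup_countable; first exact: countableP.
move=> [k q] _ /=.
have one z z' : A (k, q) z -> A (k, q) z' -> z < z' -> False.
  move=> [_ [_ [L hL]]] [rz [/= zq _]] zz.
  have m0 : 0 < Num.min (z' - z) (ratr q - z') by rewrite lt_min !subr_gt0 zz.
  have /cvgrPdist_lt/(_ _ m0)[n _ hn] := @cvg_harmonic R.
  have := hn n (leqnn n); rewrite sub0r normrN gtr0_norm ?harmonic_gt0// lt_min => /andP[n1 n2].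
  have := rz n; rewrite leNgt => /negP; apply.
  have k0 := @harmonic_gt0 R k.
  (* Values within a quarter of [harmonic k] of L oscillate by at most a half of it, against
     roughness. *)
  apply: (@le_lt_trans _ _ ((L + harmonic k / 4) - (L - harmonic k / 4))).
    apply: osc_le => //; first exact: harmonic_gt0.
    move: ba; apply: ae_imp => x <- /andP[x1 x2].
    have : `|b x - L| <= harmonic k / 4.
      apply: hL; first by apply: (lt_trans _ x1); rewrite ltrBrDl -ltrBrDr.
      by apply: (lt_trans x2); rewrite -ltrBrDl.
    by rewrite ler_distl.
  suff gen (h l : R) : 0 < h -> l + h / 4 - (l - h / 4) < h by exact: gen.
  by move=> h0; clear -h0; lra.
have [->|/set0P[z Az]] := eqVneq (A (k, q)) set0; first exact: countable0.
rewrite (_ : A (k, q) = [set z]); first exact: countable1.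
apply/seteqP; split=> z' /=; last by move=> ->.
by move=> Az'; case: (ltgtP z z') => // h; [have := one _ _ Az Az' h|have := one _ _ Az' Az h].
Qed.

End oscillation.

(** * Curves labelled by their end points *)

Section thin_backward.
Variable R : realType.
Notation mu := (@lebesgue_measure R).
Variables (a : R * R -> R) (X : R -> R -> R -> R).
Hypothesis ha : L1loc_Linfty a.
Hypothesis uX : unique_filippov_flow a X.
Hypothesis hlim : {ae mu, forall t : R, 0 < t -> has_one_sided_limits (fun x => a (x, t))}.
Variables s t : R.
Hypotheses (s0 : 0 <= s) (st : s <= t).

Let hX : filippov_flow a X := uX.1.

(** An arbitrary choice among the starting points that reach y at time t; trajectories may merge, so
    there can be several. *)
Definition flow_inv y : R := projT1 (cid (flow_surj ha uX y s0 st)).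

Lemma flow_invK y : X t (flow_inv y) s = y.
Proof. by rewrite /flow_inv; case: cid. Qed.

(** Equality at some time r would persist until t, where the positions are y and y'. Injectivity at
    every intermediate time follows. *)
Lemma flow_inv_lt y y' r : s <= r -> r <= t -> y < y' ->
  X r (flow_inv y) s < X r (flow_inv y') s.
Proof. by move=> sr rt yy; apply: (flow_lt uX s0 sr rt); rewrite !flow_invK. Qed.

Lemma measurable_flow_inv : measurable_fun setT flow_inv.
Proof.
apply: nondecreasing_measurable => // y y'; rewrite le_eqVlt => /predU1P[->//|yy].
by have := flow_inv_lt (lexx s) st yy; rewrite !(flow_id hX)// => /ltW.
Qed.

Let Xd := (fun z : R * R * R => X z.2 z.1.1 z.1.2) \_ (@flow_domain R).

Let mXd : measurable_fun setT Xd.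
Proof.
apply/(measurable_restrictT _ _).1 => //; first exact: measurable_flow_domain.
by case: hX.
Qed.

Let G (p : R * R) := Xd (flow_inv p.1, s, p.2).

Let mG : measurable_fun setT G.
Proof.
apply: (measurableT_comp mXd); apply: measurable_fun_pair => //.
apply: measurable_fun_pair => //; apply: (measurableT_comp measurable_flow_inv).
exact: measurable_fst.
Qed.

Let GE y r : s <= r -> G (y, r) = X r (flow_inv y) s.
Proof. by move=> sr; rewrite /G /Xd patchE ifT// inE /flow_domain/= s0. Qed.

(** Pairs of an end point and a time at which the curve sits on a rough point. The strip in time
    restricts to where [G] is the curve, and countable operations make the set measurable. *)
Let N := [set p : R * R | s < p.2 /\ p.2 < t] `&`
  \bigcup_k \bigcap_n [set p | 0 <= osc a (harmonic n) (G p) p.2 - harmonic k].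

Let mN : measurable N.
Proof.
apply: measurableI.
  have -> : [set p : R * R | s < p.2 /\ p.2 < t] = setT `&` snd @^-1` `]s, t[.
    by rewrite setTI; apply/seteqP; split=> p /=; rewrite in_itv/= => /andP.
  exact: measurable_snd.
apply: bigcupT_measurable => k; apply: bigcapT_measurable => n.
apply: measurable_pos; apply: measurable_funB => //.
have mp : measurable_fun setT (fun p : R * R => (G p, p.2)).
  exact: measurable_fun_pair.
apply: measurable_funB.
  exact: (measurableT_comp (measurable_esup (harmonic n) ha.1) mp).
exact: (measurableT_comp (measurable_einf (harmonic n) ha.1) mp).
Qed.

Lemma thin_backward : {ae mu, forall y, thin a s t (fun r => X r (flow_inv y) s)}.
Proof.
have : {ae mu, forall r, {ae mu, forall y, ~ N (y, r)}}.
  move: (good_time_ae ha) hlim; apply: ae_imp2 => r gr hr.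
  have [sr|rs] := ltP s r; last by apply: nearW => y -[[/= + _] _]; rewrite ltNge rs.
  have [rt|tr] := ltP r t; last by apply: nearW => y -[[/= _ +] _]; rewrite ltNge tr.
  have r0 := le_lt_trans s0 sr.
  pose B := [set y | exists k, rough a k r (X r (flow_inv y) s)].
  have cB : countable B.
    have inj : {in B &, injective (fun y => X r (flow_inv y) s)}.
      move=> y y' _ _ e; case: (ltgtP y y') => // h.
        by have := flow_inv_lt (ltW sr) (ltW rt) h; rewrite e ltxx.
      by have := flow_inv_lt (ltW sr) (ltW rt) h; rewrite e ltxx.
    rewrite -(eq_countable (inj_card_eq inj)).
    apply: (sub_countable _ (rough_countable (gr (ltW r0)) (hr r0))).
    by apply: subset_card_le => _ [y [k hk] <-]; exists k.
  exists B; split.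
  - exact: countable_measurable.
  - exact: countable_lebesgue_measure0.
  - move=> y /= /contrapT [_ [k _ hk]]; exists k => n; have := hk n I.
    by rewrite /= GE ?(ltW sr)// subr_ge0.
move=> h; have := @ae_prod_null _ _ _ _ _ mu mu N mN h; apply: ae_imp => y hy.
apply: thin_of_ae => //; first exact: flow_curve.
move: (good_time_ae ha) hy; apply: ae_imp2 => r gr hr /andP[sr rt].
apply: smooth_point; first exact: gr (le_trans s0 (ltW sr)).
move=> k hk; apply: hr; split => //; exists k => // n _ /=.
by rewrite GE ?(ltW sr)// subr_ge0; exact: hk.
Qed.

End thin_backward.

(** Near each tag f varies by at most e/2 from its value there. When two intervals are joined at y,
    pairs on both sides of y are compared through [f y]. *)
Lemma heine (R : realType) (f : R -> R) (s t e : R) : continuous f -> s <= t -> 0 < e ->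
  exists2 d, 0 < d & forall x y, s <= x -> x <= y -> y <= t -> y - x < d -> `|f x - f y| <= e.
Proof.
move=> cf st e0; have e2 : 0 < e / 2 by rewrite divr_gt0.
have loc x : exists2 d, 0 < d & forall y, `|x - y| < d -> `|f x - f y| <= e / 2.
  by have /cvgrPdist_le/(_ _ e2)/nbhs_ballP[d d0 hd] := cf x; exists d.
pose D u v := exists2 d, 0 < d & forall x y, u <= x -> x <= y -> y <= v -> y - x < d -> `|f x - f y| <= e.
apply: (@cousin _ D) => //.
  move=> x _; have [d d0 hd] := loc x; exists d => // u v _ ux xv _ uvd.
  exists 1 => // y z uy yz zv _.
  rewrite (splitr e) (le_trans (ler_distD (f x) _ _))// lerD//.
    by rewrite distrC; apply: hd; rewrite ltr_norml; apply/andP; split; lra.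
  by apply: hd; rewrite ltr_norml; apply/andP; split; lra.
move=> x y z sx xy yz zt [d1 d10 h1] [d2 d20 h2]; have [d d0 hd] := loc y.
exists (Num.min d (Num.min d1 d2)); first by rewrite !lt_min d0 d10.
move=> p q xp pq qz; rewrite !lt_min => /and3P[pqd pq1 pq2].
have [qy|yq] := leP q y; first exact: h1.
have [yp|py] := leP y p; first exact: h2.
rewrite (splitr e) (le_trans (ler_distD (f y) _ _))// lerD//.
  by rewrite distrC; apply: hd; rewrite ltr_norml; apply/andP; split; lra.
by apply: hd; rewrite ltr_norml; apply/andP; split; lra.
Qed.

(** * From interval masses to continuous test functions *)

Section localized.
Variable R : realType.
Notation mu := (@lebesgue_measure R).
Variables (a v : R * R -> R) (v0 : R -> R) (w : R -> R -> R).
Hypothesis ha : L1loc_Linfty a.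
Hypothesis hw : weak_star_representative v v0 w.
Variable M : R.
Hypothesis M0 : 0 <= M.
Hypothesis vM : {ae mu, forall t, {ae mu, forall x, `|ext_density v (x, t)| <= M}}.
Notation P := (pairing w).
Implicit Types (p q m x r : R).

Lemma indic_itvco p q x : \1_(`[p, q[) x = ((p <= x)%R && (x < q)%R)%:R :> R.
Proof. by rewrite indicE mem_setE in_itv. Qed.

Lemma indic_itvco_split p m q x : p <= m -> m <= q ->
  \1_(`[p, q[) x = \1_(`[p, m[) x + \1_(`[m, q[) x :> R.
Proof.
move=> pm mq; rewrite !indic_itvco; case: (leP m x) => mx /=.
  by rewrite (le_trans pm mx) add0r.
by rewrite addr0 (lt_le_trans mx mq).
Qed.

Variables (f : R -> R) (C : R).
Hypotheses (mf : measurable_fun setT f) (fC : forall x, `|f x| <= C).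

Lemma integrable_localized p q : mu.-integrable setT (EFin \o (fun x => \1_(`[p, q[) x * f x)).
Proof.
apply: (@integrableR_le _ _ _ mu _ _ _ (fun x => C * \1_(`[p, q[) x)) => //.
- by apply: measurable_funM => //; apply: measurable_indic.
- by move=> x _; rewrite normrM mulrC [X in _ * X]ger0_norm indic_itvco// ler_wpM2r.
- by apply: integrableRZ => //; exact: integrable_indic_itvco.
Qed.

Lemma localized_split p m q r : 0 <= r -> p <= m -> m <= q ->
  P (fun x => \1_(`[p, q[) x * f x) r =
  P (fun x => \1_(`[p, m[) x * f x) r + P (fun x => \1_(`[m, q[) x * f x) r.
Proof.
move=> r0 pm mq; have := pairingD hw 1 r0 (integrable_localized p m) (integrable_localized m q).
rewrite mul1r => <-; congr pairing; apply/funext => x.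
by rewrite (indic_itvco_split x pm mq) mulrDl mul1r.
Qed.

Lemma localized_cst p q c e r : 0 <= r -> p <= q -> 0 <= e ->
  (forall x, p <= x -> x < q -> `|f x - c| <= e) ->
  `|P (fun x => \1_(`[p, q[) x * f x) r - c * P (\1_(`[p, q[)) r| <= M * (e * (q - p)).
Proof.
move=> r0 pq e0 fc.
have i1 := integrable_localized p q; have i2 := integrable_indic_itvco p q.
have := pairingD hw (- c) r0 i1 i2; rewrite mulNr => <-.
have i3 : mu.-integrable setT (EFin \o (fun x => \1_(`[p, q[) x * f x + (- c) * \1_(`[p, q[) x)).
  by apply: (integrableRD measurableT i1); exact: (integrableRZ measurableT).
apply: (le_trans (pairing_bound ha hw vM r0 i3)); rewrite ler_wpM2l//.
apply: Rint_norm_supp => // x.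
  rewrite indic_itvco; case: andP => [[px xq]|_] /=.
    by rewrite mul1r mulr1 fc.
  by rewrite mul0r mulr0 addr0 normr0.
by rewrite indic_itvco => -[xp|qx]; rewrite ?(leNgt p) ?xp ?ltNge ?(ltW qx) ?andbF/= mul0r mulr0 addr0.
Qed.

End localized.

Section transport.
Variable R : realType.
Notation mu := (@lebesgue_measure R).
Variables (a v : R * R -> R) (v0 : R -> R) (w : R -> R -> R) (X : R -> R -> R -> R).
Hypothesis ha : L1loc_Linfty a.
Hypothesis uX : unique_filippov_flow a X.
Hypothesis hlim : {ae mu, forall t : R, 0 < t -> has_one_sided_limits (fun x => a (x, t))}.
Hypothesis hv0 : Linfty v0.
Hypothesis hw : weak_star_representative v v0 w.
Hypothesis hsol : weak_solution a v v0.
Variable M : R.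
Hypothesis M0 : 0 <= M.
Hypothesis mvv : measurable_fun setT (ext_density v).
Hypothesis vM : {ae mu, forall t, {ae mu, forall x, `|ext_density v (x, t)| <= M}}.
Variables s t : R.
Hypotheses (s0 : 0 <= s) (st : s <= t).
Notation P := (pairing w).
Notation xi := (flow_inv ha uX s0 st).
Notation Y := (fun x => X t x s).
Notation good := (fun y => thin a s t (fun r => X r (xi y) s)).

Let hX : filippov_flow a X := uX.1.
Let t0 : 0 <= t := le_trans s0 st.

Lemma flow_inv_mono p q : p < q -> xi p <= xi q.
Proof.
by move=> pq; have := flow_inv_lt ha uX s0 st (lexx s) st pq; rewrite !(flow_id hX)// => /ltW.
Qed.

Lemma good_mass p q : good p -> good q -> p < q ->
  P (\1_(`[p, q[)) t = P (\1_(`[xi p, xi q[)) s.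
Proof.
move=> gp gq pq.
have := interval_mass ha hv0 hw hsol M0 mvv vM s0 st (flow_curve hX (xi p) s0) (flow_curve hX (xi q) s0) gp gq.
by rewrite !(flow_id hX)// !flow_invK; apply; [exact: flow_inv_mono|exact: ltW].
Qed.

Variables (psi : R -> R) (N : R).
Hypotheses (cpsi : continuous psi) (psi0 : forall x, N < `|x| -> psi x = 0).

Let mY : measurable_fun setT Y.
Proof. exact: (nondecreasing_measurable measurableT (flow_mono uX s0 st)). Qed.

Let mpsi : measurable_fun setT psi := continuous_measurable_fun cpsi.

Let mpsiY : measurable_fun setT (fun x => psi (Y x)).
Proof. exact: measurableT_comp mpsi mY. Qed.

Let defect p q := P (fun x => \1_(`[p, q[) x * psi x) t -
  P (fun x => \1_(`[xi p, xi q[) x * psi (Y x)) s.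

(** Psi is replaced by the constant [psi p] at both times, as the flow sends [xi p, xi q] into
    [p, q]; the remaining masses agree by [good_mass] and cancel. *)
Lemma defect_step p q e : good p -> good q -> p < q -> 0 <= e ->
  (forall x, p <= x -> x <= q -> `|psi x - psi p| <= e) ->
  `|defect p q| <= M * (e * ((q - p) + (xi q - xi p))).
Proof.
move=> gp gq pq e0 he; have [C _ hC] := vanishing_bounded cpsi psi0.
have k1 := localized_cst ha hw M0 vM mpsi hC t0 (ltW pq) e0 (fun x px xq => he x px (ltW xq)).
have k2 : `|P (fun x => \1_(`[xi p, xi q[) x * psi (Y x)) s - psi p * P (\1_(`[xi p, xi q[)) s| <=
    M * (e * (xi q - xi p)).
  apply: (localized_cst ha hw M0 vM mpsiY (C := C)) => //; first exact: flow_inv_mono.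
  move=> x px xq; apply: he.
    by rewrite -(flow_invK ha uX s0 st p); exact: (flow_mono uX s0 st).
  by rewrite -(flow_invK ha uX s0 st q); apply: (flow_mono uX s0 st); exact: ltW.
rewrite -(good_mass gp gq pq) in k2.
rewrite mulrDr mulrDr; apply: (le_trans (ler_distD (psi p * P (\1_(`[p, q[)) t) _ _)).
by apply: lerD => //; rewrite distrC.
Qed.

Lemma defect_split p m q : p < m -> m < q -> defect p q = defect p m + defect m q.
Proof.
move=> pm mq; have [C _ hC] := vanishing_bounded cpsi psi0.
have E1 := localized_split hw mpsi hC t0 (ltW pm) (ltW mq).
have E2 := localized_split hw mpsiY (fun x => hC (Y x)) s0 (flow_inv_mono pm) (flow_inv_mono mq).
by rewrite /defect E1 E2 opprD addrACA.
Qed.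

Lemma good_ae : {ae mu, forall y, good y}.
Proof. exact: thin_backward. Qed.

(** The bound is additive in the interval, so cutting into pieces shorter than the modulus d does
    not enlarge it, whatever their number. *)
Lemma defect_bound S T e : S <= T -> 0 < e -> forall p q, S <= p -> q <= T ->
  good p -> good q -> p < q -> `|defect p q| <= M * (e * ((q - p) + (xi q - xi p))).
Proof.
move=> ST e0; have [d d0 hd] := heine cpsi ST e0.
suff chain n : forall p q, S <= p -> q <= T -> good p -> good q -> p < q ->
    q - p <= n%:R * (d / 2) -> `|defect p q| <= M * (e * ((q - p) + (xi q - xi p))).
  move=> p q Sp qT gp gq pq; have d2 : 0 < d / 2 by rewrite divr_gt0.
  apply: (chain (Num.trunc ((q - p) / (d / 2))).+1) => //.
  by rewrite -ler_pdivrMr// ltW// truncnS_gt.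
elim: n => [|n IHn] p q Sp qT gp gq pq; first by rewrite mul0r subr_le0 leNgt pq.
move=> qpn; have [qpd|dqp] := ltP (q - p) d.
  apply: defect_step => //; first exact: ltW.
  move=> x px xq; rewrite distrC; apply: hd => //; first exact: le_trans qT.
  by apply: le_lt_trans qpd; rewrite lerB.
(* The node is sought in an interval because only almost every point is good. This range makes [m,
   q[ shorter than d and shortens the rest by more than d/2, which pays for one induction step. *)
have [|m /andP[m1 m2] gm] := @ae_itv_ex _ good (q - d) (q - d / 2) _ good_ae.
  by rewrite ltrD2l ltrN2 ltr_pdivrMr// mulr_natr mulr2n ltrDl.
have pm : p < m by apply: le_lt_trans m1; rewrite lerBrDr addrC -lerBrDr.
have mq : m < q by apply: (lt_trans m2); rewrite ltrBlDr ltrDl divr_gt0.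
rewrite (defect_split pm mq).
have -> : M * (e * ((q - p) + (xi q - xi p))) =
  M * (e * ((m - p) + (xi m - xi p))) + M * (e * ((q - m) + (xi q - xi m))) by ring.
apply: (le_trans (ler_normD _ _)); apply: lerD.
  apply: IHn => //; first by apply: le_trans qT; exact: ltW.
  rewrite -(lerD2r (d / 2)); apply: le_trans (_ : q - p <= _).
    by rewrite addrAC lerB// -lerBrDr ltW.
  by apply: (le_trans qpn); rewrite -natr1 mulrDl mul1r.
apply: defect_step => //; first exact: ltW.
move=> x mx xq; rewrite distrC; apply: hd => //.
- by apply: (le_trans Sp); exact: ltW.
- exact: le_trans qT.
- by apply: (le_lt_trans (_ : _ <= q - m)); rewrite ?lerB// ltrBlDr -ltrBlDl.
Qed.

Lemma pairing_transport : mu.-integrable setT (EFin \o (fun x => psi (Y x))) /\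
  P psi t = P (fun x => psi (Y x)) s.
Proof.
have [C _ hC] := vanishing_bounded cpsi psi0.
have N1 : - (`|N| + 1) - 1 < - (`|N| + 1) by rewrite ltrBlDr ltrDl.
have N2 : `|N| + 1 < `|N| + 1 + 1 by rewrite ltrDl.
(* Good nodes on either side of the support of psi: localizing to [p, q[ then changes neither psi
   nor, by monotonicity, its composition with the flow. *)
have [p /andP[p1 p2] gp] := ae_itv_ex N1 good_ae.
have [q /andP[q1 q2] gq] := ae_itv_ex N2 good_ae.
have NN := ler_norm N; have N0 := normr_ge0 N.
have pq : p < q by apply: (lt_trans p2); apply: lt_trans q1; rewrite gtrN// ltr_wpDl.
have out x : x <= p \/ q <= x -> psi x = 0.
  move=> xpq; apply: psi0; apply: (le_lt_trans NN); rewrite ltr_normr.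
  by case: xpq => h; apply/orP; [right|left]; lra.
have E1 : psi = (fun x => \1_(`[p, q[) x * psi x).
  apply/funext => x; rewrite indic_itvco; case: (leP p x) => px /=; last by rewrite out ?mulr0//; left; exact: ltW.
  by case: (ltP x q) => xq; rewrite ?mul1r// out ?mulr0//; right.
have E2 : (fun x => psi (Y x)) = (fun x => \1_(`[xi p, xi q[) x * psi (Y x)).
  apply/funext => x; rewrite indic_itvco; case: (leP (xi p) x) => px /=; last first.
    by rewrite mul0r out//; left; have := flow_mono uX s0 st (ltW px); rewrite flow_invK.
  case: (ltP x (xi q)) => xq; rewrite ?mul1r// out ?mulr0//; right.
  by have := flow_mono uX s0 st xq; rewrite flow_invK.
split; first by rewrite E2; exact: (integrable_localized mpsiY (fun x => hC (Y x))).
apply/eqP; rewrite -subr_eq0 -normr_le0; rewrite [X in P X t]E1 E2.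
apply/ler_addgt0Pr => e e0; rewrite add0r.
set L := (q - p) + (xi q - xi p).
have L0 : 0 <= L by rewrite addr_ge0// subr_ge0 ?flow_inv_mono// ltW.
have ML : 0 < M * L + 1 by rewrite ltr_wpDl// mulr_ge0.
(* The nodes, hence L, are fixed before e, so the oscillation allowed on each piece can be e/(M L +
   1). *)
apply: (le_trans (defect_bound (ltW pq) (divr_gt0 e0 ML) (lexx p) (lexx q) gp gq pq)).
by rewrite -/L mulrCA mulrAC ler_pdivrMr// ler_wpM2l ?ltW// ltrDl.
Qed.

End transport.

Lemma compactly_supported_vanish (R : realType) (f : R -> R) : compactly_supported f ->
  exists N, forall x, N < `|x| -> f x = 0.
Proof.
move=> /compact_bounded[N [_ hN]]; exists (N + 1) => x xN.
apply: contrapT => /eqP fx; have N1 : N < N + 1 by rewrite ltrDl.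
have sx : closure [set z | f z != 0] x by exact: subset_closure.
by have /= := hN _ N1 x sx; rewrite leNgt xN.
Qed.

Theorem theorem6p1 (R : realType) (a : R * R -> R) (X : R -> R -> R -> R)
    (v : R * R -> R) (v0 : R -> R) (w : R -> R -> R)
    (ha : L1loc_Linfty a)
    (hX : unique_filippov_flow a X)
    (hlim : {ae @lebesgue_measure R, forall t : R, 0 < t ->
               has_one_sided_limits (fun x => a (x, t))})
    (hv0 : Linfty v0)
    (hv : Linfty_halfplane v)
    (hsol : weak_solution a v v0)
    (hw : weak_star_representative v v0 w) :
  (forall t : R, 0 <= t -> is_pushforward (fun x => X t x 0) v0 (w t)) /\
  (forall s t : R, 0 <= s -> s <= t ->
     is_pushforward (fun x => X t x s) (w s) (w t)).
Proof.
have [mvv [M M0 vM]] := density_bound hv.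
have EE r h : 0 <= r -> (@lebesgue_measure R).-integrable setT (EFin \o h) ->
    (\int[@lebesgue_measure R]_x (w r x * h x)%:E = (pairing w h r)%:E)%E.
  move=> r0 ih; have i2 := integrable_pairing hw r0 ih.
  by rewrite /pairing /Rintegral fineK//; exact: (integrable_fin_num measurableT i2).
have mY s t : 0 <= s -> s <= t -> measurable_fun setT (fun x => X t x s).
  by move=> s0 st; exact: (nondecreasing_measurable measurableT (flow_mono hX s0 st)).
have push s t : 0 <= s -> s <= t -> is_pushforward (fun x => X t x s) (w s) (w t).
  move=> s0 st; split; first exact: mY.
  move=> psi cpsi /compactly_supported_vanish[N hN].
  have [i1 E] := pairing_transport ha hX hlim hv0 hw hsol M0 mvv vM s0 st cpsi hN.
  by rewrite !EE ?E//; [exact: le_trans st|exact: integrable_vanishing hN].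
split=> // t t0; split; first exact: mY.
(* For s = 0 only the passage from [w 0] to [v0] remains; they agree almost everywhere. *)
move=> psi cpsi spsi; rewrite ((push 0 t (lexx 0) t0).2 psi cpsi spsi).
have [hwt _ w0 _] := hw.
have [mw _] := Linfty_bound (hwt 0 (lexx 0)); have [mv0 _] := Linfty_bound hv0.
have mpsiY : measurable_fun setT (fun x => psi (X t x 0)).
  exact: measurableT_comp (continuous_measurable_fun cpsi) (mY 0 t (lexx 0) t0).
apply: ae_eq_integral => //.
- by apply/measurable_EFinP; exact: measurable_funM.
- by apply/measurable_EFinP; exact: measurable_funM.
- by move: w0; apply: ae_imp => x -> _.
Qed.
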